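(* Let $\mathcal X\subset\mathbb R^q$ be open, let $X_1,\dots,X_n$ be i.i.d. with distribution $\mu$ on $\mathcal X$, let $\mu_n=\frac1n\sum_{i=1}^n\delta_{X_i}$, let $\Theta\subset\mathbb R^d$, let $\Phi:\Theta\times\mathcal X\to\mathbb R^k$ with $k\ge d$, and let $\Phi_m:\Theta\times\mathcal X\to\mathbb R^k$, $m\in\mathbb N$, be an observed sequence of approximations of $\Phi$, independent of the sample $X_1,\dots,X_n$. Suppose that: (1) $\Theta$ is compact. (2) $\theta\mapsto\int\Phi(\theta,x)\,d\mu(x)$ is continuous on $\Theta$ and has a unique zero $\theta_0$, which lies in the interior of $\Theta$. (3) For all $x\in\mathcal X$, $\theta\mapsto\Phi(\theta,x)$ is continuous on $\Theta$, and $x\mapsto\sup_{\theta\in\Theta}\Vert\Phi(\theta,x)\Vert$ is bounded by a $\mu$-integrable function. (4) There is a neighborhood $\mathcal N$ of $\theta_0$ such that, for all $x\in\mathcal X$, $\theta\mapsto\Phi(\theta,x)$ is twice continuously differentiable on $\mathcal N$, and $\Vert\nabla\Phi(\theta,x)\Vert$ and $\Vert\partial^2\Phi(\theta,x)/\partial\theta\partial\theta^t\Vert$ are continuous and bounded, for $\theta\in\mathcal N$, by a $\mu$-integrable function of $x$. (5) $D=\int\nabla\Phi(\theta_0,x)\,d\mu(x)\in\mathbb R^{d\times k}$ and $V=\int\Phi(\theta_0,x)\Phi^t(\theta_0,x)\,d\mu(x)\in\mathbb R^{k\times k}$ are of full rank. (6) $\Vert\Phi(\cdot,x)\Vert_\Theta$,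 $\Vert\nabla\Phi(\cdot,x)\Vert_{\mathcal N}$ and $\Vert\partial^2\Phi(\cdot,x)/\partial\theta\partial\theta^t\Vert_{\mathcal N}$ are dominated by a function $\kappa(x)$ such that $\int\kappa^{12}\,d\mu<\infty$. (7) For a given sequence $(\varphi_m)_{m\in\mathbb N}$ tending to infinity, $\varphi_m\Vert\Phi_m(\cdot,x)-\Phi(\cdot,x)\Vert_\Theta$ and $\varphi_m\Vert\nabla\Phi_m(\cdot,x)-\nabla\Phi(\cdot,x)\Vert_{\mathcal N}$ are dominated by a function $\kappa_m(x)$ such that $\sup_m\int\kappa_m^{12}\,d\mu<\infty$. (8) The random map $\theta\mapsto\hat W(\theta)$ is differentiable on $\mathcal N$, and $\mathbb E[(\sqrt n\Vert\hat W-W\Vert_\Theta)^6]$, $\mathbb E[(\sqrt n\Vert\nabla\hat W-\nabla W\Vert_{\mathcal N})^6]$ and $\mathbb E[(\varphi_m\Vert\hat W_m-\hat W\Vert_\Theta)^3]$ are bounded as $m,n$ range over $\mathbb N$. (9) $\hat W(\cdot)$ and $W(\cdot)$ are twice continuously differentiable on $\mathcal N$ and, for all $\eta>0$, $\mathbb P(\Vert d^2\hat W/d\theta d\theta^t-d^2W/d\theta d\theta^t\Vert_{\mathcal N}>\eta)=o(n^{-1})$; moreover $\hat W_m(\cdot)$ is differentiable on $\mathcal N$ and $\mathbb E[(\varphi_m\Vert\nabla\hat W_m-\nabla\hat W\Vert_{\mathcal N})^3]$ is bounded as $m,n$ range over $\mathbb N$. Let $\hat\theta_m$ and $\hat\theta$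 be the continuous updating (CUE) estimators obtained with the constraint functions $\Phi_m$ and $\Phi$ respectively. Then, as $n$ and $m$ tend to infinity, $$n\,\mathbb E\big[\Vert\hat\theta_m-\hat\theta\Vert^2\big]=O(n\varphi_m^{-2})+o(1).$$ In particular, $\hat\theta_m$ is $\sqrt n$-consistent and asymptotically efficient if $n/\varphi_m^2$ tends to zero.
   Context: $\Vert\cdot\Vert$ denotes any norm on a Euclidean space; for $f:\Theta\to E$ with $E$ Euclidean and $\mathcal S\subseteq\Theta$, $\Vert f\Vert_{\mathcal S}=\sup_{\theta\in\mathcal S}\Vert f(\theta)\Vert$. $\nabla$ denotes the derivative in $\theta$; $\nabla\Phi(\theta,x)$ is the $d\times k$ matrix with $(i,j)$ entry $\partial\Phi_j(\theta,x)/\partial\theta_i$. For $\theta\in\Theta$, $W(\theta)$ is the inverse (assumed to exist) of the covariance matrix of $\Phi(\theta,X)$, $X\sim\mu$: $$W(\theta)=\Big[\int\Phi(\theta,\cdot)\Phi^t(\theta,\cdot)\,d\mu-\int\Phi(\theta,\cdot)\,d\mu\int\Phi^t(\theta,\cdot)\,d\mu\Big]^{-1}.$$ $\hat W(\theta)$ is an arbitrary consistent estimator of $W(\theta)$ built from the observations $X_1,\dots,X_n$ and the constraint function $\Phi(\theta,\cdot)$; $\hat W_m(\theta)$ is obtained by replacing $\Phi$ by $\Phi_m$ in the expression of $\hat W(\theta)$. CUE estimators: $\hat\theta_m$ is a minimizer over $\Theta$ of $\theta\mapsto\big[\int\Phi_m^t(\theta,\cdot)\,d\mu_n\big]\hat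 W_m(\theta)\big[\int\Phi_m(\theta,\cdot)\,d\mu_n\big]$, and $\hat\theta$ is a minimizer over $\Theta$ of $\theta\mapsto\big[\int\Phi^t(\theta,\cdot)\,d\mu_n\big]\hat W(\theta)\big[\int\Phi(\theta,\cdot)\,d\mu_n\big]$. Asymptotically efficient means that the asymptotic variance of the estimator of $\theta_0$ (the limit of $n$ times its variance) equals the efficiency bound $B=[DV^{-1}D^t]^{-1}$. *)

(* Defs.v *)
From HB Require Import structures.
From mathcomp Require Import all_boot all_order all_algebra.
From mathcomp Require Import all_classical all_reals all_analysis.
From mathcomp Require Import measurable_realfun.

Set Implicit Arguments.
Unset Strict Implicit.
Unset Printing Implicit Defensive.

Import Order.TTheory GRing.Theory Num.Theory.
Import numFieldNormedType.Exports.

Local Open Scope classical_set_scope.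
Local Open Scope ring_scope.

(* Vectors of R^p are rows 'rV[R]_p, so that the library's [jacobian f t] is
   the matrix with entry (i, j) equal to d f_j / d t_i.  Maps that are only
   meaningful on a subset of R^p are total, with irrelevant values outside. *)

(* Borel sigma-algebra on the spaces of matrices, hence of row vectors. *)
HB.instance Definition _ (R : realType) (m n : nat) :=
  Measurable.copy 'M[R]_(m, n) (g_sigma_algebraType (@open 'M[R]_(m, n))).

Section analysis.
Context {R : realType}.

Definition is_norm (V : lmodType R) (N : V -> R) : Prop :=
  [/\ forall x y, N (x + y) <= N x + N y,
      forall (a : R) x, N (a *: x) = `|a| * N x &
      forall x, N x = 0 -> x = 0].

(* [nrm] is a family consisting of one norm per matrix space; the supremum is
   extended-real, so it is +oo when f is unbounded on S. *)
Definition supnorm (nrm : forall m n, 'M[R]_(m, n) -> R) {U : Type}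
    {m n : nat} (S : set U) (f : U -> 'M[R]_(m, n)) : \bar R :=
  ereal_sup [set (nrm m n (f t))%:E | t in S].

Definition supdist (nrm : forall m n, 'M[R]_(m, n) -> R) {U : Type}
    {m n : nat} (S : set U) (f g : U -> 'M[R]_(m, n)) : \bar R :=
  supnorm nrm S (fun t => f t - g t).

(* Matrix-valued maps are differentiated after flattening their values. *)
Definition vec {U : Type} {m n : nat} (f : U -> 'M[R]_(m, n)) :
    U -> 'rV[R]_(m * n) :=
  fun t => mxvec (f t).

(* Entry (i, mxvec_index j l) is d^2 f_l / d t_i d t_j. *)
Definition hessian {d p : nat} (f : 'rV[R]_d -> 'rV[R]_p) :
    'rV[R]_d -> 'M[R]_(d, d * p) :=
  jacobian (vec (jacobian f)).

(* The next two notions are meant for an open set N. *)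
Definition differentiable_on {d p : nat} (N : set 'rV[R]_d)
    (f : 'rV[R]_d -> 'rV[R]_p) : Prop :=
  forall t, N t -> differentiable f t.

Definition twice_continuously_differentiable_on {d p : nat}
    (N : set 'rV[R]_d) (f : 'rV[R]_d -> 'rV[R]_p) : Prop :=
  [/\ differentiable_on N f,
      differentiable_on N (vec (jacobian f)) &
      forall t, N t -> {for t, continuous (hessian f)}].

Definition is_minimizer {U : Type} (S : set U) (f : U -> R) (t : U) : Prop :=
  S t /\ forall s, S s -> f t <= f s.

End analysis.

Section probability.
Context {R : realType}.

Definition mx_integral {dT} {T : measurableType dT} {m n : nat}
    (mu : {measure set T -> \bar R}) (D : set T) (F : T -> 'M[R]_(m, n)) :
    'M[R]_(m, n) :=
  \matrix_(i, j) \int[mu]_(x in D) F x i j.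

(* Covariance matrix of f(X) for X ~ mu; as f is row-valued, the column
   product f f^t reads f^T *m f. *)
Definition covariance_mx {dT} {T : measurableType dT} {k : nat}
    (mu : {measure set T -> \bar R}) (D : set T) (f : T -> 'rV[R]_k) :
    'M[R]_k :=
  mx_integral mu D (fun x => (f x)^T *m f x)
  - (mx_integral mu D f)^T *m mx_integral mu D f.

(* Variance matrix of a random vector, from the library's covariance. *)
Definition variance_mx {dO} {Omega : measurableType dO} {d : nat}
    (P : probability Omega R) (Z : Omega -> 'rV[R]_d) : 'M[R]_d :=
  \matrix_(i, j) fine (covariance P (fun w => Z w 0 i) (fun w => Z w 0 j)).

(* X is an i.i.d. sequence with distribution mu.  Since some of the A i may be
   the full set, initial segments account for all finite subfamilies. *)
Definition iid {dO dT} {Omega : measurableType dO} {T : measurableType dT}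
    (P : probability Omega R) (X : nat -> {RV P >-> T})
    (mu : probability T R) : Prop :=
  (forall i A, measurable A -> distribution P (X i) A = mu A) /\
  (forall (n : nat) (A : nat -> set T), (forall i, measurable (A i)) ->
     P (\bigcap_(i in `I_n) (X i @^-1` A i))
     = (\prod_(i < n) P (X i @^-1` A i))%E).

(* Y is independent of the whole sequence X: the product rule is required on
   a pi-system generating the sigma-algebra of X. *)
Definition independent_of_sequence {dO dS dT} {Omega : measurableType dO}
    {S : measurableType dS} {T : measurableType dT} (P : probability Omega R)
    (Y : {RV P >-> S}) (X : nat -> {RV P >-> T}) : Prop :=
  forall (n : nat) (B : set S) (A : nat -> set T),
    measurable B -> (forall i, measurable (A i)) ->
    P ((Y @^-1` B) `&` \bigcap_(i in `I_n) (X i @^-1` A i))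
    = (P (Y @^-1` B) * P (\bigcap_(i in `I_n) (X i @^-1` A i)))%E.

Definition sample {dO dT} {Omega : measurableType dO} {T : measurableType dT}
    {P : probability Omega R} (X : nat -> {RV P >-> T}) (n : nat)
    (w : Omega) : n.-tuple T :=
  [tuple X i w | i < n].

(* Integral of f against the empirical measure of the sample s. *)
Definition empirical_mean {T : Type} {n k : nat} (s : n.-tuple T)
    (f : T -> 'rV[R]_k) : 'rV[R]_k :=
  n%:R^-1 *: \sum_(i < n) f (tnth s i).

(* An estimator of the weight matrix: for each sample size, an expression in
   the observations and the constraint function Phi(theta, .). *)
Definition weight_estimator (T : Type) (k : nat) : Type :=
  forall n : nat, n.-tuple T -> (T -> 'rV[R]_k) -> 'M[R]_k.

Definition cue_objective {T : Type} {d k n : nat}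
    (What : weight_estimator T k) (s : n.-tuple T)
    (Phi : 'rV[R]_d -> T -> 'rV[R]_k) (t : 'rV[R]_d) : R :=
  (empirical_mean s (Phi t) *m What n s (Phi t)
     *m (empirical_mean s (Phi t))^T) 0 0.

(* The p-th moments of the variables Z i, i in D, exist and are bounded. *)
Definition bounded_moments {dO} {Omega : measurableType dO}
    (P : probability Omega R) {I : Type} (D : set I) (p : nat)
    (Z : I -> Omega -> \bar R) : Prop :=
  (forall i, D i -> measurable_fun [set: Omega] (Z i)) /\
  exists C : R, forall i, D i -> (\int[P]_w (Z i w) ^+ p <= C%:E)%E.

(* The regimes "n and m tend to infinity" are filters F on pairs (n, m). *)
Definition root_n_consistent {dO} {Omega : measurableType dO}
    (P : probability Omega R) {d : nat} (nrm : 'rV[R]_d -> R)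
    (F : set_system (nat * nat)) (est : nat -> nat -> Omega -> 'rV[R]_d)
    (theta0 : 'rV[R]_d) : Prop :=
  forall eps : R, 0 < eps -> exists M : R,
    \forall nm \near F,
      (P [set w | M < Num.sqrt nm.1%:R * nrm (est nm.1 nm.2 w - theta0)]%R
         <= eps%:E)%E.

Definition asymptotic_variance {dO} {Omega : measurableType dO}
    (P : probability Omega R) {d : nat} (F : set_system (nat * nat))
    (est : nat -> nat -> Omega -> 'rV[R]_d) (B : 'M[R]_d) : Prop :=
  (fun nm : nat * nat => nm.1%:R *: variance_mx P (est nm.1 nm.2)) @ F --> B.

End probability.

(* Main.v *)
From HB Require Import structures.
From mathcomp Require Import all_boot all_order all_algebra.
From mathcomp Require Import all_classical all_reals all_analysis.
From mathcomp Require Import measurable_realfun.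
From mathcomp Require Import ring lra zify.
Require Import Defs.

Set Implicit Arguments.
Unset Strict Implicit.
Unset Printing Implicit Defensive.

Import Order.TTheory GRing.Theory Num.Theory.
Import numFieldNormedType.Exports.

Local Open Scope classical_set_scope.
Local Open Scope ring_scope.

(* Let Q be the quadratic criterion minimised by [thetahat], Q' the one minimised
   by [thetahatm], and L = W0 D^T (D W0 D^T)^-1 with W0 = W(theta0).  Since W is
   uniformly coercive and the mean constraint vanishes only at theta0, uniform
   closeness of the empirical mean of Phi and of What to their limits forces the
   minimisers into a small ball around theta0.  There DQ is strongly monotone: a
   point u of the ball satisfies c |u - thetahat| <= |DQ(u)|.  With u the Newton
   point theta0 - a L, a the empirical mean of Phi(theta0, .), DQ(u) is of second
   order in the fluctuations, so thetahat - theta0 + a L is quadratically small;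
   with u = thetahatm, DQ(u) = DQ(u) - DQ'(u) is O(phi_m^-1).

   In mean square, the event where closeness fails matters only through its
   probability, because Theta is bounded.  That event is reduced by a bracketing
   argument to finitely many centred empirical means, whose fourth moments are
   O(n^-2), and to the sixth moments assumed for What; so its probability is
   o(n^-1).  This gives E|thetahatm - thetahat|^2 = o(n^-1) + O(phi_m^-2), while
   -a L has variance n^-1 (D V^-1 D^T)^-1 exactly. *)

(** * Norms on matrices *)

Section norms.
Context {R : realType}.

(** The conclusion concerns n E|.|^2, so closeness in probability is not enough: on the exceptional
    event only the diameter of [Theta] bounds the error, hence its probability has to be o(n^-1). On
    the other event the Newton remainder is quadratic, so its mean square is governed by fourth
    powers of fluctuations. One random variable, [err], serves both purposes: where it is small it
    dominates the squared remainder up to a constant, and where it is not, a multiple of it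
    dominates any constant. The event of uniform closeness is therefore never measured, and suprema
    over [Theta] enter only through finitely many brackets or through the extended-real variables
    whose moments are assumed. The exact variance rests on two facts: [W theta0] inverts the
    covariance of the constraint at theta0, and a remainder whose mean square is o(n^-1) does not
    change the limit of n times a covariance. *)

Lemma ler_norm_entry m n (A : 'M[R]_(m, n)) i j : `|A i j| <= `|A|.
Proof.
rewrite [leRHS]/Num.Def.normr/= mx_normrE.
by apply: le_trans (le_bigmax _ _ (i, j)).
Qed.

Lemma norm_matrix_le m n (A : 'M[R]_(m, n)) c : 0 <= c ->
  (forall i j, `|A i j| <= c) -> `|A| <= c.
Proof.
move=> c0 Ac; rewrite [leLHS]/Num.Def.normr/= mx_normrE.
by apply: bigmax_le => //= i _; exact: Ac.
Qed.

Lemma norm_mxvec m n (A : 'M[R]_(m, n)) : `|mxvec A| = `|A|.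
Proof.
apply/eqP; rewrite eq_le; apply/andP; split; apply: norm_matrix_le => //.
  move=> i j; rewrite (ord1 i); case/mxvec_indexP: j => a b.
  by rewrite mxvecE ler_norm_entry.
by move=> i j; rewrite -mxvecE ler_norm_entry.
Qed.

Lemma norm_trmx m n (A : 'M[R]_(m, n)) : `|A^T| = `|A|.
Proof.
apply/eqP; rewrite eq_le; apply/andP; split; apply: norm_matrix_le => //.
  by move=> i j; rewrite mxE ler_norm_entry.
by move=> i j; rewrite -[A]trmxK mxE trmxK ler_norm_entry.
Qed.

Lemma norm_mulmx m n p (A : 'M[R]_(m, n)) (B : 'M[R]_(n, p)) :
  `|A *m B| <= n%:R * `|A| * `|B|.
Proof.
apply: norm_matrix_le => [|i j]; first by rewrite !mulr_ge0.
rewrite mxE (le_trans (ler_norm_sum _ _ _))//.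
rewrite -mulrA mulr_natl -[X in _ *+ X]card_ord -sumr_const ler_sum// => l _.
by rewrite normrM ler_pM// ler_norm_entry.
Qed.

Lemma is_norm0 (V : lmodType R) (N : V -> R) : is_norm N -> N 0 = 0.
Proof. by case=> _ NZ _; rewrite -(scale0r 0) NZ normr0 mul0r. Qed.

Lemma is_normN (V : lmodType R) (N : V -> R) x : is_norm N -> N (- x) = N x.
Proof. by case=> _ NZ _; rewrite -scaleN1r NZ normrN1 mul1r. Qed.

Lemma is_norm_ge0 (V : lmodType R) (N : V -> R) x : is_norm N -> 0 <= N x.
Proof.
move=> Nn; have [ND _ _] := Nn.
by have := ND x (- x); rewrite subrr is_normN// is_norm0// -mulr2n pmulrn_lge0.
Qed.

Lemma is_norm_sum (V : lmodType R) (N : V -> R) I (s : seq I) (F : I -> V) :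
  is_norm N -> N (\sum_(i <- s) F i) <= \sum_(i <- s) N (F i).
Proof.
move=> Nn; have [ND _ _] := Nn; elim/big_rec2: _ => [|i y x _ xy].
  by rewrite is_norm0.
by rewrite (le_trans (ND _ _))// lerD2l.
Qed.

Lemma lipschitz_is_continuous (V : normedModType R) (f : V -> R) C : 0 < C ->
  (forall x y, f x - f y <= C * `|x - y|) -> continuous f.
Proof.
move=> C0 fC v; apply/cvgrPdist_le => e e0; near=> u.
have : `|f v - f u| <= C * `|v - u|.
  by rewrite ler_norml fC andbT lerNl opprB (distrC v) fC.
move/le_trans; apply; rewrite -ler_pdivlMl// mulrC.
by near: u; apply: cvgr_dist_le => //; rewrite divr_gt0.
Unshelve. all: by end_near. Qed.

Lemma is_norm_le_mx_norm m n (N : 'M[R]_(m, n) -> R) : is_norm N ->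
  exists2 C, 0 < C & forall A, N A <= C * `|A|.
Proof.
move=> Nn; have [ND NZ N0] := Nn.
(* The summand 1 keeps the constant positive for empty matrices. *)
exists (1 + \sum_ij N (delta_mx ij.1 ij.2)) => [|A].
  by rewrite ltr_pwDl// sumr_ge0// => ij _; exact: is_norm_ge0.
rewrite [in leLHS](matrix_sum_delta A) pair_big/=.
rewrite (le_trans (is_norm_sum _ _ Nn))// mulrDl mul1r ler_wpDl// mulr_suml.
apply: ler_sum => ij _; rewrite NZ mulrC.
by rewrite ler_wpM2l ?ler_norm_entry ?is_norm_ge0.
Qed.

(** [N] is continuous, so it attains a positive minimum on the unit sphere of the max norm;
    homogeneity does the rest. Matrices are flattened because compactness and extrema are taken
    among row vectors. *)
Lemma mx_norm_le_is_norm m n (N : 'M[R]_(m, n) -> R) : is_norm N ->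
  exists2 C, 0 < C & forall A, `|A| <= C * N A.
Proof.
move=> Nn; have [ND NZ N0] := Nn; have [C C0 NC] := is_norm_le_mx_norm Nn.
pose f (v : 'rV[R]_(m * n)) := N (vec_mx v).
have fC : continuous f.
  apply: (lipschitz_is_continuous C0) => x y.
  rewrite lerBlDr /f -[in leLHS](subrK y x) linearD (le_trans (ND _ _))//.
  by rewrite lerD2r (le_trans (NC _))// -[in leRHS](vec_mxK (x - y)) norm_mxvec.
pose S := [set v : 'rV[R]_(m * n) | `|v| = 1].
have S_compact : compact S.
  apply: bounded_closed_compact.
    by exists 1; split => // M M1 v /= ->; exact: ltW.
  have -> : S = (fun v => `|v|) @^-1` [set 1 : R] by [].
  apply: closed_comp => [v _|]; first exact: norm_continuous.
  exact: closed_eq.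
(* The sphere is empty only when zero is the sole matrix, and then any constant works. *)
have [S0|/set0P[v0 Sv0]] := eqVneq S set0.
  exists 1 => // A; have [->|A0] := eqVneq A 0.
    by rewrite normr0 mul1r is_norm_ge0.
  have : S (`|A|^-1 *: mxvec A).
    rewrite /S/= normrZ norm_mxvec normfV normr_id mulVf// normr_eq0//.
  by rewrite S0.
have [v Sv vmin] : exists2 v, S v & forall u, S u -> f v <= f u.
  have [v] := EVT_min_rV (ex_intro _ v0 Sv0) S_compact (continuous_subspaceT fC).
  rewrite inE => Sv vmin.
  by exists v => // u Su; apply: vmin; rewrite inE.
have fv0 : 0 < f v.
  rewrite lt0r (is_norm_ge0 (vec_mx v) Nn) andbT; apply/eqP => /N0 /(congr1 mxvec).
  rewrite vec_mxK linear0 => v_eq0.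
  by move: Sv; rewrite /S/= v_eq0 normr0 => /esym/eqP; rewrite oner_eq0.
exists (f v)^-1 => [|A]; first by rewrite invr_gt0.
have [->|A0] := eqVneq A 0; 
  first by rewrite normr0 mulr_ge0 ?invr_ge0 ?(ltW fv0)// (is_norm_ge0 0 Nn).
have A_gt0 : 0 < `|A| by rewrite normr_gt0.
have /vmin : S (`|A|^-1 *: mxvec A).
  by rewrite /S/= normrZ norm_mxvec normfV normr_id mulVf// normr_eq0.
rewrite {2}/f linearZ/= mxvecK NZ normfV normr_id => h.
by rewrite ler_pdivlMl// mulrC -ler_pdivlMl.
Qed.

End norms.

(** * The quadratic criterion and its gradient *)

Section bilinear.
Context {R : realType}.

Definition bil m n (x : 'rV[R]_m) (M : 'M[R]_(m, n)) (y : 'rV[R]_n) : R :=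
  (x *m M *m y^T) 0 0.

Lemma bilE m n (x : 'rV[R]_m) (M : 'M[R]_(m, n)) (y : 'rV[R]_n) :
  bil x M y = \sum_j \sum_i x 0 i * M i j * y 0 j.
Proof.
by rewrite /bil mxE; apply: eq_bigr => j _; rewrite !mxE mulr_suml.
Qed.

Lemma bilDl m n (x x' : 'rV[R]_m) (M : 'M[R]_(m, n)) y :
  bil (x + x') M y = bil x M y + bil x' M y.
Proof. by rewrite /bil !mulmxDl mxE. Qed.

Lemma bilNl m n (x : 'rV[R]_m) (M : 'M[R]_(m, n)) y :
  bil (- x) M y = - bil x M y.
Proof. by rewrite /bil !mulNmx mxE. Qed.

Lemma bilDm m n (x : 'rV[R]_m) (M M' : 'M[R]_(m, n)) y :
  bil x (M + M') y = bil x M y + bil x M' y.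
Proof. by rewrite /bil mulmxDr mulmxDl mxE. Qed.

Lemma bilNm m n (x : 'rV[R]_m) (M : 'M[R]_(m, n)) y :
  bil x (- M) y = - bil x M y.
Proof. by rewrite /bil mulmxN mulNmx mxE. Qed.

Lemma bilDr m n (x : 'rV[R]_m) (M : 'M[R]_(m, n)) y y' :
  bil x M (y + y') = bil x M y + bil x M y'.
Proof. by rewrite /bil linearD/= mulmxDr mxE. Qed.

Lemma bilNr m n (x : 'rV[R]_m) (M : 'M[R]_(m, n)) y :
  bil x M (- y) = - bil x M y.
Proof. by rewrite /bil linearN/= mulmxN mxE. Qed.

Lemma norm_bil k (x : 'rV[R]_k) (M : 'M[R]_k) y :
  `|bil x M y| <= k%:R ^+ 2 * (`|x| * `|M| * `|y|).
Proof.
rewrite (le_trans (ler_norm_entry _ _ _))// (le_trans (norm_mulmx _ _))//.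
rewrite norm_trmx expr2 -!mulrA ler_wpM2l// mulrCA !mulrA.
by rewrite ler_wpM2r// -mulrA mulrCA mulrA norm_mulmx.
Qed.

Lemma norm_bil_le k (x : 'rV[R]_k) (M : 'M[R]_k) y a b c :
  `|x| <= a -> `|M| <= b -> `|y| <= c ->
  `|bil x M y| <= k%:R ^+ 2 * (a * b * c).
Proof.
move=> xa Mb yc; rewrite (le_trans (norm_bil _ _ _))// ler_wpM2l ?exprn_ge0//.
by rewrite ler_pM// ?mulr_ge0// ler_pM.
Qed.

(** The three arguments are exchanged one at a time, first [x], then [M], then [y]. This order
    explains why [x] and [y'] need bounds but [x'] and [y] do not. *)
Lemma norm_bil_sub k (x x' : 'rV[R]_k) (M M' : 'M[R]_k) y y' a b c e1 e2 e3 :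
  `|x| <= a -> `|M'| <= b -> `|y'| <= c -> `|M| <= b ->
  `|x - x'| <= e1 -> `|M - M'| <= e2 -> `|y - y'| <= e3 ->
  `|bil x M y - bil x' M' y'| <=
  k%:R ^+ 2 * (e1 * b * c + a * e2 * c + a * b * e3).
Proof.
move=> xa M'b y'c Mb e1x e2M e3y.
have -> : bil x M y - bil x' M' y' =
    bil (x - x') M' y' + bil x (M - M') y' + bil x M (y - y').
  by rewrite !(bilDl, bilDm, bilDr, bilNl, bilNm, bilNr); ring.
rewrite mulrDr mulrDr (le_trans (ler_normD _ _))// lerD ?norm_bil_le//.
by rewrite (le_trans (ler_normD _ _))// lerD ?norm_bil_le.
Qed.

End bilinear.

Section line.
Context {R : realType}.

Lemma is_derive_line (V W : normedModType R) (f : V -> W) s u (tau : R) df :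
  is_derive (s + tau *: u) u f df ->
  is_derive tau 1 (fun tau => f (s + tau *: u)) df.
Proof.
set x := s + _; set g := fun tau : R => _.
have E : (fun h : R => h^-1 *: ((g \o shift tau) (h *: 1) - g tau)) =
         (fun h => h^-1 *: ((f \o shift x) (h *: u) - f x)).
  apply/funext => h; rewrite /g /x /= [h *: 1]mulr1 scalerDl.
  by congr (_ *: (f _ - _)); rewrite addrCA.
move=> [d1 d2]; apply: DeriveDef; first by rewrite /derivable E.
by rewrite /derive E.
Qed.

Lemma derive_eq0_at_min (V : normedModType R) (f : V -> R) t u df r : 0 < r ->
  (forall s, `|s - t| < r -> derivable f s u) ->
  (forall s, `|s - t| < r -> f t <= f s) ->
  is_derive t u f df -> df = 0.
Proof.
move=> r0 fder fmin fdf.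
(* Parameters below [e] move the point by less than [r]; the 1 avoids a division by zero when [u] is
   0. *)
pose e := r / (1 + `|u|).
have e0 : 0 < e by rewrite divr_gt0// ltr_pwDl.
have Nr tau : tau \in `]- e, e[%R -> `|t + tau *: u - t| < r.
  rewrite in_itv/= -ltr_norml => taue; rewrite addrAC subrr add0r normrZ.
  rewrite (@le_lt_trans _ _ (`|tau| * (1 + `|u|)))//.
    by rewrite ler_wpM2l// lerDr.
  by rewrite -ltr_pdivlMr// ltr_pwDl.
have z0 : 0 \in `]- e, e[%R by rewrite in_itv/= oppr_lt0 e0.
have h0 : is_derive (0 : R) 1 (fun tau : R => f (t + tau *: u)) 0.
  apply: (@derive1_at_min _ _ (- e) e) => //.
  - by rewrite (le_trans (ltW _) (ltW e0))// oppr_lt0.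
  - move=> tau /Nr /fder ds.
    by have [] := is_derive_line (DeriveDef ds erefl).
  - by move=> tau /Nr; rewrite scale0r addr0 => /fmin.
have h1 : is_derive (0 : R) 1 (fun tau : R => f (t + tau *: u)) df.
  by apply: is_derive_line; rewrite scale0r addr0.
by have [_ <-] := h1; have [_ ->] := h0.
Qed.

Lemma is_derive_entry d p (f : 'rV[R]_d -> 'rV[R]_p) s u j :
  differentiable f s ->
  is_derive s u (fun t => f t 0 j) ((u *m jacobian f s) 0 j).
Proof.
move=> df; have dfu := diff_derivable (v := u) df.
have /derivable_mxP/(_ 0 j) dj := dfu.
apply: DeriveDef => //; rewrite -deriveEjacobian//.
by rewrite (derive_mx dfu) mxE.
Qed.

(** The mean value theorem holds for one real coordinate at a time: the intermediate point depends
    on [j]. *)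
Lemma mean_value_entry d p (f : 'rV[R]_d -> 'rV[R]_p) s t j :
  (forall tau : R, 0 <= tau <= 1 -> differentiable f (t + tau *: (s - t))) ->
  exists2 tau : R, 0 <= tau <= 1 &
    (f s - f t) 0 j = ((s - t) *m jacobian f (t + tau *: (s - t))) 0 j.
Proof.
move=> df; pose h (tau : R) := f (t + tau *: (s - t)) 0 j.
have dh (tau : R) : 0 <= tau <= 1 ->
    is_derive tau 1 h (((s - t) *m jacobian f (t + tau *: (s - t))) 0 j).
  by move=> /df dft; apply: (@is_derive_line _ _ (fun t => f t 0 j)); exact: is_derive_entry.
have [||tau] := @MVT _ h (fun tau => ((s - t) *m jacobian f (t + tau *: (s - t))) 0 j) 0 1 ltr01.
- by move=> tau; rewrite in_itv/= => /andP[t0 t1]; apply: dh; rewrite !ltW.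
- apply: derivable_within_continuous => tau; rewrite in_itv/= => /dh[].
  by [].
rewrite in_itv/= => /andP[t0 t1]; rewrite /h scale1r scale0r addr0 subr0 mulr1.
rewrite (addrC t) subrK => E; exists tau; first by rewrite !ltW.
by rewrite !mxE in E *; rewrite E.
Qed.

(** The derivative at [s] in direction [u] of the quadratic criterion. The two outer terms stay
    separate because an estimated weight [B] need not be symmetric. *)
Definition dquad d k (a : 'rV[R]_d -> 'rV[R]_k) (B : 'rV[R]_d -> 'M[R]_k)
    (s u : 'rV[R]_d) : R :=
  bil (u *m jacobian a s) (B s) (a s)
  + bil (a s) (vec_mx (u *m jacobian (vec B) s)) (a s)
  + bil (a s) (B s) (u *m jacobian a s).

Lemma is_derive_quad d k (a : 'rV[R]_d -> 'rV[R]_k)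
    (B : 'rV[R]_d -> 'M[R]_k) s u :
  differentiable a s -> differentiable (vec B) s ->
  is_derive s u (fun t => bil (a t) (B t) (a t)) (dquad a B s u).
Proof.
move=> da dB.
(* Expanding into entries leaves sums of products of real functions, to which the product rule
   applies. *)
have -> : (fun t => bil (a t) (B t) (a t)) = (\sum_(j < k) (\sum_(i < k)
    ((fun t => a t 0 i) * (fun t => vec B t 0 (mxvec_index i j)) *
     (fun t => a t 0 j)))).
  apply/funext => t; rewrite bilE fct_sumE; apply: eq_bigr => j _.
  rewrite fct_sumE; apply: eq_bigr => i _.
  by rewrite !fctE /vec mxvecE.
have da' i := is_derive_entry u i da.
have dB' i := is_derive_entry u i dB.
apply: is_derive_eq.
rewrite /dquad !bilE -!big_split/=; apply: eq_bigr => j _.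
rewrite -!big_split/=; apply: eq_bigr => i _.
rewrite /GRing.scale/= /vec !mxvecE [vec_mx _ _ _]mxE !fctE !mxvecE /=.
ring.
Qed.

End line.

Section mean_value_inequalities.
Context {R : realType} {d p : nat}.
Variables (t0 : 'rV[R]_d) (r K : R) (f : 'rV[R]_d -> 'rV[R]_p).
Hypothesis f_diff : forall s, `|s - t0| < r -> differentiable f s.

Lemma segment_in_ball (s t : 'rV[R]_d) (tau : R) : 0 <= tau <= 1 ->
  `|s - t0| < r -> `|t - t0| < r -> `|t + tau *: (s - t) - t0| < r.
Proof.
move=> /andP[tau0 tau1] sr tr.
have -> : t + tau *: (s - t) - t0 = (1 - tau) *: (t - t0) + tau *: (s - t0).
  rewrite scalerBl scale1r addrAC -[RHS]addrA; congr (_ + _).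
  by rewrite [RHS]addrC -scalerBr opprB addrA subrK.
rewrite (le_lt_trans (ler_normD _ _))// !normrZ ger0_norm ?subr_ge0//.
rewrite ger0_norm//; have [->|tau_neq0] := eqVneq tau 0; first by rewrite subr0 mul1r mul0r addr0.
have tau_gt0 : 0 < tau by rewrite lt0r tau_neq0.
have -> : r = (1 - tau) * r + tau * r by ring.
by rewrite ler_ltD ?ltr_pM2l// ler_wpM2l ?subr_ge0// ltW.
Qed.

Lemma norm_sub_le_jacobian s t : 0 <= K ->
  (forall s, `|s - t0| < r -> `|jacobian f s| <= K) ->
  `|s - t0| < r -> `|t - t0| < r -> `|f s - f t| <= d%:R * K * `|s - t|.
Proof.
move=> K0 fK sr tr; apply: norm_matrix_le => [|i j]; first by rewrite !mulr_ge0.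
rewrite (ord1 i).
have [tau tau01 ->] := @mean_value_entry R d p f s t j
  (fun tau tau01 => f_diff (segment_in_ball tau01 sr tr)).
rewrite (le_trans (ler_norm_entry _ _ _))// (le_trans (norm_mulmx _ _))//.
rewrite mulrAC ler_wpM2r// ler_wpM2l// fK//; exact: segment_in_ball.
Qed.

Lemma norm_taylor1_le s t : 0 <= K ->
  (forall s t, `|s - t0| < r -> `|t - t0| < r ->
     `|jacobian f s - jacobian f t| <= K * `|s - t|) ->
  `|s - t0| < r -> `|t - t0| < r ->
  `|f s - f t - (s - t) *m jacobian f t| <= d%:R * K * `|s - t| ^+ 2.
Proof.
move=> K0 fK sr tr; apply: norm_matrix_le => [|i j].
  by rewrite !mulr_ge0// exprn_ge0.
rewrite (ord1 i) mxE [X in _ + X]mxE.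
have [tau /[dup] tau01 /andP[tau0 tau1] ->] := @mean_value_entry R d p f s t j
  (fun tau tau01 => f_diff (segment_in_ball tau01 sr tr)).
have -> : forall (A B : 'M[R]_(1, p)), A 0 j - B 0 j = (A - B) 0 j.
  by move=> A B; rewrite !mxE.
rewrite -mulmxBr (le_trans (ler_norm_entry _ _ _))//.
rewrite (le_trans (norm_mulmx _ _))// expr2 mulrA -!mulrA ler_wpM2l//.
rewrite [leRHS]mulrCA ler_wpM2l//.
rewrite (le_trans (fK _ _ (segment_in_ball tau01 sr tr) tr))// ler_wpM2l//.
by rewrite addrAC subrr add0r normrZ ger0_norm// ler_piMl.
Qed.

End mean_value_inequalities.

Lemma mulr_le_sqrD (R : realFieldType) (x z : R) : x * z <= z ^+ 2 + x ^+ 2.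
Proof.
rewrite -subr_ge0; have -> : z ^+ 2 + x ^+ 2 - x * z =
  ((x - z) ^+ 2 + x ^+ 2 + z ^+ 2) / 2 by field.
by rewrite divr_ge0 ?addr_ge0 ?sqr_ge0.
Qed.

Section telescoping.
Context {R : realFieldType}.

Lemma ler_norm_sub3 (x1 x2 x3 y1 y2 y3 e1 e2 e3 : R) :
  `|x1 - y1| <= e1 -> `|x2 - y2| <= e2 -> `|x3 - y3| <= e3 ->
  `|x1 + x2 + x3 - (y1 + y2 + y3)| <= e1 + e2 + e3.
Proof.
rewrite !ler_norml => /andP[? ?] /andP[? ?] /andP[? ?].
by apply/andP; split; lra.
Qed.

(** Shape of the increment of [dquad]: the two outer terms each contribute the coercive form [z] up
    to [e], the middle one only an error [f]. *)
Lemma ler_sub3 (x1 x2 x3 y1 y2 y3 z e f : R) :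
  `|x1 - y1 - z| <= e -> `|x2 - y2| <= f -> `|x3 - y3 - z| <= e ->
  2 * z - (2 * e + f) <= x1 + x2 + x3 - (y1 + y2 + y3).
Proof.
by rewrite !ler_norml => /andP[? ?] /andP[? ?] /andP[? ?]; lra.
Qed.

End telescoping.

Lemma sub_split (V : zmodType) (x y z : V) : x - z = (y - z) + (x - y).
Proof. by rewrite [RHS]addrC addrA subrK. Qed.

(** Isolates the main term [bil z W z] of an increment: first the outer factor moves at fixed [y],
    then [y - y'] is replaced by [z], then the remaining factors by their limits. *)
Lemma bil_telescope_l (R : realType) k (x x' y y' z : 'rV[R]_k) (M M' W : 'M[R]_k) :
  bil x M y - bil x' M' y' - bil z W z =
  (bil x M y - bil x' M' y) + bil x' M' (y - y' - z) +
  (bil x' M' z - bil z W z).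
Proof. by rewrite !(bilDr, bilNr); ring. Qed.

Lemma bil_telescope_r (R : realType) k (x x' y y' z : 'rV[R]_k) (M M' W : 'M[R]_k) :
  bil y M x - bil y' M' x' - bil z W z =
  (bil y M x - bil y M' x') + bil (y - y' - z) M' x' +
  (bil z M' x' - bil z W z).
Proof. by rewrite !(bilDl, bilNl); ring. Qed.

(** * Strong monotonicity of the gradient near the true parameter *)

Section quadratic_objective.
Context {R : realType} {d k : nat}.
Implicit Types (a : 'rV[R]_d -> 'rV[R]_k) (B : 'rV[R]_d -> 'M[R]_k).

(** Two kinds of bounds: [eta] measures closeness to the limits 0, [D], [W0] and will be small,
    whereas [K] bounds sizes and Lipschitz constants and may be large. *)
Record regular (t0 : 'rV[R]_d) (r K eta : R) (D : 'M[R]_(d, k)) (W0 : 'M[R]_k)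
    a B : Prop := Regular {
  reg_diff : forall s, `|s - t0| < r -> differentiable a s;
  reg_diffm : forall s, `|s - t0| < r -> differentiable (vec B) s;
  reg_a : forall s, `|s - t0| < r -> `|a s| <= eta;
  reg_J : forall s, `|s - t0| < r -> `|jacobian a s - D| <= eta;
  reg_B : forall s, `|s - t0| < r -> `|B s - W0| <= eta;
  reg_JK : forall s, `|s - t0| < r -> `|jacobian a s| <= K;
  reg_BK : forall s, `|s - t0| < r -> `|B s| <= K;
  reg_GK : forall s, `|s - t0| < r -> `|jacobian (vec B) s| <= K;
  reg_JL : forall s t, `|s - t0| < r -> `|t - t0| < r ->
    `|jacobian a s - jacobian a t| <= K * `|s - t|;
  reg_GL : forall s t, `|s - t0| < r -> `|t - t0| < r ->
    `|jacobian (vec B) s - jacobian (vec B) t| <= K * `|s - t| }.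

Variables (t0 : 'rV[R]_d) (r K eta c : R) (D : 'M[R]_(d, k)) (W0 : 'M[R]_k).
Hypotheses (K1 : 1 <= K) (eta0 : 0 <= eta) (eta1 : eta <= 1).
Hypotheses (DK : `|D| <= K) (W0K : `|W0| <= K).
Hypothesis coercive : forall u, c * `|u| ^+ 2 <= bil (u *m D) W0 (u *m D).

(** One constant above [K], [d%:R * K] and [d%:R] at once; the successor keeps it at least [K] when
    d is 0. *)
Let L := d.+1%:R * K.
Let q := k%:R ^+ 2 : R.

Let K0 : 0 <= K. Proof. exact: le_trans K1. Qed.
Let L0 : 0 <= L. Proof. by rewrite mulr_ge0. Qed.
Let KL : K <= L. Proof. by rewrite ler_peMl// ler1n. Qed.
Let L1 : 1 <= L. Proof. exact: le_trans KL. Qed.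
Let dKL : d%:R * K <= L. Proof. by rewrite ler_wpM2r// ler_nat. Qed.
Let dL : d%:R <= L.
Proof. by rewrite (le_trans _ dKL)// ler_peMr. Qed.
Let q0 : 0 <= q. Proof. by rewrite exprn_ge0. Qed.

Let normM n (u : 'rV[R]_d) (A : 'M[R]_(d, n)) x : `|A| <= x ->
  `|u *m A| <= d%:R * x * `|u|.
Proof.
by move=> Ax; rewrite (le_trans (norm_mulmx _ _))// mulrAC ler_wpM2r// ler_wpM2l.
Qed.

Let normMK n (u : 'rV[R]_d) (A : 'M[R]_(d, n)) : `|A| <= K ->
  `|u *m A| <= L * `|u|.
Proof. by move=> /(normM u) /le_trans; apply; rewrite ler_wpM2r. Qed.

Lemma norm_vec_mx m n (v : 'rV[R]_(m * n)) : `|vec_mx v| = `|v|.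
Proof. by rewrite -norm_mxvec vec_mxK. Qed.

Section one.
Variables (a : 'rV[R]_d -> 'rV[R]_k) (B : 'rV[R]_d -> 'M[R]_k).
Hypothesis reg : regular t0 r K eta D W0 a B.

Let aL s t : `|s - t0| < r -> `|t - t0| < r -> `|a s - a t| <= L * `|s - t|.
Proof.
move=> sr tr.
rewrite (le_trans (norm_sub_le_jacobian (reg_diff reg) K0 (reg_JK reg) sr tr))//.
by rewrite ler_wpM2r.
Qed.

Let BL s t : `|s - t0| < r -> `|t - t0| < r -> `|B s - B t| <= L * `|s - t|.
Proof.
move=> sr tr; rewrite -norm_mxvec linearB/=.
rewrite (le_trans (norm_sub_le_jacobian (reg_diffm reg) K0 (reg_GK reg) sr tr))//.
by rewrite ler_wpM2r.
Qed.

Let aT s t : `|s - t0| < r -> `|t - t0| < r ->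
  `|a s - a t - (s - t) *m jacobian a t| <= L * `|s - t| ^+ 2.
Proof.
move=> sr tr.
rewrite (le_trans (norm_taylor1_le (reg_diff reg) K0 (reg_JL reg) sr tr))//.
by rewrite ler_wpM2r// exprn_ge0.
Qed.

Let uJ s t : `|s - t0| < r -> `|t - t0| < r ->
  `|(s - t) *m jacobian a s - (s - t) *m jacobian a t| <= L * `|s - t| ^+ 2.
Proof.
move=> sr tr; rewrite -mulmxBr (le_trans (normM _ (reg_JL reg sr tr)))//.
by rewrite mulrA -mulrA -expr2 ler_wpM2r// exprn_ge0.
Qed.

(** In an outer term of [dquad] the factor [a s - a t] is close to [u *m D], which produces the
    coercive form; whenever another factor moves, a factor [a] of size [eta] remains, or the move
    itself is of size [eta]. *)
Let bil_expand s t : `|s - t0| < r -> `|t - t0| < r ->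
  let u := s - t in
  `|bil (u *m jacobian a s) (B s) (a s) - bil (u *m jacobian a t) (B t) (a t)
    - bil (u *m D) W0 (u *m D)| <= q * L ^+ 3 * (5 * eta + 2 * r) * `|u| ^+ 2
  /\
  `|bil (a s) (B s) (u *m jacobian a s) - bil (a t) (B t) (u *m jacobian a t)
    - bil (u *m D) W0 (u *m D)| <= q * L ^+ 3 * (5 * eta + 2 * r) * `|u| ^+ 2.
Proof.
move=> sr tr u; set Js := jacobian a s; set Jt := jacobian a t.
have u2r : `|u| <= 2 * r.
  have -> : u = (s - t0) - (t - t0) by rewrite opprB addrA subrK.
  by rewrite (le_trans (ler_normB _ _))// -[2]/(1 + 1) mulrDl mul1r lerD ?ltW.
have uJs : `|u *m Js| <= L * `|u| by exact/normMK/(reg_JK reg).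
have uJt : `|u *m Jt| <= L * `|u| by exact/normMK/(reg_JK reg).
have uD : `|u *m D| <= L * `|u| by exact/normMK.
have Bs : `|B s| <= L := le_trans (reg_BK reg sr) KL.
have Bt : `|B t| <= L := le_trans (reg_BK reg tr) KL.
have W0L : `|W0| <= L := le_trans W0K KL.
have as_ : `|a s| <= eta := reg_a reg sr.
have uJtD : `|u *m Jt - u *m D| <= L * eta * `|u|.
  rewrite -mulmxBr (le_trans (normM _ (reg_J reg tr)))//.
  by rewrite !ler_wpM2r.
(* The Taylor error [L * |u|^2] counts as small through [|u| <= 2 * r]; the other part is the
   distance of the Jacobian to [D]. *)
have e2 : `|a s - a t - u *m D| <= L * `|u| * (2 * r + eta).
  have -> : a s - a t - u *m D = (a s - a t - u *m Jt) + (u *m Jt - u *m D).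
    by rewrite addrA subrK.
  rewrite (le_trans (ler_normD _ _))// mulrDr lerD//; last by rewrite mulrAC.
  by apply: (le_trans (aT sr tr)); rewrite -mulrA ler_wpM2l// expr2 ler_wpM2l.
have u0 := normr_ge0 u.
have bnd : q * (L * `|u| ^+ 2 * L * eta + L * `|u| * (L * `|u|) * eta + L * `|u| * L * 0)
   + q * (L * `|u| * L * (L * `|u| * (2 * r + eta)))
   + q * (L * eta * `|u| * L * (L * `|u|) + L * `|u| * eta * (L * `|u|) + L * `|u| * L * 0)
  <= q * L ^+ 3 * (5 * eta + 2 * r) * `|u| ^+ 2.
  have -> : q * (L * `|u| ^+ 2 * L * eta + L * `|u| * (L * `|u|) * eta + L * `|u| * L * 0)
   + q * (L * `|u| * L * (L * `|u| * (2 * r + eta)))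
   + q * (L * eta * `|u| * L * (L * `|u|) + L * `|u| * eta * (L * `|u|) + L * `|u| * L * 0)
   = q * `|u| ^+ 2 * (L ^+ 2 * (3 * eta) + L ^+ 3 * (2 * r + 2 * eta)) by ring.
  have -> : q * L ^+ 3 * (5 * eta + 2 * r) * `|u| ^+ 2 =
    q * `|u| ^+ 2 * (L ^+ 3 * (3 * eta) + L ^+ 3 * (2 * r + 2 * eta)) by ring.
  rewrite ler_wpM2l ?mulr_ge0 ?exprn_ge0// lerD2r ler_wpM2r ?mulr_ge0//.
  by rewrite [leRHS]exprS ler_peMl// exprn_ge0.
split; apply: le_trans bnd.
- rewrite (bil_telescope_l _ (u *m Jt) _ _ (u *m D)).
  apply: (le_trans (ler_normD _ _)); apply: lerD; first apply: (le_trans (ler_normD _ _)) (lerD _ _).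
  + apply: norm_bil_sub => //; [exact: uJ|exact: BL|by rewrite subrr normr0].
  + exact: norm_bil_le.
  + apply: norm_bil_sub => //; [exact: reg_B reg _ tr|by rewrite subrr normr0].
- rewrite (bil_telescope_r _ (u *m Jt) _ _ (u *m D)).
  apply: (le_trans (ler_normD _ _)); apply: lerD; first apply: (le_trans (ler_normD _ _)) (lerD _ _).
  + rewrite (le_trans (@norm_bil_sub _ _ _ (a s) _ (B t) _ (u *m Jt) eta L (L * `|u|) 0 (L * `|u|) (L * `|u| ^+ 2) _ _ _ _ _ _ _))//.
    * by rewrite subrr normr0.
    * exact: BL.
    * exact: uJ.
    * by rewrite -/q le_eqVlt; apply/orP; left; apply/eqP; ring.
  + rewrite (le_trans (@norm_bil_le _ _ _ _ _ (L * `|u| * (2 * r + eta)) L (L * `|u|) _ _ _))//.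
    by rewrite -/q le_eqVlt; apply/orP; left; apply/eqP; ring.
  + rewrite (le_trans (@norm_bil_sub _ _ _ (u *m D) _ W0 _ (u *m D) (L * `|u|) L (L * `|u|) 0 eta (L * eta * `|u|) _ _ _ _ _ _ _))//.
    * by rewrite subrr normr0.
    * exact: reg_B reg _ tr.
    * by rewrite -/q le_eqVlt; apply/orP; left; apply/eqP; ring.
Qed.

(** The term carrying the derivative of the weight is quadratic in [a], so its increment keeps a
    factor [eta] and needs no comparison with a limit. *)
Let mid_expand s t : `|s - t0| < r -> `|t - t0| < r ->
  `|bil (a s) (vec_mx ((s - t) *m jacobian (vec B) s)) (a s)
    - bil (a t) (vec_mx ((s - t) *m jacobian (vec B) t)) (a t)| <=
  q * L ^+ 3 * (3 * eta) * `|s - t| ^+ 2.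
Proof.
move=> sr tr; set u := s - t.
rewrite (le_trans (@norm_bil_sub _ _ _ _ _ _ _ _ eta (L * `|u|) eta (L * `|u|) (L * `|u| ^+ 2) (L * `|u|) _ _ _ _ _ _ _))//.
- exact: (reg_a reg).
- by rewrite norm_vec_mx; exact/normMK/(reg_GK reg).
- exact: (reg_a reg).
- by rewrite norm_vec_mx; exact/normMK/(reg_GK reg).
- exact: aL.
- rewrite -linearB/= norm_vec_mx -mulmxBr.
  rewrite (le_trans (normM _ (reg_GL reg sr tr)))//.
  by rewrite mulrA -mulrA -expr2 ler_wpM2r// exprn_ge0.
- exact: aL.
have u20 : 0 <= `|u| ^+ 2 by rewrite exprn_ge0.
rewrite -/q -/u.
have -> : q * (L * `|u| * (L * `|u|) * eta + eta * (L * `|u| ^+ 2) * eta +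
    eta * (L * `|u|) * (L * `|u|)) = q * eta * `|u| ^+ 2 * (2 * L ^+ 2 + L * eta).
  by ring.
have -> : q * L ^+ 3 * (3 * eta) * `|u| ^+ 2 =
    q * eta * `|u| ^+ 2 * (2 * L ^+ 3 + L ^+ 3) by ring.
rewrite ler_wpM2l ?mulr_ge0// lerD//.
  by rewrite ler_wpM2l// [leRHS]exprS ler_peMl// exprn_ge0.
by rewrite exprS ler_wpM2l// (le_trans eta1)// exprn_ege1.
Qed.

(** The two outer terms yield twice the coercive form with error 5 eta + 2 r each, the middle one an
    error 3 eta: hence 13 eta + 4 r, which costs one of the two copies of [c]. *)
Lemma dquad_strongly_monotone s t : q * L ^+ 3 * (13 * eta + 4 * r) <= c ->
  `|s - t0| < r -> `|t - t0| < r ->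
  c * `|s - t| ^+ 2 <= dquad a B s (s - t) - dquad a B t (s - t).
Proof.
move=> small sr tr; have [h1 h3] := bil_expand sr tr.
have h2 := mid_expand sr tr; set u := s - t in h1 h2 h3 *.
have := coercive u.
have : q * L ^+ 3 * (13 * eta + 4 * r) * `|u| ^+ 2 <= c * `|u| ^+ 2.
  by rewrite ler_wpM2r// exprn_ge0.
have := ler_sub3 h1 h2 h3; rewrite -/(dquad a B s u) -/(dquad a B t u).
move: (bil _ _ _) (dquad a B s u - _) => z w.
rewrite -!mulrA; move: (`|u| ^+ 2) (L ^+ 3) (q) => U l p; lra.
Qed.

(* [t0 - a t0 *m Lm] is the Newton step from [t0]: [Lm] is chosen so that the
   linearised gradient vanishes there. *)
Lemma dquad_newton_step (Lm : 'M[R]_(k, d)) V u :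
  let v := - (a t0 *m Lm) in
  let rho := `|a t0| ^+ 2 + `|jacobian a t0 - D| ^+ 2 + `|B t0 - W0| ^+ 2 in
  1 <= V -> `|v| <= V * `|a t0| -> `|v| < r ->
  D *m W0 *m (1%:M - Lm *m D)^T = 0 -> (1%:M - Lm *m D) *m W0 *m D^T = 0 ->
  `|dquad a B (t0 + v) u| <= 24 * q * L ^+ 4 * V ^+ 2 * rho * `|u|.
Proof.
move=> v rho V1 vV vr Pl Pr.
have V0 : 0 <= V by exact: le_trans V1.
have t0r : `|t0 - t0| < r by rewrite subrr normr0 (le_lt_trans _ vr).
set t := t0 + v; have tt0 : t - t0 = v by rewrite addrAC subrr add0r.
have tr : `|t - t0| < r by rewrite tt0.
set x := `|jacobian a t0 - D|; set y := `|B t0 - W0|; set z := `|a t0|.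
have x0 : 0 <= x := normr_ge0 _.
have y0 : 0 <= y := normr_ge0 _.
have z0 : 0 <= z := normr_ge0 _.
have rhoE : rho = z ^+ 2 + x ^+ 2 + y ^+ 2 by [].
have xz : x * z <= rho by rewrite rhoE (le_trans (mulr_le_sqrD x z))// lerDl exprn_ge0.
have yz : y * z <= rho.
  by rewrite rhoE (le_trans (mulr_le_sqrD y z))// addrAC lerDl exprn_ge0.
have zz : z * z <= rho by rewrite rhoE -expr2 -addrA lerDl addr_ge0// exprn_ge0.
have rho0 : 0 <= rho by rewrite !addr_ge0// exprn_ge0.
(* [p] is the second-order part of [a t]; the first-order part [a t0 *m (1%:M - Lm *m D)] is
   annihilated on either side by the two orthogonality relations. *)
pose p := v *m (jacobian a t0 - D) + (a t - a t0 - v *m jacobian a t0).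
have LV1 : 1 <= L * V by rewrite mulr_ege1.
have pE : a t = a t0 *m (1%:M - Lm *m D) + p.
  have -> : a t0 *m (1%:M - Lm *m D) = a t0 + v *m D.
    by rewrite mulmxBr mulmx1 mulmxA /v mulNmx.
  rewrite /p mulmxBr.
  move: (a t) (a t0) (v *m D) (v *m jacobian a t0) => e f g h.
  by apply/matrixP => i j; rewrite !mxE; ring.
have vv : `|v| ^+ 2 <= V ^+ 2 * rho.
  by rewrite (@le_trans _ _ ((V * z) ^+ 2))// ?lerXn2r ?nnegrE ?mulr_ge0// exprMn ler_wpM2l// ?exprn_ge0.
have pr : `|p| <= 2 * L * V ^+ 2 * rho.
  have := aT tr t0r; rewrite tt0 => hT.
  have h1 : `|v *m (jacobian a t0 - D)| <= L * V ^+ 2 * rho.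
    rewrite (le_trans (normM v (lexx x)))//.
    rewrite (@le_trans _ _ (L * x * (V * z)))//.
      by rewrite ler_pM ?mulr_ge0// ler_wpM2r.
    have -> : L * x * (V * z) = L * V * (x * z) by ring.
    by rewrite ler_pM ?mulr_ge0// ler_wpM2l// expr2 ler_peMl.
  rewrite /p (le_trans (ler_normD _ _))//.
  have -> : 2 * L * V ^+ 2 * rho = L * V ^+ 2 * rho + L * (V ^+ 2 * rho) by ring.
  by rewrite lerD// (le_trans hT)// ler_wpM2l.
have at_ : `|a t| <= 2 * L * V * z.
  have := aL tr t0r; rewrite tt0 => hL.
  have -> : a t = a t0 + (a t - a t0) by rewrite addrC subrK.
  rewrite (le_trans (ler_normD _ _))//.
  have -> : 2 * L * V * z = L * V * z + L * (V * z) by ring.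
  by rewrite lerD// ?(le_trans hL) ?ler_wpM2l// -/z ler_peMl.
have Jt : `|jacobian a t - D| <= L * V * (x + z).
  have := reg_JL reg tr t0r; rewrite tt0 => hL.
  rewrite (sub_split _ (jacobian a t0)).
  rewrite (le_trans (ler_normD _ _))// mulrDr lerD//; first by rewrite -/x ler_peMl.
  by rewrite (le_trans hL)// -mulrA ler_pM.
have Bt : `|B t - W0| <= L * V * (y + z).
  have := BL tr t0r; rewrite tt0 => hL.
  rewrite (sub_split _ (B t0)).
  rewrite (le_trans (ler_normD _ _))// mulrDr lerD//; first by rewrite -/y ler_peMl.
  by rewrite (le_trans hL)// -mulrA ler_pM.
have uD : `|u *m D| <= L * `|u| by exact/normMK.
have uJt : `|u *m jacobian a t| <= L * `|u| by exact/normMK/(reg_JK reg).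
have uJD : `|u *m jacobian a t - u *m D| <= L * (L * V * (x + z)) * `|u|.
  by rewrite -mulmxBr (le_trans (normM _ Jt))// ler_wpM2r// ler_wpM2r ?mulr_ge0 ?addr_ge0.
have BtL : `|B t| <= L := le_trans (reg_BK reg tr) KL.
have W0L : `|W0| <= L := le_trans W0K KL.
have Lp n : L ^+ n <= L ^+ n.+1 by rewrite exprS ler_peMl// exprn_ge0.
have e1 : q * (L * (L * V * (x + z)) * `|u| * L * (2 * L * V * z) +
   L * `|u| * (L * V * (y + z)) * (2 * L * V * z) + L * `|u| * L * 0) <=
   8 * (q * L ^+ 4 * V ^+ 2 * rho * `|u|).
  have -> : q * (L * (L * V * (x + z)) * `|u| * L * (2 * L * V * z) +
   L * `|u| * (L * V * (y + z)) * (2 * L * V * z) + L * `|u| * L * 0) =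
   q * V ^+ 2 * `|u| * (L ^+ 4 * (2 * (x * z + z * z)) + L ^+ 3 * (2 * (y * z + z * z))).
     by ring.
  have -> : 8 * (q * L ^+ 4 * V ^+ 2 * rho * `|u|) =
    q * V ^+ 2 * `|u| * (L ^+ 4 * (4 * rho) + L ^+ 4 * (4 * rho)) by ring.
  rewrite ler_wpM2l ?mulr_ge0 ?exprn_ge0// lerD// ler_pM ?exprn_ge0 ?mulr_ge0 ?addr_ge0 ?mulr_ge0//;
    by rewrite -[4]/(2 * 2)%:R natrM -mulrA ler_wpM2l// mulr_natl mulr2n lerD.
have e2 : q * (L * `|u| * L * (2 * L * V ^+ 2 * rho)) <=
    2 * (q * L ^+ 4 * V ^+ 2 * rho * `|u|).
  have -> : q * (L * `|u| * L * (2 * L * V ^+ 2 * rho)) =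
    L ^+ 3 * (2 * q * V ^+ 2 * rho * `|u|) by ring.
  have -> : 2 * (q * L ^+ 4 * V ^+ 2 * rho * `|u|) =
    L ^+ 4 * (2 * q * V ^+ 2 * rho * `|u|) by ring.
  by rewrite ler_wpM2r ?mulr_ge0 ?exprn_ge0.
have c1 : `|bil (u *m jacobian a t) (B t) (a t)| <= 10 * (q * L ^+ 4 * V ^+ 2 * rho * `|u|).
  have -> : bil (u *m jacobian a t) (B t) (a t) =
      (bil (u *m jacobian a t) (B t) (a t) - bil (u *m D) W0 (a t)) +
      bil (u *m D) W0 p.
    have E : bil (u *m D) W0 (a t0 *m (1%:M - Lm *m D)) = 0.
      by rewrite /bil trmx_mul !mulmxA -!(mulmxA u) Pl mul0mx mulmx0 mxE.
    by rewrite {3}pE bilDr E add0r subrK.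
  rewrite (_ : 10 = 8 + 2); last by ring.
  rewrite mulrDl (le_trans (ler_normD _ _))// lerD//.
    apply: le_trans e1; apply: norm_bil_sub => //.
    by rewrite subrr normr0.
  by apply: le_trans e2; exact: norm_bil_le.
have c3 : `|bil (a t) (B t) (u *m jacobian a t)| <= 10 * (q * L ^+ 4 * V ^+ 2 * rho * `|u|).
  have -> : bil (a t) (B t) (u *m jacobian a t) =
      (bil (a t) (B t) (u *m jacobian a t) - bil (a t) W0 (u *m D)) +
      bil p W0 (u *m D).
    have E : bil (a t0 *m (1%:M - Lm *m D)) W0 (u *m D) = 0.
      by rewrite /bil trmx_mul !mulmxA -!(mulmxA (a t0)) Pr mul0mx mulmx0 mxE.
    by rewrite {3}pE bilDl E add0r subrK.
  rewrite (_ : 10 = 8 + 2); last by ring.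
  rewrite mulrDl (le_trans (ler_normD _ _))// lerD//.
    apply: le_trans e1.
    rewrite (le_trans (@norm_bil_sub _ _ _ (a t) _ W0 _ (u *m D) (2 * L * V * z) L (L * `|u|) 0 (L * V * (y + z)) (L * (L * V * (x + z)) * `|u|) _ _ _ _ _ _ _))//.
      by rewrite subrr normr0.
    by rewrite -/q le_eqVlt; apply/orP; left; apply/eqP; ring.
  apply: le_trans e2.
  rewrite (le_trans (@norm_bil_le _ _ _ _ _ (2 * L * V ^+ 2 * rho) L (L * `|u|) _ _ _))//.
  by rewrite -/q le_eqVlt; apply/orP; left; apply/eqP; ring.
have c2 : `|bil (a t) (vec_mx (u *m jacobian (vec B) t)) (a t)| <=
    4 * (q * L ^+ 4 * V ^+ 2 * rho * `|u|).
  rewrite (le_trans (@norm_bil_le _ _ _ _ _ (2 * L * V * z) (L * `|u|) (2 * L * V * z) _ _ _))//.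
    by rewrite norm_vec_mx; exact/normMK/(reg_GK reg).
  rewrite -/q; have -> : q * (2 * L * V * z * (L * `|u|) * (2 * L * V * z)) =
    4 * q * V ^+ 2 * `|u| * (L ^+ 3 * (z * z)) by ring.
  have -> : 4 * (q * L ^+ 4 * V ^+ 2 * rho * `|u|) =
    4 * q * V ^+ 2 * `|u| * (L ^+ 4 * rho) by ring.
  by rewrite ler_wpM2l ?mulr_ge0 ?exprn_ge0// ler_pM ?exprn_ge0 ?mulr_ge0.
rewrite /dquad -/t.
have -> : 24 * q * L ^+ 4 * V ^+ 2 * rho * `|u| =
  10 * (q * L ^+ 4 * V ^+ 2 * rho * `|u|) + 4 * (q * L ^+ 4 * V ^+ 2 * rho * `|u|) +
  10 * (q * L ^+ 4 * V ^+ 2 * rho * `|u|) by ring.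
by rewrite !(le_trans (ler_normD _ _), lerD).
Qed.

End one.

(** Since [alpha] is at most 1, each perturbed factor is bounded by twice the common bound of the
    original one; the three terms of [dquad] then cost 12 each. *)
Lemma dquad_perturbation a B a' B' s u alpha :
  regular t0 r K eta D W0 a B -> `|s - t0| < r -> 0 <= alpha <= 1 ->
  `|a' s - a s| <= alpha -> `|B' s - B s| <= alpha ->
  `|jacobian a' s - jacobian a s| <= alpha ->
  `|jacobian (vec B') s - jacobian (vec B) s| <= alpha ->
  `|dquad a' B' s u - dquad a B s u| <= 36 * q * L ^+ 2 * alpha * `|u|.
Proof.
move=> reg sr /andP[al0 al1] aa BB JJ GG.
have move_ n m (x y : 'M[R]_(n, m)) b : `|x - y| <= alpha -> `|y| <= b -> 1 <= b ->
    `|x| <= 2 * b.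
  move=> xy yb b1; rewrite -(subrK y x) (le_trans (ler_normD _ _))//; lra.
have a1 : `|a s| <= 1 := le_trans (reg_a reg sr) eta1.
have a'2 : `|a' s| <= 2.
  by rewrite -[2]mulr1 (move_ _ _ _ (a s)).
have a2 : `|a s| <= 2 by rewrite (le_trans a1)// ler1n.
have BK : `|B s| <= K := reg_BK reg sr.
have K2L : 2 * K <= 2 * L by rewrite ler_wpM2l.
have B'2 : `|B' s| <= 2 * L by rewrite (le_trans _ K2L)// (move_ _ _ _ (B s)).
have B2 : `|B s| <= 2 * L by rewrite (le_trans BK)// (le_trans KL)// ler_peMl// ler1n.
have J'2 : `|jacobian a' s| <= 2 * K by rewrite (move_ _ _ _ (jacobian a s))// (reg_JK reg).
have G'2 : `|jacobian (vec B') s| <= 2 * K.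
  by rewrite (move_ _ _ _ (jacobian (vec B) s))// (reg_GK reg).
have u2 n (A : 'M[R]_(d, n)) : `|A| <= 2 * K -> `|u *m A| <= 2 * L * `|u|.
  move=> /(normM u)/le_trans; apply; rewrite ler_wpM2r//.
  by rewrite mulrCA ler_wpM2l.
have JK2 : `|jacobian a s| <= 2 * K.
  by rewrite (le_trans (reg_JK reg sr))// ler_peMl// ler1n.
have GK2 : `|jacobian (vec B) s| <= 2 * K.
  by rewrite (le_trans (reg_GK reg sr))// ler_peMl// ler1n.
have ud n (A A' : 'M[R]_(d, n)) : `|A' - A| <= alpha -> `|u *m A' - u *m A| <= L * alpha * `|u|.
  by rewrite -mulmxBr => /(normM u)/le_trans; apply; rewrite !ler_wpM2r.
have c1 : `|bil (u *m jacobian a' s) (B' s) (a' s) - bil (u *m jacobian a s) (B s) (a s)| <=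
    12 * (q * L ^+ 2 * alpha * `|u|).
  rewrite (le_trans (@norm_bil_sub _ _ _ _ _ _ _ _ (2 * L * `|u|) (2 * L) 2 (L * alpha * `|u|) alpha alpha (u2 _ _ J'2) B2 a2 B'2 (ud _ _ _ JJ) BB aa))//.
  rewrite -/q; have -> : q * (L * alpha * `|u| * (2 * L) * 2 + 2 * L * `|u| * alpha * 2 + 2 * L * `|u| * (2 * L) * alpha) =
    q * alpha * `|u| * (8 * L ^+ 2 + 4 * L) by ring.
  have -> : 12 * (q * L ^+ 2 * alpha * `|u|) = q * alpha * `|u| * (8 * L ^+ 2 + 4 * L ^+ 2) by ring.
  by rewrite ler_wpM2l ?mulr_ge0// lerD2l ler_wpM2l// expr2 ler_peMl.
have c3 : `|bil (a' s) (B' s) (u *m jacobian a' s) - bil (a s) (B s) (u *m jacobian a s)| <=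
    12 * (q * L ^+ 2 * alpha * `|u|).
  rewrite (le_trans (@norm_bil_sub _ _ _ _ _ _ _ _ 2 (2 * L) (2 * L * `|u|) alpha alpha (L * alpha * `|u|) a'2 B2 (u2 _ _ JK2) B'2 aa BB (ud _ _ _ JJ)))//.
  rewrite -/q; have -> : q * (alpha * (2 * L) * (2 * L * `|u|) + 2 * alpha * (2 * L * `|u|) + 2 * (2 * L) * (L * alpha * `|u|)) =
    q * alpha * `|u| * (8 * L ^+ 2 + 4 * L) by ring.
  have -> : 12 * (q * L ^+ 2 * alpha * `|u|) = q * alpha * `|u| * (8 * L ^+ 2 + 4 * L ^+ 2) by ring.
  by rewrite ler_wpM2l ?mulr_ge0// lerD2l ler_wpM2l// expr2 ler_peMl.
have c2 : `|bil (a' s) (vec_mx (u *m jacobian (vec B') s)) (a' s) - bil (a s) (vec_mx (u *m jacobian (vec B) s)) (a s)| <=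
    12 * (q * L ^+ 2 * alpha * `|u|).
  have uG (C : 'M[R]_(d, k * k)) : `|C| <= 2 * K -> `|vec_mx (u *m C)| <= 2 * L * `|u|.
    by rewrite norm_vec_mx; exact: u2.
  have uGG : `|vec_mx (u *m jacobian (vec B') s) - vec_mx (u *m jacobian (vec B) s)| <= L * alpha * `|u|.
    by rewrite -linearB/= norm_vec_mx; exact: ud.
  rewrite (le_trans (@norm_bil_sub _ _ _ _ _ _ _ _ 2 (2 * L * `|u|) 2 alpha (L * alpha * `|u|) alpha a'2 (uG _ GK2) a2 (uG _ G'2) aa uGG aa))//.
  rewrite -/q; have -> : q * (alpha * (2 * L * `|u|) * 2 + 2 * (L * alpha * `|u|) * 2 + 2 * (2 * L * `|u|) * alpha) =
    q * alpha * `|u| * (12 * L) by ring.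
  have -> : 12 * (q * L ^+ 2 * alpha * `|u|) = q * alpha * `|u| * (12 * L ^+ 2) by ring.
  by rewrite ler_wpM2l ?mulr_ge0// ler_wpM2l// expr2 ler_peMl.
have -> : 36 * q * L ^+ 2 * alpha * `|u| =
  12 * (q * L ^+ 2 * alpha * `|u|) + 12 * (q * L ^+ 2 * alpha * `|u|) +
  12 * (q * L ^+ 2 * alpha * `|u|) by ring.
exact: ler_norm_sub3.
Qed.

End quadratic_objective.

(** * Minimisers of the criterion *)

Section estimators.
Context {R : realType} {d k : nat}.
Implicit Types (a : 'rV[R]_d -> 'rV[R]_k) (B : 'rV[R]_d -> 'M[R]_k).

Definition quad a B (t : 'rV[R]_d) : R := bil (a t) (B t) (a t).

(** The minimal value is at most the value at [t0], of order eps^2, while it is at least c / 2 times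
    |a t|^2, half of the coercivity surviving the passage from [W] to [B]. So [a t], and with it
    [f t], is small. The factor 8 is 2 from c / 2 times 4 from the square of delta / 2. *)
Lemma minimizer_localized (Theta : set 'rV[R]_d) (f : 'rV[R]_d -> 'rV[R]_k)
    (W : 'rV[R]_d -> 'M[R]_k) t0 c w delta eps a B t :
  Theta t0 -> f t0 = 0 -> 0 < c -> 0 <= eps -> eps <= 1 ->
  k%:R ^+ 2 * eps <= c / 2 -> eps <= delta / 2 ->
  8 * (k%:R ^+ 2 * (w + 1)) * eps ^+ 2 < c * delta ^+ 2 ->
  (forall s, Theta s -> forall x, c * `|x| ^+ 2 <= bil x (W s) x) ->
  `|W t0| <= w ->
  (forall s, Theta s -> `|a s - f s| <= eps) ->
  (forall s, Theta s -> `|B s - W s| <= eps) ->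
  is_minimizer Theta (quad a B) t -> `|f t| < delta.
Proof.
move=> T0 f0 c0 e0 e1 qe ed small cW Ww af BW [Tt tmin].
set q := k%:R ^+ 2 in qe small *; have q0 : 0 <= q by rewrite exprn_ge0.
have w0 : 0 <= w by exact: le_trans Ww.
have a0 : `|a t0| <= eps by have := af _ T0; rewrite f0 subr0.
have B0 : `|B t0| <= w + 1.
  rewrite -(subrK (W t0) (B t0)) (le_trans (ler_normD _ _))// addrC lerD//.
  exact: le_trans (BW _ T0) e1.
have ub : quad a B t0 <= q * (w + 1) * eps ^+ 2.
  rewrite (le_trans (ler_norm _))// (le_trans (norm_bil_le a0 B0 a0))//.
  by rewrite -/q le_eqVlt; apply/orP; left; apply/eqP; ring.
have lb : c / 2 * `|a t| ^+ 2 <= quad a B t.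
  have -> : quad a B t = bil (a t) (W t) (a t) + bil (a t) (B t - W t) (a t).
    by rewrite bilDm bilNm /quad; move: (bil _ _ _) (bil _ _ _) => x y; ring.
  have h1 := cW _ Tt (a t).
  have h2 : `|bil (a t) (B t - W t) (a t)| <= c / 2 * `|a t| ^+ 2.
    rewrite (le_trans (norm_bil_le (lexx _) (BW _ Tt) (lexx _)))//.
    rewrite -/q (_ : q * _ = q * eps * `|a t| ^+ 2); last by ring.
    by rewrite ler_wpM2r// exprn_ge0.
  move: h2; rewrite ler_norml => /andP[h2 _].
  move: h1 h2; move: (bil _ _ _) (bil _ _ _) (`|a t| ^+ 2) => x y z; lra.
have ub2 : c / 2 * `|a t| ^+ 2 <= q * (w + 1) * eps ^+ 2.
  by rewrite (le_trans lb)// (le_trans (tmin _ T0)).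
rewrite ltNge; apply/negP => df.
have ad : delta / 2 <= `|a t|.
  have : `|f t| <= `|a t| + eps.
    by rewrite -(subrK (a t) (f t)) (le_trans (ler_normD _ _))// addrC lerD// distrC af.
  lra.
have d0 : 0 <= delta / 2 by exact: le_trans ed.
have : (delta / 2) ^+ 2 <= `|a t| ^+ 2 by rewrite lerXn2r// nnegrE.
move=> /(ler_wpM2l (ltW c0)).
have -> : c * (delta / 2) ^+ 2 = c * delta ^+ 2 / 4 by field.
move: ub2 small.
have -> : 8 * (q * (w + 1)) * eps ^+ 2 = 8 * (q * (w + 1) * eps ^+ 2) by ring.
have -> : c / 2 * `|a t| ^+ 2 = c * `|a t| ^+ 2 / 2 by field.
move: (q * _ * _) (c * `|a t| ^+ 2) (c * delta ^+ 2) => x y z; lra.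
Qed.

Lemma minimizer_stationary (Theta : set 'rV[R]_d) a B t0 r t u :
  (forall s, `|s - t0| < r -> Theta s) ->
  (forall s, `|s - t0| < r -> differentiable a s) ->
  (forall s, `|s - t0| < r -> differentiable (vec B) s) ->
  is_minimizer Theta (quad a B) t -> `|t - t0| < r -> dquad a B t u = 0.
Proof.
move=> rT da dB [Tt tmin] tr.
(* A ball around the minimiser itself is required, hence the reduced radius. *)
have sr s : `|s - t| < r - `|t - t0| -> `|s - t0| < r.
  move=> st; rewrite -(subrK t s) -addrA (le_lt_trans (ler_normD _ _))//; lra.
apply: (@derive_eq0_at_min _ _ (quad a B) t u _ (r - `|t - t0|)).
- by rewrite subr_gt0.
- by move=> s /sr sr'; have [] := is_derive_quad u (da _ sr') (dB _ sr').
- by move=> s /sr /rT; exact: tmin.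
- by apply: is_derive_quad; [exact: da|exact: dB].
Qed.

Section estimates.
Variables (Theta : set 'rV[R]_d).
Variables (t0 : 'rV[R]_d) (r K eta c : R) (D : 'M[R]_(d, k)) (W0 : 'M[R]_k).
Hypotheses (K1 : 1 <= K) (eta0 : 0 <= eta) (eta1 : eta <= 1).
Hypotheses (DK : `|D| <= K) (W0K : `|W0| <= K) (c0 : 0 < c).
Hypothesis coercive : forall u, c * `|u| ^+ 2 <= bil (u *m D) W0 (u *m D).
Hypothesis rTheta : forall s, `|s - t0| < r -> Theta s.
Hypothesis small :
  k%:R ^+ 2 * (d.+1%:R * K) ^+ 3 * (13 * eta + 4 * r) <= c.
Variables (a : 'rV[R]_d -> 'rV[R]_k) (B : 'rV[R]_d -> 'M[R]_k).
Hypothesis reg : regular t0 r K eta D W0 a B.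
Variable t : 'rV[R]_d.
Hypotheses (tmin : is_minimizer Theta (quad a B) t) (tr : `|t - t0| < r).

Let stationary u : dquad a B t u = 0.
Proof. exact: minimizer_stationary rTheta (reg_diff reg) (reg_diffm reg) tmin tr. Qed.

(** The gradient vanishes at [t], so strong monotonicity bounds c |u|^2 by the gradient at the
    Newton point along [u]; one factor |u| cancels. *)
Lemma newton_step_error (Lm : 'M[R]_(k, d)) V :
  let v := - (a t0 *m Lm) in
  1 <= V -> `|v| <= V * `|a t0| -> `|v| < r ->
  D *m W0 *m (1%:M - Lm *m D)^T = 0 -> (1%:M - Lm *m D) *m W0 *m D^T = 0 ->
  `|t0 + v - t| <= 24 * k%:R ^+ 2 * (d.+1%:R * K) ^+ 4 * V ^+ 2 / c *
    (`|a t0| ^+ 2 + `|jacobian a t0 - D| ^+ 2 + `|B t0 - W0| ^+ 2).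
Proof.
move=> v V1 vV vr Pl Pr.
have t1r : `|t0 + v - t0| < r by rewrite addrAC subrr add0r.
have := dquad_strongly_monotone K1 eta0 eta1 DK W0K coercive reg small t1r tr.
rewrite stationary subr0 => h1.
have := dquad_newton_step K1 DK W0K reg (t0 + v - t) V1 vV vr Pl Pr.
set rho := _ ^+ 2 + _ + _; set C := 24 * _ * _ * _ => h2.
set u := t0 + v - t in h1 h2 *.
have h3 : c * `|u| ^+ 2 <= C * rho * `|u|.
  by rewrite (le_trans h1)// (le_trans (ler_norm _)).
have [->|u0] := eqVneq u 0.
  by rewrite normr0 mulr_ge0 ?divr_ge0 ?(ltW c0)// ?mulr_ge0 ?addr_ge0 ?exprn_ge0 ?mulr_ge0 ?(le_trans _ K1) ?(le_trans _ V1).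
rewrite mulrAC ler_pdivlMr// mulrC -(@ler_pM2r _ `|u|) ?normr_gt0//.
by rewrite -mulrA -expr2.
Qed.

(** The gradient of the unperturbed criterion is evaluated at [t'], where the perturbed one
    vanishes. Hence the two criteria are compared only at [t'], and [a'], [B'] need only one
    derivative. *)
Lemma minimizer_perturbation a' B' t' alpha :
  0 <= alpha <= 1 -> is_minimizer Theta (quad a' B') t' -> `|t' - t0| < r ->
  (forall s, `|s - t0| < r -> differentiable a' s) ->
  (forall s, `|s - t0| < r -> differentiable (vec B') s) ->
  `|a' t' - a t'| <= alpha -> `|B' t' - B t'| <= alpha ->
  `|jacobian a' t' - jacobian a t'| <= alpha ->
  `|jacobian (vec B') t' - jacobian (vec B) t'| <= alpha ->
  `|t' - t| <= 36 * k%:R ^+ 2 * (d.+1%:R * K) ^+ 2 / c * alpha.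
Proof.
move=> al t'min t'r da dB aa BB JJ GG.
have := dquad_strongly_monotone K1 eta0 eta1 DK W0K coercive reg small t'r tr.
rewrite stationary subr0 => h1.
have := dquad_perturbation K1 eta1 (t' - t) reg t'r al aa BB JJ GG.
rewrite (minimizer_stationary (t' - t) rTheta da dB t'min t'r) add0r normrN.
set C := 36 * _ * _ => h2; set u := t' - t in h1 h2 *.
have h3 : c * `|u| ^+ 2 <= C * alpha * `|u|.
  by rewrite (le_trans h1)// (le_trans (ler_norm _)).
have [a0 _] := andP al.
have [->|u0] := eqVneq u 0.
  by rewrite normr0 mulr_ge0 ?divr_ge0 ?(ltW c0)// ?mulr_ge0 ?exprn_ge0 ?mulr_ge0 ?(le_trans _ K1).
rewrite mulrAC ler_pdivlMr// mulrC -(@ler_pM2r _ `|u|) ?normr_gt0//.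
by rewrite -mulrA -expr2.
Qed.

End estimates.

End estimators.

(** On the part of [Theta] at distance at least [r] from [t0], which is compact, |f| attains a
    positive minimum. *)
Lemma zero_separation (R : realType) d k (Theta : set 'rV[R]_d)
    (f : 'rV[R]_d -> 'rV[R]_k) t0 r : compact Theta ->
  {within Theta, continuous f} -> 0 < r ->
  (forall t, Theta t -> f t = 0 -> t = t0) ->
  exists2 delta, 0 < delta &
    forall t, Theta t -> `|f t| < delta -> `|t - t0| < r.
Proof.
move=> cT fc r0 uniq.
pose A := Theta `&` [set t | r <= `|t - t0|].
have cA : compact A.
  apply: compact_closedI => //.
  have -> : [set t | r <= `|t - t0|] = (fun t => `|t - t0|) @^-1` [set x | r <= x] by [].
  apply: closed_comp => [t _|]; last exact: closed_ge.
  by apply: continuous_comp; [apply: continuousB => //; exact: cst_continuous|exact: norm_continuous].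
have [A0|/set0P A0] := eqVneq A set0.
  exists 1 => // t Tt _; rewrite ltNge; apply/negP => h.
  by have : A t by []; rewrite A0.
have fA : {within A, continuous (fun t => `|f t|)}.
  have /continuous_subspaceW : {within Theta, continuous (fun t => `|f t|)}.
    by move=> t; apply: continuous_comp; [exact: fc|exact: norm_continuous].
  by apply => t [].
have [t] := EVT_min_rV A0 cA fA.
rewrite inE => -[Tt /= rt] tmin.
exists `|f t|.
  rewrite normr_gt0; apply/eqP => /(uniq _ Tt) E.
  by move: rt; rewrite E subrr normr0 leNgt r0.
move=> s Ts; apply: contraTT; rewrite -!leNgt => rs.
by apply: tmin; rewrite inE.
Qed.

(** * Coercivity of inverse covariance matrices *)

Section positive_semidefinite.
Context {R : realType}.

Lemma bil_sym k (S : 'M[R]_k) x y : S^T = S -> bil x S y = bil y S x.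
Proof.
move=> SS; have -> : bil x S y = (x *m S *m y^T)^T 0 0 by rewrite mxE.
by rewrite !trmx_mul trmxK SS mulmxA.
Qed.

Lemma bilZl k (S : 'M[R]_k) (a : R) x y : bil (a *: x) S y = a * bil x S y.
Proof. by rewrite /bil -!scalemxAl mxE. Qed.

Lemma bilZr k (S : 'M[R]_k) (a : R) x y : bil x S (a *: y) = a * bil x S y.
Proof. by rewrite /bil linearZ/= -scalemxAr mxE. Qed.

Lemma bil_cauchy_schwarz k (S : 'M[R]_k) x y : S^T = S ->
  (forall z, 0 <= bil z S z) -> bil x S y ^+ 2 <= bil x S x * bil y S y.
Proof.
move=> SS S0.
have h (tau : R) : 0 <= bil x S x + 2 * tau * bil x S y + tau ^+ 2 * bil y S y.
  have := S0 (x + tau *: y); rewrite !(bilDl, bilDr, bilZl, bilZr) (bil_sym y x SS).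
  by congr (0 <= _); move: (bil _ _ _) (bil _ _ _) (bil _ _ _) => *; ring.
move: h (S0 x) (S0 y); move: (bil x S x) (bil x S y) (bil y S y) => A B C h A0 C0.
(* If [C] is 0 the polynomial is affine in [tau], so a nonzero slope would let it reach -1. *)
have [C_eq0|C_neq0] := eqVneq C 0.
  have [->|B0] := eqVneq B 0; first by rewrite expr0n mulr_ge0.
  have := h (- (A + 1) / (2 * B)); rewrite C_eq0 mulr0 addr0.
  have -> : A + 2 * (- (A + 1) / (2 * B)) * B = -1 by field; rewrite B0.
  by rewrite oppr_ge0 ler10.
have C_gt0 : 0 < C by rewrite lt0r C_neq0.
(* The minimiser of the quadratic polynomial, which gives the discriminant inequality. *)
have := h (- B / C).
have -> : A + 2 * (- B / C) * B + (- B / C) ^+ 2 * C = (A * C - B ^+ 2) / C by field.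
by rewrite pmulr_lge0 ?invr_gt0// subr_ge0.
Qed.

Lemma bil_delta k (S : 'M[R]_k) x j : bil x S (delta_mx 0 j) = (x *m S) 0 j.
Proof.
rewrite /bil mxE (bigD1 j)//= big1 => [|i ij].
  by rewrite !mxE !eqxx mulr1 addr0.
by rewrite !mxE (negbTE ij) andbF mulr0.
Qed.

(* With [x = y S], each [x_j = <y, e_j>_S] is bounded by Cauchy-Schwarz, so no
   lower bound on the spectrum of [S] is involved. *)
Lemma invmx_coercive k (S : 'M[R]_k) C x : S^T = S -> S \in unitmx ->
  (forall z, 0 <= bil z S z) -> `|S| <= C -> 0 < C ->
  C^-1 * `|x| ^+ 2 <= bil x (invmx S) x.
Proof.
move=> SS Su S0 SC C0; pose y := x *m invmx S.
have xy : x = y *m S by rewrite /y mulmxKV.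
have -> : bil x (invmx S) x = bil y S y.
  have xT : x^T = S *m y^T by rewrite [in LHS]xy trmx_mul SS.
  by rewrite /bil -/y xT mulmxA.
rewrite ler_pdivrMl//.
have y0 := S0 y.
have : `|x| <= Num.sqrt (C * bil y S y).
  apply: norm_matrix_le => [|i j]; first exact: sqrtr_ge0.
  rewrite (ord1 i) -sqrtr_sqr ler_wsqrtr// [in leLHS]xy -bil_delta.
  rewrite (le_trans (bil_cauchy_schwarz _ _ SS S0))// mulrC ler_wpM2r//.
  rewrite bil_delta (le_trans _ SC)// (le_trans (ler_norm _))//.
  rewrite -rowE mxE; exact: ler_norm_entry.
move=> h; have : `|x| ^+ 2 <= Num.sqrt (C * bil y S y) ^+ 2.
  by rewrite lerXn2r// ?nnegrE ?sqrtr_ge0.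
by rewrite sqr_sqrtr// mulr_ge0// ltW.
Qed.

(** Full row rank provides a right inverse of [D], so |u| is at most [q] times |u *m D|. *)
Lemma row_full_rank_coercive d k (D : 'M[R]_(d, k)) (W : 'M[R]_k) c :
  \rank D = d -> 0 < c -> (forall x, c * `|x| ^+ 2 <= bil x W x) ->
  exists2 c', 0 < c' & forall u, c' * `|u| ^+ 2 <= bil (u *m D) W (u *m D).
Proof.
move=> Dr c0 cW; have Df : row_free D by rewrite /row_free Dr.
pose q := 1 + k%:R * `|pinvmx D|.
have q0 : 0 < q by rewrite ltr_pwDl// mulr_ge0.
exists (c / q ^+ 2) => [|u]; first by rewrite divr_gt0// exprn_gt0.
apply: le_trans (cW _).
rewrite -mulrA ler_wpM2l ?(ltW c0)// ler_pdivrMl ?exprn_gt0// -exprMn.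
rewrite lerXn2r ?nnegrE ?mulr_ge0 ?(ltW q0)//.
rewrite -[in leLHS](mulmxKp Df u) (le_trans (norm_mulmx _ _))//.
by rewrite mulrAC ler_wpM2r// lerDr.
Qed.

Lemma coercive_unitmx d (M : 'M[R]_d) c : 0 < c ->
  (forall u, c * `|u| ^+ 2 <= bil u M u) -> M \in unitmx.
Proof.
move=> c0 cM; rewrite -row_free_unit; apply: inj_row_free => v vM.
have := cM v; rewrite /bil vM mul0mx mxE pmulr_rle0// => v0.
by apply/eqP; rewrite -normr_eq0 -sqrf_eq0 eq_le v0 exprn_ge0.
Qed.

End positive_semidefinite.

(** Used to pick one constant meeting a finite list of smallness requirements. *)
Lemma exists_pos_le (R : realType) (s : seq R) : all (fun x => 0 < x) s ->
  exists2 e, 0 < e & all (fun x => e <= x) s.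
Proof.
elim: s => [_|x s IH /= /andP[x0 /IH[e e0 es]]]; first by exists 1.
exists (Num.min x e); first by rewrite lt_min x0.
rewrite ge_min lexx/=; apply: sub_all es => y; apply: le_trans.
by rewrite ge_min lexx orbT.
Qed.

(** * Deterministic estimates with uniform constants *)

Section estimation.
Context {R : realType} {d k : nat}.

(** A weighted right inverse of [D] when [D *m W *m D^T] is invertible: then
    [1%:M - influence D W *m D] is a projection whose range is [W]-orthogonal to the rows of [D]. *)
Definition influence (D : 'M[R]_(d, k)) (W : 'M[R]_k) : 'M[R]_(k, d) :=
  W *m D^T *m invmx (D *m W *m D^T).

Lemma influence_l (D : 'M[R]_(d, k)) W : W^T = W -> D *m W *m D^T \in unitmx ->
  D *m W *m (1%:M - influence D W *m D)^T = 0.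
Proof.
move=> WW Mu; have MM : (D *m W *m D^T)^T = D *m W *m D^T.
  by rewrite !trmx_mul trmxK WW mulmxA.
rewrite linearB/= trmx1 mulmxBr mulmx1 /influence !trmx_mul trmx_inv MM trmxK WW.
by rewrite !mulmxA mulmxV// mul1mx subrr.
Qed.

Lemma influence_r (D : 'M[R]_(d, k)) W : D *m W *m D^T \in unitmx ->
  (1%:M - influence D W *m D) *m W *m D^T = 0.
Proof.
move=> Mu; rewrite !mulmxBl mul1mx /influence.
rewrite (_ : _ *m D *m W *m D^T =
  W *m D^T *m (invmx (D *m W *m D^T) *m (D *m W *m D^T))); last by rewrite !mulmxA.
by rewrite mulVmx// mulmx1 subrr.
Qed.

(** Closeness at the centre spreads over the ball by the Lipschitz bounds, at a cost proportional to
    [r]; this is why the values of the derivatives need control at [t0] only. *)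
Lemma regular_of_bounds (t0 : 'rV[R]_d) r K e eta (D : 'M[R]_(d, k)) W0 a B :
  0 < r -> 1 <= K -> e + d.+1%:R * K * r <= eta -> eta <= 1 ->
  `|W0| + 1 <= K ->
  (forall s, `|s - t0| < r -> [/\ differentiable a s, differentiable (vec B) s,
    `|jacobian a s| <= K & `|jacobian (vec B) s| <= K]) ->
  (forall s t, `|s - t0| < r -> `|t - t0| < r ->
    `|jacobian a s - jacobian a t| <= d.+1%:R * K * `|s - t| /\
    `|jacobian (vec B) s - jacobian (vec B) t| <= d.+1%:R * K * `|s - t|) ->
  `|a t0| <= e -> `|jacobian a t0 - D| <= e -> `|B t0 - W0| <= e ->
  regular t0 r (d.+1%:R * K) eta D W0 a B.
Proof.
move=> r0 K1 small eta1 W0K bnd lip ae Je Be.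
have K0 : 0 <= K by exact: le_trans K1.
have KL : K <= d.+1%:R * K by rewrite ler_peMl// ler1n.
have t0r : `|t0 - t0| < r by rewrite subrr normr0.
have lipr p (f : 'rV[R]_d -> 'rV[R]_p) s :
    (forall s, `|s - t0| < r -> differentiable f s) ->
    (forall s, `|s - t0| < r -> `|jacobian f s| <= K) ->
    `|s - t0| < r -> `|f s - f t0| <= d.+1%:R * K * r.
  move=> df fK sr; rewrite (le_trans (norm_sub_le_jacobian df K0 fK sr t0r))//.
  by rewrite ler_pM ?mulr_ge0// ?(ltW sr)// ler_wpM2r// ler_nat.
have near_ m n (x y z : 'M[R]_(m, n)) : `|x - y| <= d.+1%:R * K * r ->
    `|y - z| <= e -> `|x - z| <= eta.
  move=> xy yz; rewrite (sub_split x y z) (le_trans (ler_normD _ _))//.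
  by rewrite (le_trans _ small)// lerD.
have d1 s : `|s - t0| < r -> differentiable a s by move=> /bnd[].
have d3 s : `|s - t0| < r -> differentiable (vec B) s by move=> /bnd[].
have b1 s : `|s - t0| < r -> `|jacobian a s| <= K by move=> /bnd[].
have b3 s : `|s - t0| < r -> `|jacobian (vec B) s| <= K by move=> /bnd[].
have nB s : `|s - t0| < r -> `|B s - W0| <= eta.
  move=> sr; apply: near_ Be; rewrite -norm_mxvec linearB/=.
  exact: lipr d3 b3 sr.
split => //.
- move=> s sr; rewrite -[a s]subr0; apply: near_ (lipr _ _ _ d1 b1 sr) _.
  by rewrite subr0.
- move=> s sr; apply: near_ Je; have [h _] := lip _ _ sr t0r.
  by rewrite (le_trans h)// ler_wpM2l ?mulr_ge0// ltW.
- by move=> s sr; rewrite (le_trans (b1 _ sr)).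
- move=> s sr; rewrite -(subrK W0 (B s)) (le_trans (ler_normD _ _))//.
  by rewrite (le_trans _ KL)// (le_trans _ W0K)// addrC lerD// (le_trans (nB _ sr)).
- by move=> s sr; rewrite (le_trans (b3 _ sr)).
- by move=> s t sr tr; have [] := lip _ _ sr tr.
- by move=> s t sr tr; have [] := lip _ _ sr tr.
Qed.

(* The deterministic conditions on a realisation [a], [B] of the empirical
   criterion under which its minimiser is controlled. *)
Record well_behaved (Theta : set 'rV[R]_d) (f : 'rV[R]_d -> 'rV[R]_k)
    (W : 'rV[R]_d -> 'M[R]_k) t0 (D : 'M[R]_(d, k)) r1 K e
    (a : 'rV[R]_d -> 'rV[R]_k) (B : 'rV[R]_d -> 'M[R]_k) : Prop :=
  WellBehaved {
  wb_bnd : forall s, `|s - t0| < r1 ->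
    [/\ differentiable a s, differentiable (vec B) s,
        `|jacobian a s| <= K & `|jacobian (vec B) s| <= K];
  wb_lip : forall s t, `|s - t0| < r1 -> `|t - t0| < r1 ->
    `|jacobian a s - jacobian a t| <= d.+1%:R * K * `|s - t| /\
    `|jacobian (vec B) s - jacobian (vec B) t| <= d.+1%:R * K * `|s - t|;
  wb_a : forall s, Theta s -> `|a s - f s| <= e;
  wb_B : forall s, Theta s -> `|B s - W s| <= e;
  wb_J : `|jacobian a t0 - D| <= e }.

(** The constants are chosen in the order [eta], [r], [delta], [e]. They depend on the limits alone
    and not on the realisation, which makes it possible to integrate the estimates afterwards. *)
Theorem estimation (Theta : set 'rV[R]_d) (f : 'rV[R]_d -> 'rV[R]_k)
    (W : 'rV[R]_d -> 'M[R]_k) t0 (D : 'M[R]_(d, k)) r1 K c :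
  compact Theta -> {within Theta, continuous f} ->
  (forall t, Theta t -> f t = 0 -> t = t0) -> f t0 = 0 ->
  0 < r1 -> (forall s, `|s - t0| < r1 -> Theta s) ->
  0 < c -> (forall s, Theta s -> forall x, c * `|x| ^+ 2 <= bil x (W s) x) ->
  (W t0)^T = W t0 -> \rank D = d ->
  1 <= K -> `|W t0| + 1 <= K -> `|D| <= K ->
  exists e, exists C, [/\ 0 < e, e <= 1, 0 < C &
    forall a B t, well_behaved Theta f W t0 D r1 K e a B ->
      is_minimizer Theta (quad a B) t ->
      `|t0 - a t0 *m influence D (W t0) - t| <=
        C * (`|a t0| ^+ 2 + `|jacobian a t0 - D| ^+ 2 + `|B t0 - W t0| ^+ 2) /\
      forall a' B' t' alpha, 0 <= alpha <= e ->
        is_minimizer Theta (quad a' B') t' ->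
        (forall s, Theta s -> `|a' s - a s| <= alpha) ->
        (forall s, Theta s -> `|B' s - B s| <= alpha) ->
        (forall s, `|s - t0| < r1 -> [/\ differentiable a' s,
           differentiable (vec B') s, `|jacobian a' s - jacobian a s| <= alpha &
           `|jacobian (vec B') s - jacobian (vec B) s| <= alpha]) ->
        `|t' - t| <= C * alpha].
Proof.
move=> cT fc uniq ft0 r10 rT c0 cW WW Dr K1 W0K DK.
have K0 : 0 <= K by exact: le_trans K1.
have T0 : Theta t0 by apply: rT; rewrite subrr normr0.
have [c' c'0 coer] := row_full_rank_coercive Dr c0 (cW _ T0).
pose Lm := influence D (W t0).
have Mu : D *m W t0 *m D^T \in unitmx.
  apply: (@coercive_unitmx _ _ _ c') => // u.
  by rewrite (le_trans (coer u))// /bil trmx_mul !mulmxA.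
pose q := k%:R ^+ 2 : R; have q0 : 0 <= q by rewrite exprn_ge0.
pose K' := d.+1%:R * K; have K'1 : 1 <= K' by rewrite mulr_ege1// ler1n.
have KK' : K <= K' by rewrite ler_peMl// ler1n.
have K'0 : 0 <= K' by exact: le_trans K'1.
pose A := q * (d.+1%:R * K') ^+ 3.
have A0 : 0 <= A by rewrite mulr_ge0// exprn_ge0// mulr_ge0.
have A1 : 0 < A + 1 by rewrite ltr_wpDl.
(* With [r <= eta], 13 eta + 4 r is at most 26 eta; dividing by [A + 1] is safe even when [A] is
   0. *)
have [|eta eta_gt0 /= /andP[eta1 /andP[etaA _]]] :=
  @exists_pos_le R [:: 1; c' / (26 * (A + 1))].
  by rewrite /= ltr01 divr_gt0// mulr_gt0.
have Aeta : A * (26 * eta) <= c'.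
  move: etaA; rewrite ler_pdivlMr ?mulr_gt0// => h.
  by rewrite (le_trans _ h)//; nra.
have K'_gt0 : 0 < K' by exact: lt_le_trans K'1.
(* The last entry spends half of [eta] on the variation inside the ball and leaves the other half to
   [e]. *)
have [|r r_gt0 /= /andP[rr1 /andP[reta /andP[reta2 _]]]] :=
  @exists_pos_le R [:: r1; eta; eta / (2 * K')].
  by rewrite /= r10 eta_gt0 divr_gt0// mulr_gt0.
have K'r : K' * r <= eta / 2.
  rewrite (le_trans (ler_wpM2l K'0 reta2))// le_eqVlt; apply/orP; left.
  by apply/eqP; field; rewrite gt_eqF.
have small : q * (d.+1%:R * K') ^+ 3 * (13 * eta + 4 * r) <= c'.
  rewrite -/A (le_trans _ Aeta)// ler_wpM2l//; lra.
have [delta delta0 sep] := zero_separation cT fc r_gt0 uniq.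
have srT s : `|s - t0| < r -> Theta s by move=> sr; apply: rT; exact: lt_le_trans rr1.
pose V := 1 + k%:R * `|Lm|.
have V1 : 1 <= V by rewrite lerDl mulr_ge0.
have V0 : 0 < V by exact: lt_le_trans V1.
pose w := `|W t0|.
pose Z := 8 * (q * (w + 1)) + 1.
have w0 : 0 <= w := normr_ge0 _.
have qw0 : 0 <= q * (w + 1) by rewrite mulr_ge0// addr_ge0.
have Z0 : 0 < Z by rewrite ltr_wpDl// mulr_ge0.
have q1 : 0 < q + 1 by rewrite ltr_wpDl.
(* The entries serve in turn: 2 e <= 1, regularity on the ball, three conditions of
   [minimizer_localized] at error 2 e (the third, the fourth and the last), and a Newton step
   staying in the ball (the fifth). *)
have [|e e_gt0 /= /andP[e12 /andP[eeta /andP[ec /andP[ed /andP[erV /andP[eZ _]]]]]]] :=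
  @exists_pos_le R [:: 1 / 2; eta / 2; c / (4 * (q + 1)); delta / 4; r / (2 * V);
    c * delta ^+ 2 / (4 * Z)].
  by rewrite /= !divr_gt0// ?mulr_gt0// exprn_gt0.
have e1 : e <= 1 by rewrite (le_trans e12)//; lra.
(* A perturbation of size [alpha <= e] only doubles [e]. *)
have loc a B e' t : 0 <= e' -> e' <= 2 * e ->
    (forall s, Theta s -> `|a s - f s| <= e') ->
    (forall s, Theta s -> `|B s - W s| <= e') ->
    is_minimizer Theta (quad a B) t -> `|t - t0| < r.
  move=> e'0 e'e af BW tm; have [Tt _] := tm.
  have e'1 : e' <= 1 by lra.
  apply: (sep _ Tt).
  apply: (@minimizer_localized _ _ _ Theta f W t0 c w delta e' a B) => //.
  - rewrite -/q (le_trans (ler_wpM2l q0 e'e))// mulrCA.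
    move: ec; rewrite ler_pdivlMr ?mulr_gt0// => ec.
    have qe0 : 0 <= e by exact: ltW.
    lra.
  - lra.
  - rewrite -/q; move: eZ; rewrite ler_pdivlMr ?mulr_gt0// => eZ.
    have e'2 : e' ^+ 2 <= e' by rewrite expr2 ler_piMl.
    have : 8 * (q * (w + 1)) * e' ^+ 2 <= Z * (2 * e).
      apply: ler_pM; [by rewrite mulr_ge0|by rewrite exprn_ge0|by rewrite /Z lerDl|].
      exact: le_trans e'2 e'e.
    move/le_lt_trans; apply.
    have cd0 : 0 < c * delta ^+ 2 by rewrite mulr_gt0// exprn_gt0.
    have -> : Z * (2 * e) = e * (4 * Z) / 2 by field.
    by move: eZ cd0; move: (c * _) (e * _) => x y; lra.
pose C1 := 24 * k%:R ^+ 2 * (d.+1%:R * K') ^+ 4 * V ^+ 2 / c'.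
pose C2 := 36 * k%:R ^+ 2 * (d.+1%:R * K') ^+ 2 / c'.
have C10 : 0 <= C1 by rewrite !mulr_ge0 ?exprn_ge0 ?invr_ge0 ?mulr_ge0 ?(ltW V0) ?(ltW c'0).
have C20 : 0 <= C2 by rewrite !mulr_ge0 ?exprn_ge0 ?invr_ge0 ?mulr_ge0 ?(ltW c'0).
have eta0 := ltW eta_gt0.
have DK' : `|D| <= K' by exact: le_trans KK'.
have W0K' : `|W t0| <= K' by rewrite (le_trans _ KK')// (le_trans _ W0K)// lerDl.
exists e, (C1 + C2 + 1); split=> // [|a B t wb tm].
  by rewrite ltr_wpDl// addr_ge0.
have tr : `|t - t0| < r.
  by apply: (loc a B e) => //; [exact: ltW|lra|exact: wb_a wb|exact: wb_B wb].
have at0 : `|a t0| <= e by have := wb_a wb T0; rewrite ft0 subr0.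
have reg : regular t0 r K' eta D (W t0) a B.
  apply: (@regular_of_bounds t0 r K e) => //.
  - by rewrite -/K'; lra.
  - by move=> s sr; apply: (wb_bnd wb); exact: lt_le_trans rr1.
  - by move=> s u sr ur; apply: (wb_lip wb); exact: lt_le_trans rr1.
  - exact: wb_J wb.
  - exact: wb_B wb _ T0.
split.
  have vV : `|- (a t0 *m Lm)| <= V * `|a t0|.
    rewrite normrN (le_trans (norm_mulmx _ _))// mulrAC ler_wpM2r//.
    by rewrite lerDr.
  have := newton_step_error K'1 eta0 eta1 DK' W0K' c'0 coer srT small reg tm tr V1 vV.
  rewrite -/C1; set rho := _ ^+ 2 + _ + _ => h.
  have rho0 : 0 <= rho by rewrite !addr_ge0 ?exprn_ge0.
  rewrite (le_trans (h _ _ _))//.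
  - rewrite (le_lt_trans vV)// (le_lt_trans (ler_wpM2l (ltW V0) at0))//.
    rewrite (le_lt_trans (ler_wpM2l (ltW V0) erV))//.
    have -> : V * (r / (2 * V)) = r / 2 by field; rewrite gt_eqF.
    by rewrite ltr_pdivrMr// ltr_pMr// ltr1n.
  - exact: influence_l.
  - exact: influence_r.
  - by rewrite ler_wpM2r//; lra.
move=> a' B' t' alpha /andP[al0 ale] t'm aa BB JG.
have t'r : `|t' - t0| < r.
  apply: (loc a' B' (2 * e)) => //; first by rewrite mulr_ge0// ltW.
  - move=> s Ts; rewrite (sub_split _ (a s)) (le_trans (ler_normD _ _))//.
    have := aa _ Ts; have := wb_a wb Ts; lra.
  - move=> s Ts; rewrite (sub_split _ (B s)) (le_trans (ler_normD _ _))//.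
    have := BB _ Ts; have := wb_B wb Ts; lra.
have [Tt' _] := t'm.
have t'r1 : `|t' - t0| < r1 by exact: lt_le_trans rr1.
have [_ _ JJ GG] := JG _ t'r1.
have al01 : 0 <= alpha <= 1 by rewrite al0 (le_trans ale).
have := minimizer_perturbation K'1 eta0 eta1 DK' W0K' c'0 coer srT small reg tm tr al01 t'm t'r
  _ _ (aa _ Tt') (BB _ Tt') JJ GG.
rewrite -/C2 => h; rewrite (le_trans (h _ _))//.
- by move=> s sr; have [] := JG _ (lt_le_trans sr rr1).
- by move=> s sr; have [] := JG _ (lt_le_trans sr rr1).
- by rewrite ler_wpM2r//; lra.
Qed.

End estimation.

(** * Moments of empirical means *)

Section integrable_EFin.
Context {d} {T : measurableType d} {R : realType} (mu : {measure set T -> \bar R}).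
Variables (D : set T) (mD : measurable D).
Implicit Types f g : T -> R.

Lemma integrable_EFinZl c f : mu.-integrable D (EFin \o f) ->
  mu.-integrable D (EFin \o (fun x => c * f x)).
Proof. exact: integrableZl. Qed.

Lemma integrable_EFinD f g :
  mu.-integrable D (EFin \o f) -> mu.-integrable D (EFin \o g) ->
  mu.-integrable D (EFin \o (fun x => f x + g x)).
Proof. exact: integrableD. Qed.

End integrable_EFin.

Section independence.
Context {dO} {Omega : measurableType dO} {R : realType}.
Variable P : probability Omega R.

(** Independence makes the joint law agree with the product law on rectangles, hence everywhere;
    Fubini then separates the integrals. *)
Lemma Rintegral_mul_indep (U V : {RV P >-> R}) :
  P.-integrable setT (EFin \o U) -> P.-integrable setT (EFin \o V) ->
  P.-integrable setT (EFin \o (fun w => U w * V w)) ->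
  (forall A B, measurable A -> measurable B ->
    P (U @^-1` A `&` V @^-1` B) = (P (U @^-1` A) * P (V @^-1` B))%E) ->
  \int[P]_w (U w * V w) = (\int[P]_w U w) * (\int[P]_w V w).
Proof.
move=> iU iV iUV indep.
have mW : measurable_fun setT (fun w => (U w, V w)).
  by apply: measurable_fun_pair; exact: measurable_funPT.
have law X : measurable X ->
    (distribution P U \x distribution P V)%E X = pushforward P (fun w => (U w, V w)) X.
  by apply: (@product_measure_unique _ _ _ _ _ (distribution P U) (distribution P V)
    (pushforward P (fun w => (U w, V w)))) => A B mA mB; exact: indep.
have mf : measurable_fun setT (fun z : R * R => (z.1 * z.2)%:E).
  by apply/measurable_EFinP; apply: measurable_funM.
have iE (f : R -> R) (Z : {RV P >-> R}) : measurable_fun setT f ->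
    P.-integrable setT (EFin \o (f \o Z)) ->
    (\int[distribution P Z]_x (f x)%:E = \int[P]_w (f (Z w))%:E)%E.
  move=> mf' fi; rewrite -(integral_distribution (f := fun x => (f x)%:E))//.
  exact/measurable_EFinP.
have iprod : (distribution P U \x distribution P V)%E.-integrable setT
    (fun z : R * R => (z.1 * z.2)%:E).
  apply/integrableP; split => //.
  rewrite (eq_measure_integral (pushforward P (fun w => (U w, V w)))) => [|X mX _].
    have /integrableP[_] := iUV; apply: le_lt_trans.
    rewrite ge0_integral_pushforward//; first exact: measurableT_comp.
  exact: law.
rewrite /Rintegral -fineM; last 2 first.
- exact: integrable_fin_num.
- exact: integrable_fin_num.
congr fine.
transitivity (\int[pushforward P (fun w => (U w, V w))]_z (z.1 * z.2)%:E)%E.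
  by rewrite integral_pushforward.
rewrite -(eq_measure_integral _ (fun X mX _ => law X mX)).
rewrite -integral12_prod_meas1//= /fubini_F/=.
have V1 : (\int[distribution P V]_y y%:E = \int[P]_w (V w)%:E)%E by exact: (iE id).
have Vf : (\int[P]_w (V w)%:E)%E \is a fin_num by exact: integrable_fin_num.
transitivity (\int[distribution P U]_x (x * fine (\int[P]_w (V w)%:E))%:E)%E.
  apply: eq_integral => x _; under eq_integral do rewrite EFinM.
  rewrite integralZl//=; first by rewrite V1 EFinM fineK.
  apply/integrableP; split; first exact/measurable_EFinP.
  have /integrableP[_] := iV; apply: le_lt_trans.
  rewrite -(@ge0_integral_distribution _ _ _ _ _ P V (fun y : R => `|y%:E|%E))//.
  exact: measurableT_comp.
under eq_integral do rewrite EFinM.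
rewrite (iE (fun x => x * _))//; last 2 first.
- by apply: measurable_funM.
- rewrite (_ : _ \o _ = (fun w => (U w)%:E * (fine (\int[P]_w (V w)%:E))%:E)%E).
    exact: integrableZr.
  by apply/funext => w /=.
under eq_integral do rewrite EFinM.
by rewrite integralZr// fineK.
Unshelve. all: exact: mW.
Qed.

End independence.

Section iid_sample.
Context {dO dT} {Omega : measurableType dO} {T : measurableType dT} {R : realType}.
Variables (P : probability Omega R) (mu : probability T R).
Variable X : nat -> {RV P >-> T}.
Hypothesis X_iid : iid X mu.

(** A pi-system generating the information carried by the first n observations. *)
Definition cylinders n : set (set Omega) :=
  [set E | exists2 A : nat -> set T, (forall i, measurable (A i)) &
    E = \bigcap_(i in `I_n) (X i @^-1` A i)].

Lemma measurable_cylinder n E : cylinders n E -> measurable E.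
Proof.
move=> [A mA ->]; apply: bigcap_measurableType => i _.
by rewrite -[X in measurable X]setTI; exact: measurable_funPT.
Qed.

(** [A |-> P (A]&[X n @^-1] B)[and]A |-> P A * P (X n @^-1[B)] are finite measures that agree on the
    cylinders, hence on the sigma-algebra they generate. *)
Lemma indep_past n (U : Omega -> R) :
  measurable_fun [set: g_sigma_algebraType (cylinders n)] U ->
  forall A B, measurable A -> measurable B ->
    P (U @^-1` A `&` X n @^-1` B) = (P (U @^-1` A) * P (X n @^-1` B))%E.
Proof.
move=> mU A B mA mB.
have mXB : measurable (X n @^-1` B).
  by rewrite -[X in measurable X]setTI; exact: measurable_funPT.
have pB : P (X n @^-1` B) \is a fin_num by exact: fin_num_measure.
pose c := NngNum (fine_ge0 (measure_ge0 P (X n @^-1` B))).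
pose m1 : {measure set Omega -> \bar R} := mrestr P mXB.
pose m2 : {measure set Omega -> \bar R} := mscale c P.
suff : m1 (U @^-1` A) = m2 (U @^-1` A).
  by rewrite /m1 /m2 /c /=; rewrite /mrestr /mscale /= fineK// muleC.
apply: (@g_sigma_algebra_measure_unique _ _ _ (cylinders n) _ (fun=> setT)).
- by move=> E; exact: measurable_cylinder.
- move=> _; exists (fun=> setT) => //.
  by apply/seteqP; split.
- by apply/seteqP; split => // x _; exists 0%N.
- move=> _ _ [A1 mA1 ->] [A2 mA2 ->]; exists (fun i => A1 i `&` A2 i).
    by move=> i; exact: measurableI.
  by rewrite -bigcapI; apply: eq_bigcapr => i _; rewrite preimage_setI.
- move=> _ [A' mA' ->]; rewrite /m1 /m2 /c /=; rewrite /mrestr /mscale /= fineK//.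
  have [_ ind] := X_iid; rewrite ind// muleC.
  (* Placing [B] at index n turns the intersection into a cylinder of length n + 1, where the
     product rule is available. *)
  pose A2 i := if i == n then B else A' i.
  have mA2 i : measurable (A2 i) by rewrite /A2; case: ifP.
  have := ind n.+1 A2 mA2; rewrite big_ord_recr/= {3}/A2 eqxx.
  have -> : \bigcap_(i in `I_n.+1) (X i @^-1` A2 i) =
      \bigcap_(i in `I_n) (X i @^-1` A' i) `&` X n @^-1` B.
    rewrite IIS bigcap_setU bigcap_set1 {2}/A2 eqxx; congr (_ `&` _).
    by apply: eq_bigcapr => i /= iltn; rewrite /A2 ltn_eqF.
  move=> ->; congr (_ * _)%E; apply: eq_bigr => i _.
  by rewrite /A2 ltn_eqF.
- move=> _; rewrite /m1 /mrestr (@le_lt_trans _ _ 1%E) ?ltry//.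
  by apply: probability_le1; exact: measurableI.
- rewrite -[X in (<<s _ >>) X]setTI; exact: mU.
Qed.

Definition sample_sum (g : T -> R) n (w : Omega) : R := \sum_(i < n) g (X i w).

Lemma measurable_sample_sum (g : T -> R) n : measurable_fun setT g ->
  measurable_fun setT (sample_sum g n).
Proof.
move=> mg; apply: measurable_sum => i.
by apply: measurableT_comp => //; exact: measurable_funPT.
Qed.

Lemma measurable_sample_sum_past (g : T -> R) n : measurable_fun setT g ->
  measurable_fun [set: g_sigma_algebraType (cylinders n)] (sample_sum g n).
Proof.
move=> mg; apply: measurable_sum => i; apply: measurableT_comp => //.
move=> _ B mB; rewrite setTI; apply: sub_sigma_algebra.
exists (fun j => if j == i :> nat then B else setT).
  by move=> j; case: ifP.
apply/seteqP; split => [w Bw j /= jn|w /(_ i (ltn_ord i))].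
  by case: ifP => // /eqP ->.
by rewrite /= eqxx.
Qed.

Lemma integral_sample (g : T -> R) i : mu.-integrable setT (EFin \o g) ->
  P.-integrable setT (EFin \o (g \o X i)) /\
  \int[P]_w g (X i w) = \int[mu]_x g x.
Proof.
move=> gi; have mg := measurable_int _ gi; have [law _] := X_iid.
have lawE : forall A, measurable A -> A `<=` setT -> distribution P (X i) A = mu A.
  by move=> A mA _; exact: law.
have i1 : (distribution P (X i)).-integrable setT (EFin \o g).
  apply/integrableP; split => //; have /integrableP[_] := gi.
  by rewrite (eq_measure_integral _ lawE).
have i2 : P.-integrable setT (EFin \o (g \o X i)).
  apply/integrableP; split.
    apply/measurable_EFinP; apply: measurableT_comp; first exact/measurable_EFinP.
    exact: measurable_funPT.
  have /integrableP[_] := i1; rewrite ge0_integral_distribution//.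
  exact: measurableT_comp.
split => //; rewrite /Rintegral; congr fine.
by rewrite -(integral_distribution (f := EFin \o g))// (eq_measure_integral _ lawE).
Qed.

End iid_sample.

Section fourth_moments.
Context {d} {T : measurableType d} {R : realType}.
Variable mu : probability T R.
Implicit Types f g h : T -> R.

(** Under a probability this class contains the constants, is stable under linear combinations, and
    makes all monomials of total degree at most 4 integrable. *)
Definition L4 f := measurable_fun setT f /\
  mu.-integrable setT (EFin \o (fun x => f x ^+ 4)).

Lemma pow4_abs (x : R) : x ^+ 4 = `|x| ^+ 4.
Proof. by rewrite -normrX ger0_norm// -[4%N]/(2 * 2)%N exprM sqr_ge0. Qed.

Lemma integrable_le_L4 f g h C : L4 f -> L4 g -> measurable_fun setT h ->
  (forall x, `|h x| <= C * (1 + f x ^+ 4 + g x ^+ 4)) ->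
  mu.-integrable setT (EFin \o h).
Proof.
move=> [mf if4] [mg ig4] mh hC.
apply: (@le_integrable _ _ _ _ _ _ _ (EFin \o (fun x => C * (1 + f x ^+ 4 + g x ^+ 4)))) => //.
- exact/measurable_EFinP.
- by move=> x _ /=; rewrite lee_fin (le_trans (hC x))// ler_norm.
apply: integrable_EFinZl => //; do 2 apply: integrable_EFinD => //.
exact: finite_measure_integrable_cst.
Qed.

Lemma L4D f g : L4 f -> L4 g -> L4 (fun x => f x + g x).
Proof.
move=> f4 g4; split; first by apply: measurable_funD; [case: f4|case: g4].
apply: (@integrable_le_L4 f g _ 8) => //.
  by apply: measurable_funX; apply: measurable_funD; [case: f4|case: g4].
move=> x; move: (f x) (g x) => a b.
rewrite ger0_norm; last by rewrite -[4%N]/(2 * 2)%N exprM sqr_ge0.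
have h1 : (a + b) ^+ 4 <= 8 * (a ^+ 4 + b ^+ 4).
  have e1 : (a + b) ^+ 2 <= 2 * (a ^+ 2 + b ^+ 2).
    rewrite -subr_ge0; have -> : 2 * (a ^+ 2 + b ^+ 2) - (a + b) ^+ 2 = (a - b) ^+ 2 by ring.
    exact: sqr_ge0.
  have e2 : ((a + b) ^+ 2) ^+ 2 <= (2 * (a ^+ 2 + b ^+ 2)) ^+ 2.
    by rewrite lerXn2r// nnegrE ?sqr_ge0// mulr_ge0// addr_ge0// sqr_ge0.
  rewrite -[4%N]/(2 * 2)%N exprM (le_trans e2)// -subr_ge0.
  have -> : 8 * (a ^+ (2 * 2) + b ^+ (2 * 2)) - (2 * (a ^+ 2 + b ^+ 2)) ^+ 2 =
    4 * (a ^+ 2 - b ^+ 2) ^+ 2 by ring.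
  by rewrite mulr_ge0// sqr_ge0.
by rewrite (le_trans h1)// ler_wpM2l// -addrA lerDr.
Qed.

Lemma L4Z f c : L4 f -> L4 (fun x => c * f x).
Proof.
move=> f4; split; first by apply: measurable_funM => //; case: f4.
apply: (@integrable_le_L4 f f _ (c ^+ 4)) => //.
  by apply: measurable_funX; apply: measurable_funM => //; case: f4.
move=> x; rewrite exprMn.
have p (a : R) : 0 <= a ^+ 4 by rewrite -[4%N]/(2 * 2)%N exprM sqr_ge0.
rewrite ger0_norm; last by rewrite mulr_ge0.
apply: ler_wpM2l => //.
by have := p (f x); move: (f x ^+ 4) => y; lra.
Qed.

Lemma L4_cst c : L4 (fun=> c).
Proof. by split => //; exact: finite_measure_integrable_cst. Qed.

Lemma L4_sum (I : Type) (s : seq I) (F : I -> T -> R) :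
  (forall i, L4 (F i)) -> L4 (fun x => \sum_(i <- s) F i x).
Proof.
move=> F4; elim: s => [|i s IH].
  by under eq_fun do rewrite big_nil; exact: L4_cst.
by under eq_fun do rewrite big_cons; exact: L4D.
Qed.

Lemma L4_mul_integrable f g i j : L4 f -> L4 g -> (i + j <= 4)%N ->
  mu.-integrable setT (EFin \o (fun x => f x ^+ i * g x ^+ j)).
Proof.
move=> f4 g4 ij; apply: (@integrable_le_L4 f g _ 1) => //.
  by apply: measurable_funM; apply: measurable_funX; [case: f4|case: g4].
move=> x; rewrite mul1r normrM !normrX (pow4_abs (f x)) (pow4_abs (g x)).
have := normr_ge0 (f x); have := normr_ge0 (g x).
move: `|f x| `|g x| => a b b0 a0.
(* Every monomial of degree at most 4 is below the fourth power of the maximum of 1, |f| and |g|. *)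
pose m := Num.max 1 (Num.max a b).
have m1 : 1 <= m by rewrite le_max lexx.
have am : a <= m by rewrite !le_max lexx orbT.
have bm : b <= m by rewrite !le_max lexx !orbT.
have m0 : 0 <= m by exact: le_trans m1.
rewrite (@le_trans _ _ (m ^+ 4))//.
  rewrite (@le_trans _ _ (m ^+ (i + j)))//; last by rewrite ler_weXn2l.
  by rewrite exprD ler_pM ?exprn_ge0// lerXn2r.
have p (y : R) : 0 <= y ^+ 4 by rewrite -[4%N]/(2 * 2)%N exprM sqr_ge0.
have [pa pb] := (p a, p b).
have [h|[h|h]] : m = 1 \/ m = a \/ m = b.
- by rewrite /m; case: (leP a b) => _; case: leP => _; tauto.
- by rewrite h expr1n; lra.
- by rewrite h; lra.
- by rewrite h; lra.
Qed.

Lemma L4_integrable f : L4 f -> mu.-integrable setT (EFin \o f).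
Proof.
move=> f4; rewrite (_ : f = (fun x => f x ^+ 1 * f x ^+ 0)).
  exact: L4_mul_integrable.
by apply/funext => x; rewrite expr1 expr0 mulr1.
Qed.

Lemma L4M_integrable f g : L4 f -> L4 g ->
  mu.-integrable setT (EFin \o (fun x => f x * g x)).
Proof.
move=> f4 g4; rewrite (_ : (fun x => _) = (fun x => f x ^+ 1 * g x ^+ 1)).
  exact: L4_mul_integrable.
by apply/funext => x; rewrite !expr1.
Qed.

(** The variance of f^2 is nonnegative. *)
Lemma Rintegral_sqr_sqr_le f : L4 f ->
  (\int[mu]_x (f x ^+ 2)) ^+ 2 <= \int[mu]_x (f x ^+ 4).
Proof.
move=> f4; set m := \int[mu]_x _.
have i2 : mu.-integrable setT (EFin \o (fun x => f x ^+ 2)).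
  rewrite (_ : (fun x => _) = (fun x => f x * f x)); first exact: L4M_integrable.
  by apply/funext => x; rewrite expr2.
have i4 : mu.-integrable setT (EFin \o (fun x => f x ^+ 4)) by case: f4.
have ic c : mu.-integrable setT (EFin \o (fun=> c : R)) by exact: finite_measure_integrable_cst.
have iz (c : R) : mu.-integrable setT (EFin \o (fun x => c * f x ^+ 2)).
  exact: integrable_EFinZl.
have : 0 <= \int[mu]_x ((f x ^+ 2 - m) ^+ 2) by apply: Rintegral_ge0 => x _; exact: sqr_ge0.
have -> : \int[mu]_x ((f x ^+ 2 - m) ^+ 2) =
    \int[mu]_x (f x ^+ 4 + ((- (2 * m)) * f x ^+ 2 + m ^+ 2)).
  by apply: eq_Rintegral => x _; ring.
have i3 : mu.-integrable setT (EFin \o (fun x => - (2 * m) * f x ^+ 2 + m ^+ 2)).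
  exact: integrable_EFinD.
rewrite RintegralD// RintegralD// RintegralZl// -/m Rintegral_cst//.
have mu1 : fine (mu [set: T]) = 1 by rewrite probability_setT.
by rewrite mu1; move: (\int[mu]_x _) => M; rewrite mulr1 => h; lra.
Qed.

End fourth_moments.

Section sample_moments.
Context {dO dT} {Omega : measurableType dO} {T : measurableType dT} {R : realType}.
Variables (P : probability Omega R) (mu : probability T R).
Variable X : nat -> {RV P >-> T}.
Hypothesis X_iid : iid X mu.

Lemma L4_sample (g : T -> R) i : L4 mu g -> L4 P (fun w => g (X i w)).
Proof.
move=> [mg ig]; split; first by apply: measurableT_comp => //; exact: measurable_funPT.
exact: (integral_sample X_iid i ig).1.
Qed.

Lemma L4_sample_sum (g : T -> R) n : L4 mu g -> L4 P (sample_sum X g n).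
Proof. by move=> g4; apply: L4_sum => i; exact: L4_sample. Qed.

Lemma sample_sumS (g : T -> R) n w :
  sample_sum X g n.+1 w = sample_sum X g n w + g (X n w).
Proof. by rewrite /sample_sum big_ord_recr. Qed.

Lemma Rintegral_past_mul n (U : Omega -> R) (h : T -> R) :
  measurable_fun [set: g_sigma_algebraType (cylinders X n)] U ->
  P.-integrable setT (EFin \o U) -> mu.-integrable setT (EFin \o h) ->
  P.-integrable setT (EFin \o (fun w => U w * h (X n w))) ->
  \int[P]_w (U w * h (X n w)) = (\int[P]_w U w) * (\int[mu]_x h x).
Proof.
move=> pU iU ih iUh.
have mU : measurable_fun setT U by apply/measurable_EFinP; exact: measurable_int iU.
have mh : measurable_fun setT h by apply/measurable_EFinP; exact: measurable_int ih.
have mV : measurable_fun setT (fun w => h (X n w)).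
  by apply: measurableT_comp => //; exact: measurable_funPT.
pose U' : {RV P >-> R} := HB.pack U (isMeasurableFun.Build _ _ _ _ _ mU).
pose V' : {RV P >-> R} := HB.pack (fun w => h (X n w)) (isMeasurableFun.Build _ _ _ _ _ mV).
have [iV <-] := integral_sample X_iid n ih.
apply: (@Rintegral_mul_indep _ _ _ _ U' V') => // A B mA mB.
have := indep_past X_iid pU mA (B := h @^-1` B); apply.
by rewrite -[X in measurable X]setTI; exact: mh.
Qed.

Lemma Rintegral_sample_sum (g : T -> R) n : mu.-integrable setT (EFin \o g) ->
  \int[mu]_x g x = 0 ->
  P.-integrable setT (EFin \o sample_sum X g n) /\
  \int[P]_w sample_sum X g n w = 0.
Proof.
move=> ig g0; elim: n => [|n [iS S0]].
  have E : sample_sum X g 0 = fun=> 0 by apply/funext => w; rewrite /sample_sum big_ord0.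
  rewrite E; split; first exact: finite_measure_integrable_cst.
  by rewrite Rintegral_cst// mul0r.
have E : sample_sum X g n.+1 = fun w => sample_sum X g n w + g (X n w).
  by apply/funext => w; rewrite sample_sumS.
have [iX gX] := integral_sample X_iid n ig.
rewrite E; split; first exact: integrable_EFinD.
by rewrite RintegralD// S0 gX g0 addr0.
Qed.

Lemma Rintegral_sample_sum_mul (f g : T -> R) n : L4 mu f -> L4 mu g ->
  \int[mu]_x f x = 0 -> \int[mu]_x g x = 0 ->
  \int[P]_w (sample_sum X f n w * sample_sum X g n w) =
  n%:R * \int[mu]_x (f x * g x).
Proof.
move=> f4 g4 f0 g0; elim: n => [|n IH].
  under eq_Rintegral do rewrite /sample_sum big_ord0 mul0r.
  by rewrite Rintegral_cst// !mul0r.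
pose Sf := sample_sum X f n; pose Sg := sample_sum X g n.
pose zf w := f (X n w); pose zg w := g (X n w).
have Sf4 : L4 P Sf by exact: L4_sample_sum.
have Sg4 : L4 P Sg by exact: L4_sample_sum.
have zf4 : L4 P zf by exact: L4_sample.
have zg4 : L4 P zg by exact: L4_sample.
have i1 := L4M_integrable Sf4 Sg4; have i2 := L4M_integrable Sf4 zg4.
have i3 := L4M_integrable Sg4 zf4; have i4 := L4M_integrable zf4 zg4.
transitivity (\int[P]_w (Sf w * Sg w + (Sf w * zg w + (Sg w * zf w + zf w * zg w)))).
  by apply: eq_Rintegral => w _; rewrite !sample_sumS /Sf /Sg /zf /zg; ring.
have i34 := integrable_EFinD measurableT i3 i4.
have i234 := integrable_EFinD measurableT i2 i34.
rewrite RintegralD// RintegralD// RintegralD// IH.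
have pf : measurable_fun [set: g_sigma_algebraType (cylinders X n)] Sf.
  by apply: measurable_sample_sum_past; case: f4.
have pg : measurable_fun [set: g_sigma_algebraType (cylinders X n)] Sg.
  by apply: measurable_sample_sum_past; case: g4.
rewrite (Rintegral_past_mul pf (L4_integrable Sf4) (L4_integrable g4))//.
rewrite (Rintegral_past_mul pg (L4_integrable Sg4) (L4_integrable f4))//.
rewrite f0 g0 !mulr0 !add0r.
rewrite (integral_sample X_iid n (L4M_integrable f4 g4)).2.
by rewrite -[in RHS]natr1 mulrDl mul1r.
Qed.

(** Expanding (S + z)^4 with z independent of S and both centred, the terms S^3 z and S z^3
    integrate to 0. The increment is thus at most (6 n + 1) times the fourth moment of g, which fits
    under 3 (n + 1)^2 - 3 n^2 = 6 n + 3. *)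
Lemma Rintegral_sample_sum_fourth (g : T -> R) n : L4 mu g ->
  \int[mu]_x g x = 0 ->
  \int[P]_w (sample_sum X g n w ^+ 4) <= 3 * n%:R ^+ 2 * \int[mu]_x (g x ^+ 4).
Proof.
move=> g4 g0; elim: n => [|n IH].
  under eq_Rintegral do rewrite /sample_sum big_ord0 expr0n/=.
  by rewrite Rintegral_cst// mul0r expr0n/= mulr0 mul0r.
pose S := sample_sum X g n; pose z w := g (X n w).
have S4 : L4 P S by exact: L4_sample_sum.
have z4 : L4 P z by exact: L4_sample.
have i40 : P.-integrable setT (EFin \o (fun w => S w ^+ 4)) by case: S4.
have i04 : P.-integrable setT (EFin \o (fun w => z w ^+ 4)) by case: z4.
pose p31 w := S w ^+ 3 * z w ^+ 1; pose p22 w := S w ^+ 2 * z w ^+ 2.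
pose p13 w := S w ^+ 1 * z w ^+ 3.
have i31 : P.-integrable setT (EFin \o p31) by exact: L4_mul_integrable.
have i22 : P.-integrable setT (EFin \o p22) by exact: L4_mul_integrable.
have i13 : P.-integrable setT (EFin \o p13) by exact: L4_mul_integrable.
have c31 := integrable_EFinZl measurableT 4 i31.
have c22 := integrable_EFinZl measurableT 6 i22.
have c13 := integrable_EFinZl measurableT 4 i13.
have s1 := integrable_EFinD measurableT c13 i04.
have s2 := integrable_EFinD measurableT c22 s1.
have s3 := integrable_EFinD measurableT c31 s2.
have -> : \int[P]_w (sample_sum X g n.+1 w ^+ 4) =
  \int[P]_w (S w ^+ 4 + (4 * p31 w + (6 * p22 w + (4 * p13 w + z w ^+ 4)))).
  by apply: eq_Rintegral => w _; rewrite sample_sumS /p31 /p22 /p13 /S /z; ring.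
rewrite RintegralD// RintegralD// RintegralD// RintegralD// !RintegralZl//.
have pow i : (i <= 4)%N -> mu.-integrable setT (EFin \o (fun x => g x ^+ i)).
  move=> i4; rewrite (_ : (fun x => _) = (fun x => g x ^+ i * g x ^+ 0)).
    by apply: L4_mul_integrable => //; rewrite addn0.
  by apply/funext => x; rewrite expr0 mulr1.
have powS i : (i <= 4)%N -> P.-integrable setT (EFin \o (fun x => S x ^+ i)).
  move=> i4; rewrite (_ : (fun x => _) = (fun x => S x ^+ i * S x ^+ 0)).
    by apply: L4_mul_integrable => //; rewrite addn0.
  by apply/funext => x; rewrite expr0 mulr1.
have past i : measurable_fun [set: g_sigma_algebraType (cylinders X n)] (fun w => S w ^+ i).
  by apply: measurable_funX; apply: measurable_sample_sum_past; case: g4.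
have g1 : \int[mu]_x (g x ^+ 1) = 0 by rewrite -[RHS]g0; apply: eq_Rintegral => x _; rewrite expr1.
have S1 : \int[P]_x (S x ^+ 1) = 0.
  rewrite -[RHS](Rintegral_sample_sum n (L4_integrable g4) g0).2.
  by apply: eq_Rintegral => x _; rewrite expr1.
have S2 : \int[P]_x (S x ^+ 2) = n%:R * \int[mu]_x (g x ^+ 2).
  transitivity (\int[P]_w (S w * S w)); first by apply: eq_Rintegral => x _; rewrite expr2.
  by rewrite (Rintegral_sample_sum_mul n g4 g4 g0 g0).
have -> : \int[P]_w p31 w = 0.
  apply: etrans (Rintegral_past_mul (h := fun x => g x ^+ 1) (past 3%N) (powS 3%N isT) (pow 1%N isT) i31) _.
  exact: etrans (congr1 (fun x => _ * x) g1) (mulr0 _).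
have -> : \int[P]_w p13 w = 0.
  apply: etrans (Rintegral_past_mul (h := fun x => g x ^+ 3) (past 1%N) (powS 1%N isT) (pow 3%N isT) i13) _.
  exact: etrans (congr1 (fun x => x * _) S1) (mul0r _).
have -> : \int[P]_w p22 w =
    n%:R * \int[mu]_x (g x ^+ 2) * \int[mu]_x (g x ^+ 2).
  apply: etrans (Rintegral_past_mul (h := fun x => g x ^+ 2) (past 2%N) (powS 2%N isT) (pow 2%N isT) i22) _.
  exact: (congr1 (fun x => x * _) S2).
rewrite !mulr0 !add0r.
have [|_ ->] := @integral_sample _ _ _ _ _ P mu X X_iid (fun x => g x ^+ 4) n; first by case: g4.
have := Rintegral_sqr_sqr_le g4.
move: IH; rewrite -/S.
move: (\int[P]_w S w ^+ 4) (\int[mu]_x g x ^+ 4) (\int[mu]_x g x ^+ 2) => a b c IH cb.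
have n0 : 0 <= n%:R :> R by [].
have b0 : 0 <= b by rewrite (le_trans _ cb)// sqr_ge0.
rewrite -[n.+1%:R]natr1.
have h : 6 * (n%:R * c * c) <= 6 * (n%:R * b) by rewrite ler_wpM2l// -mulrA ler_wpM2l// -expr2.
have -> : 3 * (n%:R + 1) ^+ 2 * b = 3 * n%:R ^+ 2 * b + (6 * (n%:R * b) + 3 * b) by ring.
by rewrite lerD// lerD//; lra.
Qed.

End sample_moments.

(** * Compactness and bracketing *)

Section compact_nets.
Context {R : realType} {V : normedModType R}.
Implicit Types A : set V.

Lemma within_continuousP (W : normedModType R) A (f : V -> W) :
  {within A, continuous f} -> forall u e, A u -> 0 < e ->
  exists2 rho, 0 < rho & forall v, A v -> `|v - u| < rho -> `|f v - f u| < e.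
Proof.
move=> /subspace_continuousP fc u e Au e0.
have /cvgrPdist_lt/(_ e e0) := fc u Au.
rewrite near_withinE => /nbhs_normP[rho /= rho0 h].
exists rho => // v Av vu; rewrite distrC; apply: (h v _ Av).
by rewrite /= distrC.
Qed.

Lemma open_norm_ball (u : V) rho : open [set v | `|v - u| < rho].
Proof.
have -> : [set v | `|v - u| < rho] = (fun v => `|v - u|) @^-1` [set x | x < rho] by [].
apply: open_comp; last exact: open_lt.
move=> v _; apply: (lipschitz_is_continuous ltr01) => x y.
by rewrite mul1r lerBlDr (sub_split x y u) addrC ler_normD.
Qed.

Lemma compact_finite_net A (rho : V -> R) : compact A ->
  (forall u, A u -> 0 < rho u) ->
  exists2 s : seq V, {in s, forall u, A u} &
    forall t, A t -> exists2 u, u \in s & `|t - u| < rho u.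
Proof.
rewrite compact_cover => cA rho0.
have [||s sA As] := cA V A (fun u => [set v | `|v - u| < rho u]).
- by move=> u _; exact: open_norm_ball.
- by move=> t At; exists t => //=; rewrite subrr normr0 rho0.
exists (finmap.enum_fset s) => [u us|t /As[u us tu]]; last by exists u.
by have := sA _ us; rewrite inE.
Qed.

(** A countable dense family will replace suprema over neighbourhoods by measurable countable
    suprema. *)
Lemma compact_dense_sequence A : compact A -> A !=set0 ->
  exists2 nu : nat -> V, forall i, A (nu i) &
    forall t e, A t -> 0 < e -> exists i, `|t - nu i| < e.
Proof.
move=> cA [a0 Aa0].
have net n : {s : seq V | {in s, forall u, A u} /\
    forall t, A t -> exists2 u, u \in s & `|t - u| < n.+1%:R^-1}.
  apply: cid; have [s sA As] := @compact_finite_net A (fun=> n.+1%:R^-1) cA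
    (fun _ _ => ltac:(by rewrite invr_gt0)).
  by exists s.
(* The integer encodes a scale and a position in the net of that scale; out-of-range positions yield
   [a0], so every term lies in [A]. *)
pose nu i := let: (n, k) := odflt (0%N, 0%N) (unpickle i) in
  nth a0 (sval (net n)) k.
exists nu => [i|t e At e0].
  rewrite /nu; case: (odflt _ _) => n k; have [sA _] := svalP (net n).
  have [ks|ks] := ltnP k (size (sval (net n))); last by rewrite nth_default.
  by apply: sA; rewrite mem_nth.
have [n ne] : exists n, n.+1%:R^-1 < e.
  exists (Num.truncn e^-1); rewrite invf_plt ?posrE//.
  exact: truncnS_gt.
have [_ /(_ t At)[u us tu]] := svalP (net n).
exists (pickle (n, index u (sval (net n)))).
rewrite /nu pickleK /= nth_index//; exact: lt_trans ne.
Qed.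

End compact_nets.

Section bracketing.
Context {d} {T : measurableType d} {R : realType} {V : normedModType R}.
Variables (mu : probability T R) (A : set V).
Hypothesis cA : compact A.
Variables (f : V -> T -> R) (kappa : T -> R).
Hypothesis mf : forall t, A t -> measurable_fun setT (f t).
Hypothesis fc : forall x, {within A, continuous (f^~ x)}.
Hypothesis ikappa : mu.-integrable setT (EFin \o kappa).
Hypothesis f_kappa : forall t x, A t -> `|f t x| <= kappa x.

(** [w] is the oscillation around [u] over a dense sequence at scale 1 / (N + 1): measurable as a
    countable supremum, dominated by 2 kappa, and tending to 0 pointwise as N grows. Dominated
    convergence makes its integral small. *)
Lemma local_modulus u eps : A u -> 0 < eps ->
  exists rho, exists w : T -> R, [/\ 0 < rho, measurable_fun setT w,
    forall x, 0 <= w x <= 2 * kappa x, \int[mu]_x w x <= eps &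
    forall t x, A t -> `|t - u| < rho -> `|f t x - f u x| <= w x].
Proof.
move=> Au eps0.
have [nu Anu nu_dense] := compact_dense_sequence cA (ex_intro _ u Au).
pose h n k x := if `|nu k - u| < n.+1%:R^-1 then `|f (nu k) x - f u x| else 0.
have h0 n k x : 0 <= h n k x by rewrite /h; case: ifP.
have fk2 t x : A t -> `|f t x - f u x| <= 2 * kappa x.
  move=> At; rewrite (le_trans (ler_normB _ _))//.
  by have := f_kappa x At; have := f_kappa x Au; lra.
have kappa0 x : 0 <= kappa x by exact: le_trans (f_kappa x Au).
have hk n k x : h n k x <= 2 * kappa x.
  by rewrite /h; case: ifP => _; [exact: fk2|rewrite mulr_ge0].
have hub n x : has_ubound (range (h n ^~ x)).
  by exists (2 * kappa x) => _ [k _ <-].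
pose w n x := sups (h n ^~ x) 0.
have wE n x : w n x = sup (range (h n ^~ x)).
  by rewrite /w /sups /sdrop /=; congr sup; apply/seteqP; split => _ [k _ <-]; exists k.
have w_ge n k x : h n k x <= w n x.
  by rewrite wE; apply: ub_le_sup => //; exists k.
have w_le n x c : (forall k, h n k x <= c) -> w n x <= c.
  move=> hc; rewrite wE; apply: ge_sup; first by exists (h n 0 x), 0%N.
  by move=> _ [k _ <-].
have mw n : measurable_fun setT (w n).
  apply: measurable_fun_sups => [x _|k]; first exact: hub.
  rewrite /h; case: (_ < _) => //.
  apply: measurableT_comp => //; apply: measurable_funB; exact: mf.
have w0 n x : 0 <= w n x by exact: le_trans (h0 n 0%N x) (w_ge _ _ _).
have wk n x : w n x <= 2 * kappa x by apply: w_le => k; exact: hk.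
have w_cvg x : w n x @[n --> \oo] --> (0 : R).
  apply/cvgrPdist_le => e e0.
  have [rho rho0 hrho] := within_continuousP (@fc x) Au e0.
  have [N _ hN] : \forall n \near \oo, (n.+1%:R^-1 : R) < rho.
    have := @cvg_harmonic R; move=> /cvgrPdist_lt/(_ rho rho0).
    by apply: filterS => n /=; rewrite sub0r normrN ger0_norm// invr_ge0.
  exists N => // n /hN nrho; rewrite sub0r normrN ger0_norm//.
  apply: w_le => k; rewrite /h; case: ifP => [knu|_]; last exact: ltW.
  by apply/ltW/hrho => //; exact: lt_trans nrho.
have mwE n : measurable_fun setT (EFin \o w n) by exact/measurable_EFinP.
have i2k := integrable_EFinZl measurableT 2 ikappa.
have wkE : {ae mu, forall x n, setT x -> (`|(EFin \o w n) x| <= (2 * kappa x)%:E)%E}.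
  by apply: aeW => x n _; rewrite /= lee_fin ger0_norm.
have wcE : {ae mu, forall x, setT x -> (EFin \o w n) x @[n --> \oo] --> (cst 0%E x : \bar R)}.
  apply: aeW => x _; apply/fine_cvgP; split; first by near=> n.
  exact: w_cvg.
have m0 : measurable_fun [set: T] (cst 0 : T -> \bar R)%E by exact: measurable_cst.
have [_ _] := dominated_convergence measurableT mwE m0 wcE i2k wkE.
rewrite integral0 => /fine_cvgP[_] /cvgrPdist_le/(_ eps eps0)[N _ hN].
have := hN N (leqnn N); rewrite /= sub0r normrN => hNe.
exists N.+1%:R^-1, (w N); split => //.
- by move=> x; rewrite w0 wk.
- by rewrite (le_trans (ler_norm _))//.
move=> t x At tu; apply/ler_addgt0Pr => e e0.
have [rho rho0 hrho] := within_continuousP (@fc x) At e0.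
(* The point of the sequence is close enough to [t] for continuity and also stays inside the ball
   around [u], so the oscillation bound extends from the sequence to [t]. *)
have [||i ti] := nu_dense t (Num.min rho (N.+1%:R^-1 - `|t - u|)) => //.
  by rewrite lt_min rho0 subr_gt0.
move: ti; rewrite lt_min => /andP[ti1 ti2].
have nuu : `|nu i - u| < N.+1%:R^-1.
  rewrite (sub_split (nu i) t u) (le_lt_trans (ler_normD _ _))//.
  by rewrite distrC in ti2; rewrite -ltrBrDl.
rewrite (sub_split _ (f (nu i) x)) (le_trans (ler_normD _ _))// lerD//.
  by have := w_ge N i x; rewrite /h nuu.
by rewrite distrC ltW// hrho// distrC.
Unshelve. all: by end_near. Qed.

Lemma bracketing eps : 0 < eps ->
  exists s : seq V, exists w : V -> T -> R, [/\ {in s, forall u, A u},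
    (forall u, measurable_fun setT (w u)),
    (forall u x, `|w u x| <= 2 * `|kappa x|),
    {in s, forall u, \int[mu]_x w u x <= eps} &
    forall t, A t -> exists2 u, u \in s & forall x, `|f t x - f u x| <= w u x].
Proof.
move=> eps0.
have modulus u : {p : R * (T -> R) | A u -> [/\ 0 < p.1, measurable_fun setT p.2,
    forall x, 0 <= p.2 x <= 2 * kappa x, \int[mu]_x p.2 x <= eps &
    forall t x, A t -> `|t - u| < p.1 -> `|f t x - f u x| <= p.2 x]}.
  apply: cid; have [Au|nAu] := pselect (A u); last by exists (0, cst 0).
  by have [rho [w h]] := local_modulus Au eps0; exists (rho, w).
have [|s sA sn] := @compact_finite_net R V A (fun u => (sval (modulus u)).1) cA.
  by move=> u Au; have [] := svalP (modulus u) Au.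
(* Off the net the bracket is 0, so that measurability and domination hold for every [u]. *)
exists s, (fun u x => if u \in s then (sval (modulus u)).2 x else 0); split => //.
- move=> u; have [us|us] := boolP (u \in s); last exact: measurable_cst.
  by have [] := svalP (modulus u) (sA _ us).
- move=> u x; case: ifPn => [us|_]; last by rewrite normr0 mulr_ge0.
  have [_ _ /(_ x)/andP[w0 wk] _ _] := svalP (modulus u) (sA _ us).
  by rewrite ger0_norm// (le_trans wk)// ler_wpM2l// ler_norm.
- move=> u us; have [_ _ _ wi _] := svalP (modulus u) (sA _ us).
  by under eq_Rintegral do rewrite us.
move=> t At; have [u us tu] := sn t At.
exists u => // x; rewrite us.
by have [_ _ _ _ h] := svalP (modulus u) (sA _ us); exact: h.
Qed.

End bracketing.

(** * Suprema, Jacobians and covariances *)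

Section monotone_integral.
Context {d} {T : measurableType d} {R : realType} (mu : {measure set T -> \bar R}).

(* The integral of a nonnegative function is a supremum over simple functions
   below it, so monotonicity holds without measurability. *)
Lemma ge0_le_integral_sup (f g : T -> \bar R) :
  (forall x, 0 <= f x)%E -> (forall x, f x <= g x)%E ->
  (\int[mu]_x f x <= \int[mu]_x g x)%E.
Proof.
move=> f0 fg; have g0 x : (0 <= g x)%E by exact: le_trans (f0 x) (fg x).
rewrite !ge0_integralTE//; apply: ereal_sup_le => _ [h hf <-].
by exists h => // x; exact: le_trans (hf x) (fg x).
Qed.

End monotone_integral.

Section supnorm.
Context {R : realType} (nrm : forall m n, 'M[R]_(m, n) -> R).

Lemma supnorm_le (U : Type) m n (S : set U) (f : U -> 'M[R]_(m, n)) c t :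
  (supnorm nrm S f <= c%:E)%E -> S t -> nrm (f t) <= c.
Proof.
move=> fc St; rewrite -lee_fin (le_trans _ fc)//.
by apply: ereal_sup_ubound; exists t.
Qed.

Lemma supnorm_ge (U : Type) m n (S : set U) (f : U -> 'M[R]_(m, n)) t :
  S t -> ((nrm (f t))%:E <= supnorm nrm S f)%E.
Proof. by move=> St; apply: ereal_sup_ubound; exists t. Qed.

End supnorm.

Section jacobian.
Context {R : realType} {d p : nat}.

Lemma row_jacobian (f : 'rV[R]_d -> 'rV[R]_p) t i : differentiable f t ->
  row i (jacobian f t) = 'D_(delta_mx 0 i) f t.
Proof. by move=> df; rewrite deriveEjacobian// rowE. Qed.

Lemma jacobian_entry (f : 'rV[R]_d -> 'rV[R]_p) t i j : differentiable f t ->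
  jacobian f t i j = 'D_(delta_mx 0 i) (fun s => f s 0 j) t.
Proof.
move=> df; have [_ ->] := is_derive_entry (delta_mx 0 i) j df.
by rewrite -rowE [RHS]mxE.
Qed.

Lemma empirical_mean_jacobian n (F : 'I_n -> 'rV[R]_d -> 'rV[R]_p) t :
  (forall l, differentiable (F l) t) ->
  differentiable (fun s => n%:R^-1 *: \sum_l F l s) t /\
  jacobian (fun s => n%:R^-1 *: \sum_l F l s) t =
    n%:R^-1 *: \sum_l jacobian (F l) t.
Proof.
move=> dF.
have E : (fun s => n%:R^-1 *: \sum_l F l s) = n%:R^-1 *: (\sum_l F l).
  by apply/funext => s; rewrite fctE fct_sumE.
have ds : differentiable (\sum_l F l) t by exact: differentiable_sum.
have df : differentiable (fun s => n%:R^-1 *: \sum_l F l s) t.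
  by rewrite E; exact: differentiableZ.
split => //; apply/row_matrixP => i.
rewrite row_jacobian// E deriveZ; last exact: diff_derivable.
rewrite derive_sum; last by move=> l; exact: diff_derivable.
apply/rowP => j; rewrite !mxE !summxE; congr (_ * _).
by apply: eq_bigr => l _; rewrite -row_jacobian// mxE.
Qed.

End jacobian.

Section measurable_jacobian.
Context {dT} {T : measurableType dT} {R : realType} {d : nat}.

(** The derivative is a pointwise limit of difference quotients along a fixed sequence of steps,
    each measurable in x. *)
Lemma measurable_derive (g : 'rV[R]_d -> T -> R) (t u : 'rV[R]_d) (N : set 'rV[R]_d) r :
  0 < r -> (forall s, `|s - t| < r -> N s) ->
  (forall s, N s -> measurable_fun setT (g s)) ->
  (forall x, derivable (g^~ x) t u) ->
  measurable_fun setT (fun x => 'D_u (g^~ x) t).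
Proof.
move=> r0 rN mg dg.
pose e := r / (1 + `|u|); have e0 : 0 < e by rewrite divr_gt0// ltr_pwDl.
(* Denominators of at least 2 keep the shifted point strictly inside the ball. *)
pose s n := e / n.+2%:R.
have s0 n : 0 < s n by rewrite divr_gt0.
have sN n : N (s n *: u + t).
  apply: rN; rewrite addrK normrZ gtr0_norm//.
  rewrite (@le_lt_trans _ _ (s n * (1 + `|u|)))//.
    by rewrite ler_wpM2l ?(ltW (s0 n))// lerDr.
  rewrite /s /e mulrAC divfK ?gt_eqF ?ltr_pwDl//.
  by rewrite ltr_pdivrMr// ltr_pMr// ltr1n.
have tN : N t by apply: rN; rewrite subrr normr0.
apply: (@measurable_fun_cvg _ _ _ _ (fun n x => (s n)^-1 * (g (s n *: u + t) x - g t x))).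
  move=> n; apply: measurable_funM => //; apply: measurable_funB; exact: mg.
move=> x _.
have s_cvg : s n @[n --> \oo] --> (0 : R).
  rewrite -(mulr0 e); apply: cvgMr.
  have := @cvg_harmonic R; rewrite -(cvg_shiftS (@harmonic R)).
  exact.
have := dg x => /cvg_ex[l hl].
have -> : 'D_u (g^~ x) t = l by apply/cvg_lim.
have sd : s n @[n --> \oo] --> (0 : R)^'.
  move=> A; rewrite /dnbhs/= /within/= => A0.
  have : \forall n \near \oo, s n != 0 -> A (s n) := s_cvg _ A0.
  by apply: filterS => n; apply; rewrite gt_eqF ?s0.
exact: (cvg_comp _ _ sd hl).
Qed.

End measurable_jacobian.

Section second_moments.
Context {d} {T : measurableType d} {R : realType} (mu : probability T R).
Implicit Types f g : T -> R.

Lemma Rintegral_sqr_le f :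
  mu.-integrable setT (EFin \o f) ->
  mu.-integrable setT (EFin \o (fun x => f x ^+ 2)) ->
  (\int[mu]_x f x) ^+ 2 <= \int[mu]_x (f x ^+ 2).
Proof.
move=> i1 i2; set m := \int[mu]_x _.
have ic c : mu.-integrable setT (EFin \o (fun=> c : R)) by exact: finite_measure_integrable_cst.
have : 0 <= \int[mu]_x ((f x - m) ^+ 2) by apply: Rintegral_ge0 => x _; exact: sqr_ge0.
have -> : \int[mu]_x ((f x - m) ^+ 2) =
    \int[mu]_x (f x ^+ 2 + (- (2 * m) * f x + m ^+ 2)).
  by apply: eq_Rintegral => x _; ring.
have iz := integrable_EFinZl measurableT (- (2 * m)) i1.
have i3 := integrable_EFinD measurableT iz (ic (m ^+ 2)).
rewrite RintegralD// RintegralD// RintegralZl// -/m Rintegral_cst//.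
have mu1 : fine (mu [set: T]) = 1 by rewrite probability_setT.
by rewrite mu1; move: (\int[mu]_x _) => M; rewrite mulr1 => h; lra.
Qed.

Lemma Rintegral_lin_sum (I : Type) (s : seq I) (c : I -> R) (F : I -> T -> R) :
  (forall i, mu.-integrable setT (EFin \o F i)) ->
  mu.-integrable setT (EFin \o (fun x => \sum_(i <- s) c i * F i x)) /\
  \int[mu]_x (\sum_(i <- s) c i * F i x) = \sum_(i <- s) c i * \int[mu]_x F i x.
Proof.
move=> iF; elim: s => [|i s [IHi IH]].
  have E : (fun x => \sum_(i <- [::]) c i * F i x) = fun=> 0.
    by apply/funext => x; rewrite big_nil.
  by rewrite E big_nil Rintegral_cst// mul0r; split => //; exact: finite_measure_integrable_cst.
have iZ := integrable_EFinZl measurableT (c i) (iF i).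
have E : (fun x => \sum_(j <- i :: s) c j * F j x) =
    (fun x => c i * F i x + \sum_(j <- s) c j * F j x).
  by apply/funext => x; rewrite big_cons.
rewrite E big_cons RintegralD// RintegralZl// IH; split => //.
exact: integrable_EFinD.
Qed.

Definition cov_mx k (F : 'I_k -> T -> R) : 'M[R]_k :=
  \matrix_(i, j) (\int[mu]_x (F i x * F j x) - \int[mu]_x F i x * \int[mu]_x F j x).

Variables (k : nat) (F : 'I_k -> T -> R).
Hypothesis F4 : forall j, L4 mu (F j).

Lemma cov_mx_sym : (cov_mx F)^T = cov_mx F.
Proof.
apply/matrixP => i j; rewrite !mxE; congr (_ - _); last by rewrite mulrC.
by apply: eq_Rintegral => x _; rewrite mulrC.
Qed.

(** The form at z is the variance of the combination of the [F i] with coefficients z. *)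
Lemma cov_mx_psd z : 0 <= bil z (cov_mx F) z.
Proof.
pose G x := \sum_(i < k) z 0 i * F i x.
have iF j := L4_integrable (F4 j).
have [iG GE] := Rintegral_lin_sum (index_enum _) (fun i => z 0 i) iF.
pose G2 (x : T) := \sum_(p <- index_enum ('I_k * 'I_k)%type) (z 0 p.1 * z 0 p.2) * (F p.1 x * F p.2 x).
have G2E x : G x ^+ 2 = G2 x.
  rewrite /G /G2 expr2 mulr_suml -(pair_bigA _ (fun i j => z 0 i * z 0 j * (F i x * F j x)))/=.
  by apply: eq_bigr => i _; rewrite mulr_sumr; apply: eq_bigr => j _; ring.
have iFF (p : 'I_k * 'I_k) : mu.-integrable setT (EFin \o (fun x => F p.1 x * F p.2 x)).
  exact: L4M_integrable.
have [iG2 G2I] := Rintegral_lin_sum (index_enum ('I_k * 'I_k)%type)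
  (fun p => z 0 p.1 * z 0 p.2) iFF.
have := @Rintegral_sqr_le G iG.
rewrite (_ : (fun x => G x ^+ 2) = G2); last by apply/funext.
move/(_ iG2); rewrite GE G2I -subr_ge0; congr (0 <= _).
rewrite bilE exchange_big/= expr2 mulr_suml.
rewrite -(pair_bigA _ (fun i j => z 0 i * z 0 j * \int[mu]_x (F i x * F j x)))/= -sumrB.
apply: eq_bigr => i _; rewrite mulr_sumr -sumrB; apply: eq_bigr => j _.
by rewrite !mxE; ring.
Qed.

Lemma norm_cov_mx_le (kappa : T -> R) : L4 mu kappa ->
  (forall j x, `|F j x| <= kappa x) ->
  `|cov_mx F| <= 2 * \int[mu]_x (kappa x ^+ 2).
Proof.
move=> k4 Fk.
have i1 := L4_integrable k4.
have i2 : mu.-integrable setT (EFin \o (fun x => kappa x ^+ 2)) by exact: (L4M_integrable k4 k4).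
have h := Rintegral_sqr_le i1 i2.
have m0 : 0 <= \int[mu]_x (kappa x ^+ 2) by rewrite (le_trans _ h)// sqr_ge0.
apply: norm_matrix_le => [|i j]; first by rewrite mulr_ge0.
have hi l : `|\int[mu]_x F l x| <= \int[mu]_x kappa x.
  have iF := L4_integrable (F4 l).
  rewrite (le_trans (le_normr_Rintegral _ _))//.
  apply: le_Rintegral => //; exact: integrable_norm.
rewrite mxE (le_trans (ler_normB _ _))// mulrDl mul1r lerD//.
  have iFF := L4M_integrable (F4 i) (F4 j).
  rewrite (le_trans (le_normr_Rintegral _ _))//.
  apply: le_Rintegral => //; first exact: integrable_norm.
  by move=> x _; rewrite normrM expr2 ler_pM.
by rewrite normrM (le_trans _ h)// expr2 ler_pM.
Qed.

End second_moments.

(** * Limits of second moments *)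

Section covariance_perturbation.
Context {d} {T : measurableType d} {R : realType} (P : probability T R).
Implicit Types x y v u r s : T -> R.

Lemma L4_sub_mean r : L4 P r -> L4 P (fun w => r w - \int[P]_w r w).
Proof. by move=> r4; apply: L4D => //; exact: L4_cst. Qed.

Lemma Rintegral_sub_mean r : L4 P r -> \int[P]_w (r w - \int[P]_w r w) = 0.
Proof.
move=> r4; rewrite RintegralB//; [|exact: L4_integrable|exact: finite_measure_integrable_cst].
rewrite Rintegral_cst//.
have P1 : fine (P [set: T]) = 1 by rewrite probability_setT.
by rewrite P1 mulr1 subrr.
Qed.

Lemma L4_sqr_integrable r : L4 P r -> P.-integrable setT (EFin \o (fun w => r w ^+ 2)).
Proof. by move=> r4; exact: (L4M_integrable r4 r4). Qed.

Lemma Rintegral_centered_sqr_le r : L4 P r ->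
  \int[P]_w (r w - \int[P]_w r w) ^+ 2 <= \int[P]_w (r w ^+ 2).
Proof.
move=> r4; set m := \int[P]_w r w.
have i1 := L4_integrable r4; have i2 := L4_sqr_integrable r4.
have ic c : P.-integrable setT (EFin \o (fun=> c : R)) by exact: finite_measure_integrable_cst.
have -> : \int[P]_w (r w - m) ^+ 2 = \int[P]_w (r w ^+ 2 + (- (2 * m) * r w + m ^+ 2)).
  by apply: eq_Rintegral => w _; ring.
have iz := integrable_EFinZl measurableT (- (2 * m)) i1.
have i3 := integrable_EFinD measurableT iz (ic (m ^+ 2)).
rewrite RintegralD// RintegralD// RintegralZl// -/m Rintegral_cst//.
have P1 : fine (P [set: T]) = 1 by rewrite probability_setT.
rewrite P1; have : 0 <= m ^+ 2 by exact: sqr_ge0.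
by move: (\int[P]_w _) => M; lra.
Qed.

Lemma young (t a b : R) : 0 < t -> `|a * b| <= (t * a ^+ 2 + t^-1 * b ^+ 2) / 2.
Proof.
move=> t0; rewrite normrM -(real_normK (num_real a)) -(real_normK (num_real b)).
move: `|a| `|b| => p q; rewrite -subr_ge0.
have -> : (t * p ^+ 2 + t^-1 * q ^+ 2) / 2 - p * q = t^-1 * (t * p - q) ^+ 2 / 2.
  by field; rewrite gt_eqF.
by rewrite divr_ge0// mulr_ge0 ?sqr_ge0// invr_ge0 ltW.
Qed.

(** Young's inequality with a free weight [t] on the cross terms; the extra 1 beside t^-1 comes from
    the product of the two remainders. In the application n times the integrals of v^2 and u^2 is
    fixed and n times those of r^2 and s^2 tends to 0, so [t] is fixed first. *)
Lemma covariance_perturbation x y v u r s (c c' t : R) : 0 < t ->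
  L4 P v -> L4 P u -> L4 P r -> L4 P s ->
  \int[P]_w v w = 0 -> \int[P]_w u w = 0 ->
  (forall w, x w = c + v w + r w) -> (forall w, y w = c' + u w + s w) ->
  `|\int[P]_w ((x w - \int[P]_w x w) * (y w - \int[P]_w y w))
    - \int[P]_w (v w * u w)| <=
  t / 2 * (\int[P]_w (v w ^+ 2) + \int[P]_w (u w ^+ 2)) +
  (t^-1 + 1) / 2 * (\int[P]_w (r w ^+ 2) + \int[P]_w (s w ^+ 2)).
Proof.
move=> t0 v4 u4 r4 s4 v0 u0 xE yE.
have ic e : P.-integrable setT (EFin \o (fun=> e : R)) by exact: finite_measure_integrable_cst.
have P1 : fine (P [set: T]) = 1 by rewrite probability_setT.
have mean (z a b : T -> R) e : L4 P a -> L4 P b -> \int[P]_w a w = 0 ->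
    (forall w, z w = e + a w + b w) -> \int[P]_w z w = e + \int[P]_w b w.
  move=> a4 b4 a0 zE; have -> : z = (fun w => e + a w + b w) by apply/funext.
  have i1 := integrable_EFinD measurableT (ic e) (L4_integrable a4).
  rewrite RintegralD//; last exact: L4_integrable.
  rewrite RintegralD//; last exact: L4_integrable.
  by rewrite Rintegral_cst// P1 mulr1 a0 addr0.
pose r' w := r w - \int[P]_w r w; pose s' w := s w - \int[P]_w s w.
have r'4 : L4 P r' by exact: L4_sub_mean.
have s'4 : L4 P s' by exact: L4_sub_mean.
have -> : \int[P]_w ((x w - \int[P]_w x w) * (y w - \int[P]_w y w)) =
    \int[P]_w ((v w + r' w) * (u w + s' w)).
  apply: eq_Rintegral => w _; rewrite (mean x v r c)// (mean y u s c')// xE yE /r' /s'.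
  by congr (_ * _); ring.
rewrite -RintegralB//; [|by apply: L4M_integrable; exact: L4D|exact: L4M_integrable].
pose b w := t / 2 * (v w ^+ 2 + u w ^+ 2) + (t^-1 + 1) / 2 * (r' w ^+ 2 + s' w ^+ 2).
have iv := L4_sqr_integrable v4; have iu := L4_sqr_integrable u4.
have ir := L4_sqr_integrable r'4; have is_ := L4_sqr_integrable s'4.
have ivu := integrable_EFinD measurableT iv iu.
have irs := integrable_EFinD measurableT ir is_.
have tvu := integrable_EFinZl measurableT (t / 2) ivu.
have trs := integrable_EFinZl measurableT ((t^-1 + 1) / 2) irs.
have ib : P.-integrable setT (EFin \o b) by exact: integrable_EFinD.
have iD : P.-integrable setT (EFin \o (fun w => (v w + r' w) * (u w + s' w) - v w * u w)).
  have := integrable_EFinD measurableT (L4M_integrable (L4D v4 r'4) (L4D u4 s'4))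
    (integrable_EFinZl measurableT (- 1) (L4M_integrable v4 u4)).
  by apply: eq_integrable => // w _; rewrite /= mulN1r.
rewrite (le_trans (le_normr_Rintegral _ _))//.
rewrite (@le_trans _ _ (\int[P]_w b w))//.
  apply: le_Rintegral => //; first exact: integrable_norm.
  move=> w _; rewrite /b /=.
  have -> : (v w + r' w) * (u w + s' w) - v w * u w =
    v w * s' w + u w * r' w + r' w * s' w by ring.
  rewrite (le_trans (ler_normD _ _))// (le_trans (lerD (ler_normD _ _) (lexx _)))//.
  have := young (v w) (s' w) t0; have := young (u w) (r' w) t0.
  have := young (r' w) (s' w) ltr01; rewrite invr1.
  move: (`|_|) (`|_|) (`|_|) => p q m.
  by move: (v w ^+ 2) (u w ^+ 2) (r' w ^+ 2) (s' w ^+ 2) t^-1 => *; nra.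
rewrite /b RintegralD// !RintegralZl// !RintegralD//.
rewrite lerD2l ler_wpM2l//.
  by rewrite divr_ge0// addr_ge0// invr_ge0 ltW.
by rewrite lerD// Rintegral_centered_sqr_le.
Qed.

End covariance_perturbation.

Section sqn.
Context {R : realType} {d : nat}.
Implicit Types x y : 'rV[R]_d.

(** The squared Euclidean norm, preferred for integration because it is a polynomial in the
    entries. *)
Definition sqn x : R := \sum_i x 0 i ^+ 2.

Lemma sqn_ge0 x : 0 <= sqn x.
Proof. by apply: sumr_ge0 => i _; exact: sqr_ge0. Qed.

Lemma sqr_entry_le_sqn x i : x 0 i ^+ 2 <= sqn x.
Proof.
by rewrite /sqn (bigD1 i)//= lerDl sumr_ge0// => j _; exact: sqr_ge0.
Qed.

Lemma norm_sqr_le_sqn x : `|x| ^+ 2 <= sqn x.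
Proof.
have : `|x| <= Num.sqrt (sqn x).
  apply: norm_matrix_le => [|i j]; first exact: sqrtr_ge0.
  by rewrite (ord1 i) -sqrtr_sqr ler_wsqrtr// sqr_entry_le_sqn.
move=> h; have : `|x| ^+ 2 <= Num.sqrt (sqn x) ^+ 2.
  by rewrite lerXn2r// ?nnegrE ?sqrtr_ge0.
by rewrite sqr_sqrtr// sqn_ge0.
Qed.

Lemma sqn_le_norm_sqr x : sqn x <= d%:R * `|x| ^+ 2.
Proof.
rewrite mulr_natl -[X in _ *+ X]card_ord -sumr_const; apply: ler_sum => i _.
by rewrite -(real_normK (num_real _)) lerXn2r ?nnegrE// ler_norm_entry.
Qed.

Lemma sqnD_le x y : sqn (x + y) <= 2 * sqn x + 2 * sqn y.
Proof.
rewrite /sqn !mulr_sumr -big_split/=; apply: ler_sum => i _; rewrite mxE.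
rewrite -subr_ge0.
have -> : 2 * x 0 i ^+ 2 + 2 * y 0 i ^+ 2 - (x 0 i + y 0 i) ^+ 2 =
  (x 0 i - y 0 i) ^+ 2 by ring.
exact: sqr_ge0.
Qed.

End sqn.

(** * From mean square bounds to the asymptotic statements *)

Section asymptotics.
Context {dO} {Omega : measurableType dO} {R : realType} (P : probability Omega R).
Context {d : nat}.
Variables (nrm : 'rV[R]_d -> R) (nrm_norm : is_norm nrm).
Variables (th : nat -> Omega -> 'rV[R]_d) (thm : nat -> nat -> Omega -> 'rV[R]_d).
Variables (t0 : 'rV[R]_d) (v : nat -> Omega -> 'rV[R]_d) (B : 'M[R]_d).
Variables (phi : nat -> R) (delta : nat -> R) (C : R) (m0 : nat).
Hypothesis C0 : 0 <= C.
Hypothesis phi0 : forall m, (m0 <= m)%N -> 0 < phi m.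
Hypothesis n_delta : n%:R * delta n @[n --> \oo] --> (0 : R).
Hypothesis delta0 : forall n, 0 <= delta n.
Hypothesis th4 : forall n i, (0 < n)%N -> L4 P (fun w => th n w 0 i).
Hypothesis thm4 : forall n m i, (0 < n)%N -> L4 P (fun w => thm n m w 0 i).
Hypothesis v4 : forall n i, (0 < n)%N -> L4 P (fun w => v n w 0 i).
Hypothesis th_v : forall n, (0 < n)%N ->
  \int[P]_w sqn (th n w - t0 - v n w) <= delta n.
Hypothesis thm_th : forall n m, (0 < n)%N -> (m0 <= m)%N ->
  \int[P]_w sqn (thm n m w - th n w) <= delta n + C * phi m ^- 2.

Let L4_entryB (f g : Omega -> 'rV[R]_d) : (forall i, L4 P (fun w => f w 0 i)) ->
  (forall i, L4 P (fun w => g w 0 i)) -> forall i, L4 P (fun w => (f w - g w) 0 i).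
Proof.
move=> f4 g4 i; have := L4D (f4 i) (L4Z (- 1) (g4 i)).
rewrite (_ : (fun w => (f w - g w) 0 i) = (fun w => f w 0 i + (-1) * g w 0 i))//.
by apply/funext => w; rewrite !mxE mulN1r.
Qed.

Let isqn (f : Omega -> 'rV[R]_d) : (forall i, L4 P (fun w => f w 0 i)) ->
  P.-integrable setT (EFin \o (fun w => sqn (f w))).
Proof.
move=> f4; have [] := @Rintegral_lin_sum _ _ _ P 'I_d (index_enum _) (fun=> 1)
  (fun i w => f w 0 i ^+ 2).
  by move=> i; exact: L4_sqr_integrable.
by under eq_fun do under eq_bigr do rewrite mul1r.
Qed.

Let Efin (f : Omega -> R) : P.-integrable setT (EFin \o f) ->
  (\int[P]_w (f w)%:E = (\int[P]_w f w)%:E)%E.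
Proof. by move=> fi; rewrite /Rintegral fineK// integrable_fin_num. Qed.

Lemma approximation_error :
  exists a b : nat * nat -> R,
   [/\ \forall nm \near filter_prod \oo \oo,
         (nm.1%:R%:E * 'E_P[(fun w : Omega =>
            nrm (thm nm.1 nm.2 w - th nm.1 w) ^+ 2)%R])%E
         = (a nm + b nm)%:E,
       forall nm : nat * nat, a nm =O_(nm \near filter_prod \oo \oo)
         (nm.1%:R * phi nm.2 ^- 2 : R) &
       b @ filter_prod \oo \oo --> (0 : R)].
Proof.
have [c c0 nc] := is_norm_le_mx_norm nrm_norm.
pose e (nm : nat * nat) := ('E_P[(fun w : Omega =>
  nrm (thm nm.1 nm.2 w - th nm.1 w) ^+ 2)%R])%E.
have e_ge0 nm : (0 <= e nm)%E.
  by rewrite /e unlock; apply: integral_ge0 => w _; rewrite lee_fin sqr_ge0.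
have e_le nm : (0 < nm.1)%N -> (m0 <= nm.2)%N ->
    (e nm <= (c ^+ 2 * (delta nm.1 + C * phi nm.2 ^- 2))%:E)%E.
  move=> n0 mm0; rewrite /e unlock.
  have i1 : P.-integrable setT (EFin \o (fun w => sqn (thm nm.1 nm.2 w - th nm.1 w))).
    by apply: isqn; apply: L4_entryB => i; [exact: thm4|exact: th4].
  apply: (@le_trans _ _ (\int[P]_w (c ^+ 2 * sqn (thm nm.1 nm.2 w - th nm.1 w))%:E)%E).
    apply: ge0_le_integral_sup => w; first by rewrite lee_fin sqr_ge0.
    rewrite lee_fin (@le_trans _ _ ((c * `|thm nm.1 nm.2 w - th nm.1 w|) ^+ 2))//.
      by rewrite lerXn2r ?nnegrE ?mulr_ge0 ?(ltW c0)//; exact: is_norm_ge0.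
    by rewrite exprMn ler_wpM2l ?sqr_ge0// norm_sqr_le_sqn.
  rewrite Efin; last exact: integrable_EFinZl.
  by rewrite lee_fin RintegralZl// ler_wpM2l ?sqr_ge0// thm_th.
pose s nm := nm.1%:R * fine (e nm).
(* Truncating at the multiple of n delta_n gives a part that tends to 0 whatever m is; the excess
   [s - b] is then at most a multiple of n phi_m^-2, and the two parts add up exactly. *)
pose b nm := Num.min (s nm) (c ^+ 2 * (nm.1%:R * delta nm.1)).
have s0 nm : 0 <= s nm by rewrite mulr_ge0// fine_ge0.
have near_n : \forall nm \near filter_prod \oo \oo, (0 < nm.1)%N /\ (m0 <= nm.2)%N.
  exists ([set n | (0 < n)%N], [set m | (m0 <= m)%N]) => /=.
    by split; [exists 1%N|exists m0].
  by move=> [n m] [].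
exists (fun nm => s nm - b nm), b; split.
- apply: filterS near_n => nm [n0 mm0]; rewrite subrK /s EFinM fineK//.
  by rewrite ge0_fin_numE// (le_lt_trans (e_le _ n0 mm0))// ltry.
- pose FP : set_system (nat * nat) := filter_prod \oo \oo.
  have : (fun nm => s nm - b nm) =O_FP (fun nm => nm.1%:R * phi nm.2 ^- 2 : R).
    apply/eqO_exP; exists (c ^+ 2 * C + 1).
      by rewrite ltr_wpDl// mulr_ge0// sqr_ge0.
    apply: filterS near_n => nm [n0 mm0].
    have bs : b nm <= s nm by rewrite ge_min lexx.
    rewrite ger0_norm ?subr_ge0// ger0_norm; last first.
      by rewrite mulr_ge0// invr_ge0 exprn_ge0// ltW// phi0.
    have p0 : 0 <= nm.1%:R * phi nm.2 ^- 2.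
      by rewrite mulr_ge0// invr_ge0 exprn_ge0// ltW// phi0.
    have sle : s nm <= c ^+ 2 * (nm.1%:R * delta nm.1) + c ^+ 2 * C * (nm.1%:R * phi nm.2 ^- 2).
      rewrite /s; have := e_le _ n0 mm0.
      rewrite -[e nm]fineK; last by rewrite ge0_fin_numE// (le_lt_trans (e_le _ n0 mm0))// ltry.
      rewrite lee_fin => /(ler_wpM2l (ler0n R nm.1))/le_trans; apply.
      by rewrite le_eqVlt; apply/orP; left; apply/eqP; ring.
    rewrite /b; case: (leP (s nm)) => _.
      by rewrite subrr mulr_ge0// addr_ge0// mulr_ge0// sqr_ge0.
    rewrite lerBlDl mulrDl mul1r (le_trans sle)// lerD2l lerDl//.
  by move=> h nm; exact: (congr1 (fun g => g nm) h).
- have : (fun nm : nat * nat => c ^+ 2 * (nm.1%:R * delta nm.1)) @ filter_prod \oo \oo --> (0 : R).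
    rewrite -(mulr0 (c ^+ 2)); apply: cvgMr.
    exact: (cvg_comp _ _ cvg_fst n_delta).
  apply: squeeze_cvgr; last exact: cvg_cst.
  near=> nm; apply/andP; split.
    by rewrite le_min s0 mulr_ge0 ?sqr_ge0// mulr_ge0.
  by rewrite ge_min lexx orbT.
Unshelve. all: by end_near. Qed.

Hypothesis v_mean : forall n i, (0 < n)%N -> \int[P]_w v n w 0 i = 0.
Hypothesis v_cov : forall n i j, (0 < n)%N ->
  n%:R * \int[P]_w (v n w 0 i * v n w 0 j) = B i j.

Variable F : set_system (nat * nat).
Hypothesis PF : ProperFilter F.
Hypothesis F_oo : F --> filter_prod \oo \oo.
Hypothesis F_phi : nm.1%:R / phi nm.2 ^+ 2 @[nm --> F] --> (0 : R).

(** Bounds the mean square of the whole remainder [r]: twice the bound for [thm - th] plus twice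
    that for [th - t0 - v]. *)
Let rho (nm : nat * nat) := 4 * delta nm.1 + 2 * (C * phi nm.2 ^- 2).

Let near_F : \forall nm \near F, (0 < nm.1)%N /\ (m0 <= nm.2)%N.
Proof.
apply: F_oo; exists ([set n | (0 < n)%N], [set m | (m0 <= m)%N]) => /=.
  by split; [exists 1%N|exists m0].
by move=> [n m] [].
Qed.

Let n_rho : nm.1%:R * rho nm @[nm --> F] --> (0 : R).
Proof.
have h1 : (fun nm : nat * nat => nm.1%:R * delta nm.1) @ F --> (0 : R).
  move=> A A0; apply: F_oo.
  exact: (cvg_comp _ _ cvg_fst n_delta A A0).
have -> : (fun nm => nm.1%:R * rho nm) =
    (fun nm => 4 * (nm.1%:R * delta nm.1) + (2 * C) * (nm.1%:R / phi nm.2 ^+ 2)).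
  by apply/funext => nm; rewrite /rho; ring.
rewrite -[X in _ --> X](_ : 4 * 0 + 2 * C * 0 = 0 :> R); last by ring.
by apply: cvgD; apply: cvgMr.
Qed.

Let r (nm : nat * nat) w := thm nm.1 nm.2 w - t0 - v nm.1 w.

Let r4 nm i : (0 < nm.1)%N -> L4 P (fun w => r nm w 0 i).
Proof.
move=> n0; apply: L4_entryB; last by move=> j; exact: v4.
by apply: L4_entryB => j; [exact: thm4|exact: L4_cst].
Qed.

Let r_le nm : (0 < nm.1)%N -> (m0 <= nm.2)%N -> \int[P]_w sqn (r nm w) <= rho nm.
Proof.
move=> n0 mm0.
have i1 : P.-integrable setT (EFin \o (fun w => sqn (thm nm.1 nm.2 w - th nm.1 w))).
  by apply: isqn; apply: L4_entryB => i; [exact: thm4|exact: th4].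
have i2 : P.-integrable setT (EFin \o (fun w => sqn (th nm.1 w - t0 - v nm.1 w))).
  apply: isqn; apply: L4_entryB => i; last exact: v4.
  by move: i; apply: L4_entryB => i; [exact: th4|exact: L4_cst].
have i3 : P.-integrable setT (EFin \o (fun w => sqn (r nm w))).
  by apply: isqn => i; exact: r4.
have z1 := integrable_EFinZl measurableT 2 i1.
have z2 := integrable_EFinZl measurableT 2 i2.
rewrite (@le_trans _ _ (\int[P]_w (2 * sqn (thm nm.1 nm.2 w - th nm.1 w) +
    2 * sqn (th nm.1 w - t0 - v nm.1 w))))//.
  apply: le_Rintegral => //; first exact: integrable_EFinD.
  move=> w _; apply: le_trans (sqnD_le _ _).
  rewrite /r (_ : thm nm.1 nm.2 w - th nm.1 w + (th nm.1 w - t0 - v nm.1 w) =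
    thm nm.1 nm.2 w - t0 - v nm.1 w)//.
  by rewrite -!addrA addKr.
rewrite RintegralD// !RintegralZl//.
by have := th_v n0; have := thm_th n0 mm0; rewrite /rho; lra.
Qed.

Let r_entry_le nm i : (0 < nm.1)%N -> (m0 <= nm.2)%N ->
  \int[P]_w (r nm w 0 i ^+ 2) <= rho nm.
Proof.
move=> n0 mm0; apply: le_trans (r_le n0 mm0).
apply: le_Rintegral => //.
- by apply: L4_sqr_integrable; exact: r4.
- by apply: isqn => j; exact: r4.
- by move=> w _; exact: sqr_entry_le_sqn.
Qed.

Let v_sqr n i : (0 < n)%N -> n%:R * \int[P]_w (v n w 0 i ^+ 2) = B i i.
Proof. by move=> n0; rewrite -(v_cov i i n0). Qed.

Lemma asymptotically_efficient : asymptotic_variance P F thm B.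
Proof.
rewrite /asymptotic_variance.
suff entry i j : (fun nm : nat * nat => nm.1%:R *
    fine (covariance P (fun w => thm nm.1 nm.2 w 0 i) (fun w => thm nm.1 nm.2 w 0 j))) @ F --> B i j.
  move=> A /= [Q hQ QA].
  have : \forall nm \near F, forall i j, Q i j (nm.1%:R *
    fine (covariance P (fun w => thm nm.1 nm.2 w 0 i) (fun w => thm nm.1 nm.2 w 0 j))).
    apply: filter_forall => i; apply: filter_forall => j; exact: entry (hQ i j).
  apply: filterS => nm h; apply: QA => i j; rewrite !mxE; exact: h.
apply/cvgrPdist_le => eps eps0.
have B0 l : 0 <= B l l.
  rewrite -(v_sqr l (ltn0Sn 0)) mulr_ge0// Rintegral_ge0// => w _; exact: sqr_ge0.
(* With this weight the part coming from the diagonal entries of [B] is at most eps / 2, and the 1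
   guards against a zero denominator. *)
pose t := eps / (B i i + B j j + 1).
have Bs : 0 < B i i + B j j + 1 by rewrite ltr_wpDl// addr_ge0.
have t0' : 0 < t by rewrite divr_gt0.
have tB : t / 2 * (B i i + B j j) <= eps / 2.
  rewrite /t mulrAC ler_wpM2r// mulrAC ler_pdivrMr// ler_wpM2l ?(ltW eps0)//.
  by rewrite lerDl.
have e1 : 0 < eps / 2 / (t^-1 + 1) by rewrite !divr_gt0// addr_gt0// invr_gt0.
have /cvgrPdist_le/(_ _ e1) h := n_rho.
near=> nm.
have [n0 mm0] : (0 < nm.1)%N /\ (m0 <= nm.2)%N by near: nm; exact: near_F.
have hr : nm.1%:R * rho nm <= eps / 2 / (t^-1 + 1).
  have : `|0 - nm.1%:R * rho nm| <= eps / 2 / (t^-1 + 1) by near: nm; exact: h.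
  by rewrite sub0r normrN => /(le_trans (ler_norm _)).
have cE : fine (covariance P (fun w => thm nm.1 nm.2 w 0 i) (fun w => thm nm.1 nm.2 w 0 j)) =
  \int[P]_w ((thm nm.1 nm.2 w 0 i - \int[P]_w thm nm.1 nm.2 w 0 i) *
    (thm nm.1 nm.2 w 0 j - \int[P]_w thm nm.1 nm.2 w 0 j)).
  by rewrite unlock /Rintegral unlock.
have xE l w : thm nm.1 nm.2 w 0 l = t0 0 l + v nm.1 w 0 l + r nm w 0 l.
  by rewrite /r !mxE; ring.
have := covariance_perturbation t0' (v4 i n0) (v4 j n0) (r4 i n0) (r4 j n0)
  (v_mean i n0) (v_mean j n0) (xE i) (xE j).
rewrite -cE distrC => hc.
rewrite -(v_cov i j n0) -mulrBr normrM (ger0_norm (ler0n R _)).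
rewrite (le_trans (ler_wpM2l (ler0n R _) hc))//.
move: (r_entry_le i n0 mm0) (r_entry_le j n0 mm0) (v_sqr i n0) (v_sqr j n0).
set vi := \int[P]_w (v nm.1 w 0 i ^+ 2); set vj := \int[P]_w (v nm.1 w 0 j ^+ 2).
set ri := \int[P]_w (r nm w 0 i ^+ 2); set rj := \int[P]_w (r nm w 0 j ^+ 2).
move=> hri hrj hvi hvj.
have T0 : 0 < t^-1 + 1 by rewrite addr_gt0// invr_gt0.
rewrite (_ : nm.1%:R * _ = t / 2 * (nm.1%:R * vi + nm.1%:R * vj) +
  (t^-1 + 1) * (nm.1%:R * ((ri + rj) / 2))); last by ring.
rewrite hvi hvj [leRHS]splitr lerD//.
have -> : eps / 2 = (t^-1 + 1) * (eps / 2 / (t^-1 + 1)).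
  by rewrite [RHS]mulrC divfK// gt_eqF.
rewrite ler_wpM2l ?(ltW T0)// (le_trans _ hr)// ler_wpM2l//; lra.
Unshelve. all: by end_near. Qed.

Hypothesis thm_meas : forall n m, measurable_fun setT (thm n m).

(** Chebyshev's inequality, with n times the mean square of [v] equal to the trace of [B] and n
    times that of the remainder eventually below 1. *)
Lemma root_n_consistency : root_n_consistent P nrm F thm t0.
Proof.
move=> eps eps0; have [c c0 nc] := is_norm_le_mx_norm nrm_norm.
pose trB := \sum_i B i i.
have v2 n : (0 < n)%N -> n%:R * \int[P]_w sqn (v n w) = trB.
  move=> n0; have [_] := @Rintegral_lin_sum _ _ _ P 'I_d (index_enum _) (fun=> 1)
    (fun i w => v n w 0 i ^+ 2) (fun i => L4_sqr_integrable (v4 i n0)).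
  under eq_Rintegral do under eq_bigr do rewrite mul1r.
  move=> ->; rewrite mulr_sumr; apply: eq_bigr => i _; rewrite mul1r.
  exact: v_sqr.
have trB0 : 0 <= trB.
  rewrite -(v2 1%N isT) mulr_ge0// Rintegral_ge0// => w _; exact: sqn_ge0.
pose G := c ^+ 2 * (2 * trB + 2).
have G0 : 0 <= G by rewrite mulr_ge0 ?sqr_ge0// addr_ge0// mulr_ge0.
pose M := Num.sqrt (G / eps) + 1.
have M0 : 0 < M by rewrite ltr_wpDl// sqrtr_ge0.
have GM : G <= M ^+ 2 * eps.
  rewrite -ler_pdivrMr// -[leLHS]sqr_sqrtr ?divr_ge0 ?(ltW eps0)//.
  by rewrite lerXn2r ?nnegrE ?sqrtr_ge0 ?(ltW M0)// lerDl.
exists M; have /cvgrPdist_le/(_ _ ltr01) h := n_rho.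
near=> nm.
have [n0 mm0] : (0 < nm.1)%N /\ (m0 <= nm.2)%N by near: nm; exact: near_F.
have hr : nm.1%:R * rho nm <= 1.
  have : `|0 - nm.1%:R * rho nm| <= 1 by near: nm; exact: h.
  by rewrite sub0r normrN => /(le_trans (ler_norm _)).
set A := [set w | _].
have mA : measurable A.
  have cf : continuous (fun x : 'rV[R]_d => nrm (x - t0)).
    apply: (lipschitz_is_continuous c0) => x y.
    have [ND _ _] := nrm_norm.
    rewrite lerBlDr (sub_split x y t0) addrC (le_trans (ND _ _))// lerD2r.
    exact: nc.
  (* The event is the preimage of an open set under the estimator, hence measurable. *)
  pose U := [set x : 'rV[R]_d | M / Num.sqrt nm.1%:R < nrm (x - t0)].
  have oU : open U.
    have -> : U = (fun x => nrm (x - t0)) @^-1` [set y | M / Num.sqrt nm.1%:R < y] by [].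
    by apply: open_comp; [move=> x _; exact: cf|exact: open_gt].
  have -> : A = setT `&` thm nm.1 nm.2 @^-1` U.
    by rewrite setTI; apply/seteqP; split => w /=; rewrite /A /U /= ltr_pdivrMr ?sqrtr_gt0 ?ltr0n// mulrC.
  by apply: thm_meas => //; exact: sub_sigma_algebra.
have i3 : P.-integrable setT (EFin \o (fun w => sqn (r nm w))).
  by apply: isqn => i; exact: r4.
have iv : P.-integrable setT (EFin \o (fun w => sqn (v nm.1 w))).
  by apply: isqn => i; exact: v4.
have z1 := integrable_EFinZl measurableT 2 iv.
have z2 := integrable_EFinZl measurableT 2 i3.
have z3 := integrable_EFinD measurableT z1 z2.
have key : ((M ^+ 2)%:E * P A <= G%:E)%E.
  rewrite -[A]setIT -(integral_indic P measurableT mA).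
  rewrite -ge0_integralZl_EFin ?sqr_ge0//; last first.
    by apply/measurable_EFinP; exact: measurable_indic.
  apply: (@le_trans _ _ (\int[P]_w (nm.1%:R * c ^+ 2 * (2 * sqn (v nm.1 w) + 2 * sqn (r nm w)))%:E)%E).
    apply: ge0_le_integral_sup => w.
      by rewrite -EFinM lee_fin mulr_ge0 ?sqr_ge0.
    rewrite -EFinM lee_fin indicE; have [|] := boolP (w \in A); last first.
      move=> _; rewrite mulr0; apply: mulr_ge0; first by rewrite mulr_ge0 ?sqr_ge0.
      by apply: addr_ge0; apply: mulr_ge0 => //; exact: sqn_ge0.
    rewrite inE /A /= mulr1 => Mw.
    rewrite (@le_trans _ _ ((Num.sqrt nm.1%:R * nrm (thm nm.1 nm.2 w - t0)) ^+ 2))//.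
      by rewrite lerXn2r ?nnegrE ?(ltW M0)// ltW// (lt_trans M0).
    rewrite exprMn sqr_sqrtr// -mulrA ler_wpM2l//.
    rewrite (@le_trans _ _ ((c * `|thm nm.1 nm.2 w - t0|) ^+ 2))//.
      by rewrite lerXn2r ?nnegrE ?mulr_ge0 ?(ltW c0)//; exact: is_norm_ge0.
    rewrite exprMn ler_wpM2l ?sqr_ge0// (le_trans (norm_sqr_le_sqn _))//.
    by rewrite (_ : thm _ _ w - t0 = v nm.1 w + r nm w) ?sqnD_le// /r [RHS]addrC subrK.
  rewrite Efin; last exact: integrable_EFinZl.
  rewrite lee_fin RintegralZl// RintegralD// !RintegralZl//.
  rewrite [leLHS](_ : _ = c ^+ 2 * (2 * (nm.1%:R * \int[P]_w sqn (v nm.1 w)) +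
    2 * (nm.1%:R * \int[P]_w sqn (r nm w)))); last by ring.
  rewrite v2// ler_wpM2l ?sqr_ge0// lerD2l -[leRHS]mulr1 ler_wpM2l//.
  by rewrite (le_trans _ hr)// ler_wpM2l// r_le.
have := le_trans key (_ : (G%:E <= (M ^+ 2)%:E * eps%:E)%E).
rewrite lee_pmul2l ?lte_fin ?exprn_gt0//; apply.
by rewrite -EFinM lee_fin.
Unshelve. all: by end_near. Qed.

End asymptotics.

Section empirical_fluctuations.
Context {dO dT} {Omega : measurableType dO} {T : measurableType dT} {R : realType}.
Variables (P : probability Omega R) (mu : probability T R).
Variable X : nat -> {RV P >-> T}.
Hypothesis X_iid : iid X mu.
Implicit Types (g : T -> R) (gs : seq (T -> R)).

Definition zbar g n w : R := n%:R^-1 * sample_sum X g n w - \int[mu]_x g x.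

Lemma zbarE g n w : (0 < n)%N ->
  zbar g n w = n%:R^-1 * sample_sum X (fun x => g x - \int[mu]_x g x) n w.
Proof.
move=> n0; rewrite /zbar /sample_sum sumrB sumr_const card_ord mulrBr.
by congr (_ - _); rewrite -[X in _ = _ * X]mulr_natl mulrA mulVf ?mul1r// pnatr_eq0 -lt0n.
Qed.

Lemma L4_zbar g n : L4 mu g -> L4 P (zbar g n).
Proof.
move=> g4; apply: L4D; last exact: L4_cst.
by apply: L4Z; exact: (L4_sample_sum X_iid).
Qed.

Lemma Rintegral_zbar g n : (0 < n)%N -> L4 mu g -> \int[P]_w zbar g n w = 0.
Proof.
move=> n0 g4; rewrite (@eq_Rintegral _ _ _ P setT (fun w => n%:R^-1 * sample_sum X (fun x => g x - \int[mu]_x g x) n w)).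
  have [i0 S0] := Rintegral_sample_sum X_iid n (L4_integrable (L4_sub_mean g4)) (Rintegral_sub_mean g4).
  by rewrite RintegralZl// S0 mulr0.
by move=> w _; exact: zbarE.
Qed.

Lemma Rintegral_zbar_mul f g n : (0 < n)%N -> L4 mu f -> L4 mu g ->
  n%:R * \int[P]_w (zbar f n w * zbar g n w) =
  \int[mu]_x ((f x - \int[mu]_x f x) * (g x - \int[mu]_x g x)).
Proof.
move=> n0 f4 g4; have nn0 : n%:R != 0 :> R by rewrite pnatr_eq0 -lt0n.
rewrite (@eq_Rintegral _ _ _ P setT (fun w => n%:R^-1 ^+ 2 *
  (sample_sum X (fun x => f x - \int[mu]_x f x) n w *
   sample_sum X (fun x => g x - \int[mu]_x g x) n w))); last first.
  by move=> w _; rewrite !zbarE//; ring.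
have f4' := L4_sub_mean f4; have g4' := L4_sub_mean g4.
rewrite RintegralZl//; last by apply: L4M_integrable; exact: (L4_sample_sum X_iid).
rewrite (Rintegral_sample_sum_mul X_iid)//; [|exact: Rintegral_sub_mean|exact: Rintegral_sub_mean].
by field.
Qed.

Lemma Rintegral_zbar_fourth g n : (0 < n)%N -> L4 mu g ->
  \int[P]_w (zbar g n w ^+ 4) <=
  n%:R ^- 2 * (3 * \int[mu]_x ((g x - \int[mu]_x g x) ^+ 4)).
Proof.
move=> n0 g4; have nn0 : n%:R != 0 :> R by rewrite pnatr_eq0 -lt0n.
rewrite (@eq_Rintegral _ _ _ P setT (fun w => n%:R^-1 ^+ 4 *
  sample_sum X (fun x => g x - \int[mu]_x g x) n w ^+ 4)); last first.
  by move=> w _; rewrite zbarE// exprMn.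
have g4' := L4_sub_mean g4.
rewrite RintegralZl//; last by case: (L4_sample_sum X_iid n g4').
have h := Rintegral_sample_sum_fourth X_iid n g4' (Rintegral_sub_mean g4).
rewrite (le_trans (ler_wpM2l _ h)) ?exprn_ge0 ?invr_ge0//.
by rewrite le_eqVlt; apply/orP; left; apply/eqP; field.
Qed.

(** Dominates the fourth power of each centred mean in the list, while being one integrable variable
    of mean O(n^-2). *)
Definition zsum gs n w : R := \sum_(g <- gs) zbar g n w ^+ 4.

Lemma zsum_ge0 gs n w : 0 <= zsum gs n w.
Proof. by apply: sumr_ge0 => g _; rewrite pow4_abs exprn_ge0. Qed.

Lemma zbar_le_zsum gs n w g : g \in gs -> zbar g n w ^+ 4 <= zsum gs n w.
Proof.
rewrite /zsum; elim: gs => // h gs IH; rewrite inE big_cons => /orP[/eqP->|/IH hg].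
  by rewrite lerDl; exact: zsum_ge0.
by rewrite (le_trans hg)// lerDr pow4_abs exprn_ge0.
Qed.

Lemma Rintegral_zsum gs : {in gs, forall g, L4 mu g} ->
  exists2 C, 0 <= C & forall n, (0 < n)%N ->
    P.-integrable setT (EFin \o zsum gs n) /\
    \int[P]_w zsum gs n w <= C * n%:R ^- 2.
Proof.
elim: gs => [_|g gs IH g4].
  exists 0 => // n n0.
  have E : zsum [::] n = fun=> 0 by apply/funext => w; rewrite /zsum big_nil.
  rewrite E mul0r Rintegral_cst// mul0r; split => //.
  exact: finite_measure_integrable_cst.
have [|C C0 hC] := IH; first by move=> h hgs; apply: g4; rewrite inE hgs orbT.
have gg : L4 mu g by apply: g4; rewrite inE eqxx.
exists (3 * \int[mu]_x ((g x - \int[mu]_x g x) ^+ 4) + C).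
  rewrite addr_ge0// mulr_ge0// Rintegral_ge0// => x _.
  by rewrite pow4_abs exprn_ge0.
move=> n n0; have [iz hz] := hC n n0.
have E : zsum (g :: gs) n = fun w => zbar g n w ^+ 4 + zsum gs n w.
  by apply/funext => w; rewrite /zsum big_cons.
have [_ i4] := L4_zbar n gg.
rewrite E; split; first exact: integrable_EFinD.
rewrite RintegralD// mulrDl lerD//.
by rewrite mulrC Rintegral_zbar_fourth.
Qed.

Lemma empirical_mean_entry k n (f : T -> 'rV[R]_k) w j :
  empirical_mean (sample X n w) f 0 j = n%:R^-1 * sample_sum X (fun x => f x 0 j) n w.
Proof.
rewrite /empirical_mean mxE summxE; congr (_ * _).
by apply: eq_bigr => i _; rewrite tnth_mktuple.
Qed.

(** Jensen's inequality for the empirical measure, read off the nonnegative empirical variance. *)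
Lemma mean_sqr_le g n w : (n%:R^-1 * sample_sum X g n w) ^+ 2 <=
  n%:R^-1 * sample_sum X (fun x => g x ^+ 2) n w.
Proof.
have [->|n0] := posnP n; first by rewrite invr0 !mul0r expr0n.
have nn0 : n%:R != 0 :> R by rewrite pnatr_eq0 -lt0n.
set m := n%:R^-1 * sample_sum X g n w.
have : 0 <= n%:R^-1 * \sum_(i < n) (g (X i w) - m) ^+ 2.
  by rewrite mulr_ge0 ?invr_ge0// sumr_ge0// => i _; exact: sqr_ge0.
have -> : \sum_(i < n) (g (X i w) - m) ^+ 2 =
    sample_sum X (fun x => g x ^+ 2) n w - 2 * m * sample_sum X g n w + n%:R * m ^+ 2.
  have -> : n%:R * m ^+ 2 = \sum_(i < n) m ^+ 2 by rewrite sumr_const card_ord mulr_natl.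
  rewrite /sample_sum mulr_sumr -sumrB -big_split/=.
  by apply: eq_bigr => i _; ring.
have -> : sample_sum X g n w = n%:R * m by rewrite /m mulrA mulfV// mul1r.
have -> : n%:R^-1 * (sample_sum X (fun x => g x ^+ 2) n w - 2 * m * (n%:R * m) + n%:R * m ^+ 2) =
    n%:R^-1 * sample_sum X (fun x => g x ^+ 2) n w - m ^+ 2 by field.
by rewrite subr_ge0.
Qed.

End empirical_fluctuations.

Section extended_real_bounds.
Context {R : realType}.
Implicit Types (u : \bar R) (x c h : R).

(** Raising to the sixth power produces n^3, of which only n^2 is used: the normalisation n^-2 u^6
    is the one that also fits [scaled_error_fourth], and it suffices for a rate o(n^-1). An infinite
    [u] is excluded by the last premise. *)
Lemma scaled_error_small n x u c h : (0 < n)%N -> 0 <= c -> 0 <= h -> 0 <= x ->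
  (0 <= u)%E -> ((Num.sqrt n%:R * x)%:E <= c%:E * u)%E ->
  ((n%:R ^- 2)%:E * u ^+ 6 < (h ^+ 6)%:E)%E -> x <= c * h.
Proof.
move=> n0 c0 h0 x0; have n1 : 1 <= n%:R :> R by rewrite ler1n.
have n_gt0 : 0 < n%:R :> R by rewrite ltr0n.
case: u => [u||//]; last first.
  by move=> _ _; rewrite expeS muleC gt0_mulye// lte_fin invr_gt0 exprn_gt0.
rewrite lee_fin => u0; rewrite -EFinM lee_fin => xu.
rewrite -EFin_expe -EFinM lte_fin => uh.
rewrite leNgt; apply/negP => chx.
have h1 : (Num.sqrt n%:R * (c * h)) ^+ 6 < (c * u) ^+ 6.
  rewrite ltrXn2r ?nnegrE ?mulr_ge0// (lt_le_trans _ xu)//.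
  by rewrite ltr_pM2l// sqrtr_gt0.
have : c ^+ 6 * (n%:R ^+ 3 * h ^+ 6) < c ^+ 6 * u ^+ 6.
  have -> : c ^+ 6 * (n%:R ^+ 3 * h ^+ 6) = (Num.sqrt n%:R * (c * h)) ^+ 6.
    by rewrite exprMn -[in RHS](_ : 2 * 3 = 6)%N// exprM sqr_sqrtr// exprMn; ring.
  by rewrite -exprMn.
have c_gt0 : 0 < c ^+ 6.
  rewrite lt0r exprn_ge0// andbT; apply/eqP => c6.
  by move: h1; rewrite !exprMn c6 !mul0r mulr0 ltxx.
rewrite ltr_pM2l//; apply/negP; rewrite -leNgt.
have : u ^+ 6 <= n%:R ^+ 2 * h ^+ 6 by rewrite ltW// -ltr_pdivrMl// exprn_gt0.
move/le_trans; apply; rewrite ler_wpM2r ?exprn_ge0//.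
by rewrite ler_weXn2l.
Qed.

(** Dividing by n^2, x^4 is at most c^4 n^-2 u^4, and u^4 <= 1 + u^6 passes to the moment that is
    controlled. *)
Lemma scaled_error_fourth n x u c : (0 < n)%N -> 0 <= c -> 0 <= x ->
  (0 <= u)%E -> ((Num.sqrt n%:R * x)%:E <= c%:E * u)%E ->
  ((x ^+ 4)%:E <= (c ^+ 4)%:E * ((n%:R ^- 2)%:E + (n%:R ^- 2)%:E * u ^+ 6))%E.
Proof.
move=> n0 c0 x0; have n_gt0 : 0 < n%:R :> R by rewrite ltr0n.
case: u => [u||//]; last first.
  move=> _; have [->|cn0] := eqVneq c 0.
    rewrite mul0e lee_fin expr0n/= mul0e lee_fin => h.
    have : x <= 0 by rewrite -(pmulr_rle0 _ (_ : 0 < Num.sqrt n%:R)) ?sqrtr_gt0.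
    by move=> x0'; rewrite (_ : x = 0) ?expr0n//; apply/eqP; rewrite eq_le x0 x0'.
  move=> _; have c_gt0 : 0 < c by rewrite lt0r cn0.
  have -> : ((+oo : \bar R) ^+ 6 = +oo)%E by rewrite !expeS expe0 mule1 !mulyy.
  rewrite gt0_muley ?lte_fin ?invr_gt0 ?exprn_gt0// addey//.
  by rewrite gt0_muley ?leey// lte_fin exprn_gt0.
rewrite lee_fin => u0; rewrite -EFinM lee_fin => xu.
rewrite -EFin_expe.
change ((x ^+ 4)%:E <= (c ^+ 4 * (n%:R ^- 2 + n%:R ^- 2 * u ^+ 6))%:E)%E.
rewrite lee_fin.
have h1 : (Num.sqrt n%:R * x) ^+ 4 <= (c * u) ^+ 4.
  by rewrite lerXn2r ?nnegrE ?mulr_ge0.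
have h2 : n%:R ^+ 2 * x ^+ 4 <= c ^+ 4 * u ^+ 4.
  rewrite -exprMn (le_trans _ h1)//.
  by rewrite exprMn -[in leRHS](_ : 2 * 2 = 4)%N// exprM sqr_sqrtr.
have h3 : u ^+ 4 <= 1 + u ^+ 6.
  have [u1|u1] := leP u 1; first by rewrite (@le_trans _ _ 1) ?exprn_ile1// lerDl exprn_ge0.
  by rewrite (@le_trans _ _ (u ^+ 6)) ?lerDr// ler_weXn2l// ltW.
rewrite -ler_pdivlMl ?exprn_gt0// in h2.
rewrite (le_trans h2)// -[X in X + _]mulr1 -mulrDr mulrCA ler_wpM2l ?invr_ge0 ?exprn_ge0//.
by rewrite ler_wpM2l// exprn_ge0.
Qed.

Lemma sqr_le_cube (x : R) : 0 <= x -> x ^+ 2 <= 1 + x ^+ 3.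
Proof.
move=> x0; have [x1|x1] := leP x 1; first by rewrite (@le_trans _ _ 1) ?exprn_ile1// lerDl exprn_ge0.
by rewrite (@le_trans _ _ (x ^+ 3)) ?lerDr// ler_weXn2l// ltW.
Qed.

End extended_real_bounds.

(** * Mean square errors of the estimators *)

Section bounds.
Context {R : realType}.

Lemma norm_mean_le m n l (A : 'I_l -> 'M[R]_(m, n)) (c : 'I_l -> R) :
  (forall i, `|A i| <= c i) ->
  `|l%:R^-1 *: \sum_i A i| <= l%:R^-1 * \sum_i c i.
Proof.
move=> Ac; rewrite normrZ ger0_norm ?invr_ge0// ler_wpM2l ?invr_ge0//.
by rewrite (le_trans (ler_norm_sum _ _ _))// ler_sum.
Qed.

Lemma L4_le d (T : measurableType d) (mu : probability T R) (f g : T -> R) :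
  L4 mu g -> measurable_fun setT f -> (forall x, `|f x| <= g x) -> L4 mu f.
Proof.
move=> g4 mf fg; split => //; apply: (@integrable_le_L4 _ _ _ mu g g _ 1) => //.
  exact: measurable_funX.
move=> x; rewrite mul1r normrX.
have : `|f x| ^+ 4 <= g x ^+ 4 by rewrite lerXn2r ?nnegrE// (le_trans _ (fg x)).
by have : 0 <= g x ^+ 4 by [rewrite pow4_abs exprn_ge0]; lra.
Qed.

(** Where [E] is at least [eta], a constant [A] is absorbed into a multiple of [E]. *)
Lemma lee_dichotomy (E : \bar R) (A B eta Z : R) :
  0 <= A -> 0 <= B -> 0 < eta -> (eta%:E <= E)%E -> (Z%:E <= E)%E ->
  ((A + B * Z)%:E <= (A / eta + B)%:E * E)%E.
Proof.
move=> A0 B0 eta0; case: E => [E| |//].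
  rewrite !lee_fin => etaE ZE; rewrite mulrDl lerD ?ler_wpM2l//.
  by rewrite -mulrA ler_peMr// ler_pdivlMl// mulr1.
(* At [E] infinite a zero coefficient would make the right side 0, but it forces both [A] and [B] to
   be 0. *)
move=> _ _; have [AB|AB] := eqVneq (A / eta + B) 0.
  have Ae : 0 <= A / eta by rewrite divr_ge0// ltW.
  have B_eq0 : B = 0 by lra.
  have : A / eta = 0 by lra.
  move/eqP; rewrite mulf_eq0 invr_eq0 (gt_eqF eta0) orbF => /eqP->.
  by rewrite B_eq0 !mul0r addr0 mul0e.
by rewrite gt0_muley ?leey// lte_fin lt0r AB addr_ge0// divr_ge0// ltW.
Qed.

Lemma ge_pieces (a b c d : \bar R) :
  (0 <= a)%E -> (0 <= b)%E -> (0 <= c)%E -> (0 <= d)%E ->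
  [/\ (a <= a + b + c + d)%E, (b <= a + b + c + d)%E, (c <= a + b + c + d)%E &
      (d <= a + b + c + d)%E].
Proof.
move=> a0 b0 c0 d0; split.
- by rewrite -!addeA leeDl// !adde_ge0.
- by rewrite (addeC a) -!addeA leeDl// !adde_ge0.
- by rewrite (addeC (a + b)) -!addeA leeDl// !adde_ge0.
- by rewrite leeDr// !adde_ge0.
Qed.

Lemma summands_le_sum (a b c d : R) : 0 <= a -> 0 <= b -> 0 <= c -> 0 <= d ->
  let S := a + b + c + d + 1 in [/\ a <= S, b <= S, c <= S, d <= S & 0 < S].
Proof. by move=> ? ? ? ? S; rewrite /S; split; lra. Qed.

Lemma ler_norm_bracket (a b c i j l h e : R) :
  `|a - b| <= l + (c - l) -> `|b - i| <= h -> `|i - j| <= l -> `|c - l| <= h ->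
  l <= e -> h <= e -> `|a - j| <= 4 * e.
Proof.
rewrite !ler_norml => /andP[? ?] /andP[? ?] /andP[? ?] /andP[? ?] ? ?.
by apply/andP; split; lra.
Qed.

Lemma sqr_le_fourth (x : R) : x ^+ 2 <= 1 + x ^+ 4.
Proof.
have := sqr_ge0 (x ^+ 2 - 1); have := sqr_ge0 x.
rewrite (_ : (x ^+ 2 - 1) ^+ 2 = x ^+ 4 - 2 * x ^+ 2 + 1); last by ring.
by move: (x ^+ 2) (x ^+ 4) => y z; lra.
Qed.

Lemma sqr_gap_le (z y1 y2 c : R) : 0 <= y1 -> 0 <= y2 ->
  (z + c * y1 + c * y2) ^+ 2 <=
  3 * (1 + c ^+ 2) * (z ^+ 2 + 2 + y1 ^+ 3 + y2 ^+ 3).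
Proof.
move=> y10 y20.
apply: (@le_trans _ _ (3 * (z ^+ 2 + c ^+ 2 * y1 ^+ 2 + c ^+ 2 * y2 ^+ 2))).
  rewrite -subr_ge0.
  have -> : 3 * (z ^+ 2 + c ^+ 2 * y1 ^+ 2 + c ^+ 2 * y2 ^+ 2) - (z + c * y1 + c * y2) ^+ 2 =
    (z - c * y1) ^+ 2 + (z - c * y2) ^+ 2 + (c * y1 - c * y2) ^+ 2 by ring.
  by rewrite !addr_ge0// sqr_ge0.
rewrite -mulrA ler_wpM2l//.
have c2 : 0 <= c ^+ 2 := sqr_ge0 _.
have k2 : 0 <= z ^+ 2 := sqr_ge0 _.
have y13 : 0 <= y1 ^+ 3 by rewrite exprn_ge0.
have y23 : 0 <= y2 ^+ 3 by rewrite exprn_ge0.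
have s1 := ler_wpM2l c2 (sqr_le_cube y10); have s2 := ler_wpM2l c2 (sqr_le_cube y20).
have ck : 0 <= c ^+ 2 * z ^+ 2 by rewrite mulr_ge0.
rewrite mulrDl mul1r !mulrDr; rewrite !mulrDr in s1 s2.
move: s1 s2 ck c2 k2 y13 y23.
move: (c ^+ 2 * y1 ^+ 2) (c ^+ 2 * y2 ^+ 2) (c ^+ 2 * z ^+ 2) (c ^+ 2 * y1 ^+ 3) (c ^+ 2 * y2 ^+ 3).
by move: (c ^+ 2) (z ^+ 2) (y1 ^+ 3) (y2 ^+ 3) => *; lra.
Qed.

Lemma compact_norm_bounded d (A : set 'rV[R]_d) : compact A ->
  exists2 K, 0 <= K & forall t, A t -> `|t| <= K.
Proof.
move=> /compact_bounded[M [_ hM]]; exists (`|M| + 1); first by rewrite addr_ge0.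
by move=> t At; apply: hM => //; rewrite (le_lt_trans (ler_norm _))// ltrDl.
Qed.

End bounds.

Section cue_estimator.
Context {dO dT} {Omega : measurableType dO} {T : measurableType dT} {R : realType}.
Context {d k : nat}.
Variables (P : probability Omega R) (mu : probability T R).
Variable X : nat -> {RV P >-> T}.
Hypothesis X_iid : iid X mu.

Variables (Theta : set 'rV[R]_d) (t0 : 'rV[R]_d) (r1 : R).
Hypotheses (cT : compact Theta) (r10 : 0 < r1).
Hypothesis rT : forall s, `|s - t0| < r1 -> Theta s.
Variables (F : 'rV[R]_d -> T -> 'rV[R]_k) (kappa : T -> R).
Hypothesis kappa4 : L4 mu kappa.
Hypothesis mF : forall t j, Theta t -> measurable_fun setT (fun x => F t x 0 j).
Hypothesis cF : forall x, {within Theta, continuous (F^~ x)}.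
Hypothesis F_le : forall t x, Theta t -> `|F t x| <= kappa x.
Hypothesis dF : forall x t, `|t - t0| < r1 -> differentiable (F^~ x) t.
Hypothesis JF_le : forall x t, `|t - t0| < r1 -> `|jacobian (F^~ x) t| <= kappa x.
Hypothesis JF_lip : forall x s t, `|s - t0| < r1 -> `|t - t0| < r1 ->
  `|jacobian (F^~ x) s - jacobian (F^~ x) t| <= d.+1%:R * kappa x * `|s - t|.

Definition mean_constraint t : 'rV[R]_k := \row_j \int[mu]_x F t x 0 j.
Let f := mean_constraint.
Hypothesis f_cont : {within Theta, continuous f}.
Hypothesis f_uniq : forall t, Theta t -> f t = 0 -> t = t0.
Hypothesis f0 : f t0 = 0.

Variable W : 'rV[R]_d -> 'M[R]_k.
Hypothesis cov_unit : forall t, Theta t -> cov_mx mu (fun j x => F t x 0 j) \in unitmx.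
Hypothesis WE : forall t, Theta t -> W t = invmx (cov_mx mu (fun j x => F t x 0 j)).

Definition mean_jacobian : 'M[R]_(d, k) :=
  \matrix_(i, j) \int[mu]_x jacobian (F^~ x) t0 i j.
Let D := mean_jacobian.
Hypothesis D_rank : \rank D = d.

Variable KW : R.
Hypothesis W_le : forall t, `|t - t0| < r1 ->
  `|jacobian (vec W) t| <= KW /\ `|hessian (vec W) t| <= KW.

Variable B : nat -> Omega -> 'rV[R]_d -> 'M[R]_k.
Hypothesis B_diff : forall n w t, (0 < n)%N -> `|t - t0| < r1 ->
  differentiable (vec (B n w)) t /\
  differentiable (vec (jacobian (vec (B n w)))) t.
Variables (c1 M : R) (u1 u2 : nat -> Omega -> \bar R) (A3 : nat -> set Omega).
Hypotheses (c10 : 0 <= c1) (M0 : 0 <= M).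
Hypothesis u1_ge0 : forall n w, (0 <= u1 n w)%E.
Hypothesis u2_ge0 : forall n w, (0 <= u2 n w)%E.
Hypothesis B_err : forall n w t, (0 < n)%N -> Theta t ->
  ((Num.sqrt n%:R * `|B n w t - W t|)%:E <= c1%:E * u1 n w)%E.
Hypothesis G_err : forall n w t, (0 < n)%N -> `|t - t0| < r1 ->
  ((Num.sqrt n%:R * `|jacobian (vec (B n w)) t - jacobian (vec W) t|)%:E
     <= c1%:E * u2 n w)%E.
Hypothesis H_err : forall n w t, (0 < n)%N -> `|t - t0| < r1 -> ~ A3 n w ->
  `|hessian (vec (B n w)) t - hessian (vec W) t| <= 1.

Definition empirical_constraint n w t : 'rV[R]_k := empirical_mean (sample X n w) (F t).
Let a := empirical_constraint.

Lemma L4_F t j : Theta t -> L4 mu (fun x => F t x 0 j).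
Proof.
move=> Tt; apply: (L4_le kappa4); first exact: mF.
by move=> x; rewrite (le_trans (ler_norm_entry _ _ _))// F_le.
Qed.

Let t0r : `|t0 - t0| < r1. Proof. by rewrite subrr normr0. Qed.
Let T0 : Theta t0. Proof. exact: rT. Qed.

Let J i j x := jacobian (F^~ x) t0 i j.

Lemma L4_J i j : L4 mu (J i j).
Proof.
apply: (L4_le kappa4); last first.
  by move=> x; rewrite (le_trans (ler_norm_entry _ _ _))// JF_le.
have -> : J i j = fun x => 'D_(delta_mx 0 i) (fun s => F s x 0 j) t0.
  by apply/funext => x; rewrite /J jacobian_entry//; exact: dF.
apply: (@measurable_derive _ _ _ _ (fun s x => F s x 0 j) _ _ Theta r1) => //.
  by move=> s Ts; exact: mF.
by move=> x; have [] := is_derive_entry (delta_mx 0 i) j (dF x t0r).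
Qed.

Let kappa0 x : 0 <= kappa x.
Proof. by apply: le_trans (F_le x T0). Qed.

(** The covariances are bounded uniformly on [Theta] by the second moment of [kappa], so their
    inverses are uniformly bounded below. *)
Lemma W_coercive : exists2 c, 0 < c &
  forall s, Theta s -> forall x, c * `|x| ^+ 2 <= bil x (W s) x.
Proof.
pose C := 2 * \int[mu]_x (kappa x ^+ 2) + 1.
have I0 : 0 <= \int[mu]_x (kappa x ^+ 2) by apply: Rintegral_ge0 => x _; exact: sqr_ge0.
have C0 : 0 < C by rewrite ltr_wpDl// mulr_ge0.
exists C^-1 => [|s Ts x]; first by rewrite invr_gt0.
have F4 j : L4 mu (fun x => F s x 0 j) by exact: L4_F.
rewrite WE//; apply: invmx_coercive => //.
- exact: cov_mx_sym.
- exact: cov_unit.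
- exact: cov_mx_psd.
- rewrite (le_trans (norm_cov_mx_le F4 kappa4 _)) ?lerDl//.
  by move=> j y; rewrite (le_trans (ler_norm_entry _ _ _))// F_le.
Qed.

Lemma W_sym : (W t0)^T = W t0.
Proof. by rewrite WE// trmx_inv cov_mx_sym. Qed.

Let a_entry n w t j :
  a n w t 0 j = n%:R^-1 * sample_sum X (fun x => F t x 0 j) n w.
Proof. exact: empirical_mean_entry. Qed.

Let a_jac n w t : `|t - t0| < r1 -> differentiable (a n w) t /\
  jacobian (a n w) t = n%:R^-1 *: \sum_(l < n) jacobian (F^~ (X l w)) t.
Proof.
move=> tr.
have [] := @empirical_mean_jacobian R d k n (fun l s => F s (X l w)) t.
  by move=> l; exact: dF.
have -> : (fun s => n%:R^-1 *: \sum_(l < n) F s (X l w)) = a n w.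
  apply/funext => s; congr (_ *: _); apply: eq_bigr => l _.
  by rewrite tnth_mktuple.
by [].
Qed.

Let kappa_mean n w : n%:R^-1 * \sum_(l < n) kappa (X l w) =
  \int[mu]_x kappa x + zbar mu X kappa n w.
Proof. by rewrite /zbar addrC subrK. Qed.

(** Gathers every function whose centred mean has to be small. The constant 4 counts the bracket
    integral, the fluctuation of the bracket, the fluctuation at the centre, and the change of the
    mean from centre to point. *)
Lemma bracketing_lists e : 0 < e ->
  exists gs : seq (T -> R), [/\ {in gs, forall g, L4 mu g}, kappa \in gs,
    forall j, (fun x => F t0 x 0 j) \in gs, forall i j, J i j \in gs &
    forall n w h, (0 < n)%N -> h <= e ->
      (forall g, g \in gs -> `|zbar mu X g n w| <= h) ->
      forall t, Theta t -> `|a n w t - f t| <= 4 * e].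
Proof.
move=> e0.
have br j : {p : seq 'rV[R]_d * ('rV[R]_d -> T -> R) |
    [/\ {in p.1, forall u, Theta u}, (forall u, measurable_fun setT (p.2 u)),
    (forall u x, `|p.2 u x| <= 2 * `|kappa x|),
    {in p.1, forall u, \int[mu]_x p.2 u x <= e} &
    forall t, Theta t -> exists2 u, u \in p.1 & forall x, `|F t x 0 j - F u x 0 j| <= p.2 u x]}.
  apply: cid.
  have cFj x : {within Theta, continuous (fun t => F t x 0 j)}.
    move=> t; apply: (@continuous_comp _ _ _ (F^~ x : subspace Theta -> _) (fun y : 'rV[R]_k => y 0 j)).
      exact: cF.
    exact: coord_continuous.
  have Fj_le t x : Theta t -> `|F t x 0 j| <= kappa x.
    by move=> Tt; rewrite (le_trans (ler_norm_entry _ _ _))// F_le.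
  have [s [w h]] := bracketing cT (fun t Tt => mF j Tt) cFj (L4_integrable kappa4) Fj_le e0.
  by exists (s, w).
pose s j := (sval (br j)).1; pose w j := (sval (br j)).2.
(* In order: the envelope, which bounds the averaged derivatives; the constraint and its Jacobian at
   [t0]; the brackets; the constraint at the centres of the brackets. *)
pose gs := kappa :: [seq (fun x => F t0 x 0 j) | j <- enum 'I_k] ++
  [seq J p.1 p.2 | p <- enum {: 'I_d * 'I_k}] ++
  flatten [seq [seq w j u | u <- s j] | j <- enum 'I_k] ++
  flatten [seq [seq (fun x => F u x 0 j) | u <- s j] | j <- enum 'I_k].
have in_w j u : u \in s j -> w j u \in gs.
  move=> us; rewrite inE !mem_cat; apply/orP; right; do 2 (apply/orP; right).
  apply/orP; left; apply/flatten_mapP; exists j; rewrite ?mem_enum//.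
  exact: map_f.
have in_F j u : u \in s j -> (fun x => F u x 0 j) \in gs.
  move=> us; rewrite inE !mem_cat; do 4 (apply/orP; right).
  apply/flatten_mapP; exists j; rewrite ?mem_enum//.
  by apply/mapP; exists u.
have w4 j u : L4 mu (w j u).
  have [_ mw wk _ _] := svalP (br j).
  apply: (L4_le (L4Z 2 kappa4)); first exact: mw.
  by move=> x; rewrite (le_trans (wk u x))// ger0_norm.
exists gs; split.
- move=> g; rewrite inE !mem_cat => /orP[/eqP->//|/orP[/mapP[j _ ->]|/orP[/mapP[p _ ->]|/orP[]]]].
  + exact: L4_F.
  + exact: L4_J.
  + by move=> /flatten_mapP[j _ /mapP[u _ ->]]; exact: w4.
  + move=> /flatten_mapP[j _ /mapP[u us ->]]; apply: L4_F.
    by have [sT _ _ _ _] := svalP (br j); exact: sT.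
- by rewrite inE eqxx.
- move=> j; rewrite inE mem_cat; apply/orP; right; apply/orP; left.
  by apply/mapP; exists j; rewrite ?mem_enum.
- move=> i j; rewrite inE !mem_cat; do 2 (apply/orP; right); apply/orP; left.
  by apply/mapP; exists (i, j); rewrite ?mem_enum.
move=> n w0 h n0 he zh t Tt.
apply: norm_matrix_le => [|i j]; first by rewrite mulr_ge0// ltW.
rewrite (ord1 i) mxE [X in _ + X]mxE a_entry.
have [sT mw wk wi sn] := svalP (br j).
have [u us hu] := sn t Tt.
have iF v : Theta v -> mu.-integrable setT (EFin \o (fun x => F v x 0 j)).
  by move=> Tv; apply: L4_integrable; exact: L4_F.
have iw : mu.-integrable setT (EFin \o w j u) by exact: L4_integrable.
have e1 : `|n%:R^-1 * sample_sum X (fun x => F t x 0 j) n w0 -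
    n%:R^-1 * sample_sum X (fun x => F u x 0 j) n w0| <=
    \int[mu]_x w j u x + zbar mu X (w j u) n w0.
  rewrite /zbar [leRHS]addrC subrK -mulrBr normrM ger0_norm ?invr_ge0//.
  rewrite ler_wpM2l ?invr_ge0// /sample_sum -sumrB (le_trans (ler_norm_sum _ _ _))//.
  by apply: ler_sum => l _; exact: hu.
have e2 := zh _ (in_F _ _ us).
have e3 : `|\int[mu]_x F u x 0 j - \int[mu]_x F t x 0 j| <= \int[mu]_x w j u x.
  have iFu := iF _ (sT _ us); have iFt := iF _ Tt.
  have iB : mu.-integrable setT (EFin \o (fun x => F u x 0 j - F t x 0 j)).
    have := integrable_EFinD measurableT iFu (integrable_EFinZl measurableT (-1) iFt).
    by apply: eq_integrable => // x _ /=; rewrite mulN1r.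
  rewrite -RintegralB// (le_trans (le_normr_Rintegral _ _))//.
  apply: le_Rintegral => //; first exact: integrable_norm.
  by move=> x _; rewrite distrC hu.
have e4 := zh _ (in_w _ _ us).
have e5 := wi _ us.
rewrite mxE; apply: ler_norm_bracket e1 e2 e3 e4 e5 he.
Qed.

(* Where [err] is small the realisation is well behaved; elsewhere a constant [A]
   is at most [A / eta * err].  Hence [err] controls squared errors everywhere,
   and its expectation is [O(n^-2) + P (A3 n)], that is [o(n^-1)]. *)
Definition err gs n w : \bar R :=
  ((zsum mu X gs n w)%:E + ((n%:R ^- 2)%:E + (n%:R ^- 2)%:E * u1 n w ^+ 6)
   + (n%:R ^- 2)%:E * u2 n w ^+ 6 + (\1_(A3 n) w)%:E)%E.

Lemma err_pieces gs n w :
  [/\ ((zsum mu X gs n w)%:E <= err gs n w)%E,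
      ((n%:R ^- 2)%:E + (n%:R ^- 2)%:E * u1 n w ^+ 6 <= err gs n w)%E,
      ((n%:R ^- 2)%:E * u2 n w ^+ 6 <= err gs n w)%E &
      ((\1_(A3 n) w)%:E <= err gs n w)%E].
Proof.
have n2 : 0 <= n%:R ^- 2 :> R by rewrite invr_ge0 exprn_ge0.
apply: ge_pieces.
- by rewrite lee_fin zsum_ge0.
- by rewrite adde_ge0 ?lee_fin// mule_ge0 ?lee_fin// expe_ge0.
- by rewrite mule_ge0 ?lee_fin// expe_ge0.
- by rewrite lee_fin indicE.
Qed.

Lemma err_ge0 gs n w : (0 <= err gs n w)%E.
Proof.
by have [h _ _ _] := err_pieces gs n w; apply: le_trans h; rewrite lee_fin zsum_ge0.
Qed.

Lemma empirical_constraint_t0 n w j :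
  a n w t0 0 j = zbar mu X (fun x => F t0 x 0 j) n w.
Proof.
rewrite a_entry /zbar (_ : \int[mu]_x F t0 x 0 j = 0) ?subr0//.
by have := congr1 (fun y : 'rV_k => y 0 j) f0; rewrite !mxE.
Qed.

Lemma empirical_jacobian_t0 n w i j :
  (jacobian (a n w) t0 - D) i j = zbar mu X (J i j) n w.
Proof.
have [_ ->] := a_jac n w t0r.
by rewrite mxE [X in _ + X]mxE [X in _ - X]mxE mxE summxE.
Qed.

Lemma norm_pow4_le m n (A : 'M[R]_(m, n)) z : 0 <= z ->
  (forall i j, A i j ^+ 4 <= z) -> `|A| ^+ 4 <= z.
Proof.
move=> z0 Az; have [->|A0] := eqVneq `|A| 0; first by rewrite expr0n.
have [ij ->] : exists ij, `|A| = `|A ij.1 ij.2| by exact: mx_norm_neq0 A0.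
by rewrite -pow4_abs.
Qed.

Lemma err_a0 gs n w : (forall j, (fun x => F t0 x 0 j) \in gs) ->
  `|a n w t0| ^+ 4 <= zsum mu X gs n w.
Proof.
move=> hgs; apply: norm_pow4_le => [|i j]; first exact: zsum_ge0.
rewrite (ord1 i) empirical_constraint_t0; exact: zbar_le_zsum.
Qed.

Lemma err_J0 gs n w : (forall i j, J i j \in gs) ->
  `|jacobian (a n w) t0 - D| ^+ 4 <= zsum mu X gs n w.
Proof.
move=> hgs; apply: norm_pow4_le => [|i j]; first exact: zsum_ge0.
rewrite empirical_jacobian_t0; exact: zbar_le_zsum.
Qed.

Let KW0 : 0 <= KW.
Proof. by have [h _] := W_le t0r; exact: le_trans h. Qed.

Let Ikappa0 : 0 <= \int[mu]_x kappa x.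
Proof. by apply: Rintegral_ge0. Qed.

(** One bound for all sizes required by [estimation]; the additive constant leaves room for
    fluctuations of size at most 1. *)
Let K := `|W t0| + `|D| + \int[mu]_x kappa x + KW + 3.

(** The sixth power is the common threshold: since [h <= 1], a fourth power below h^6 is below h^4,
    and an indicator below h^6 is 0, which excludes the event [A3 n]. *)
Lemma well_behaved_of_err gs n w e h : (0 < n)%N -> 0 < e -> 0 < h -> h <= e / 4 ->
  h <= 1 -> c1 * h <= e -> c1 * h <= 1 ->
  kappa \in gs -> (forall i j, J i j \in gs) ->
  (forall n w h, (0 < n)%N -> h <= e / 4 ->
      (forall g, g \in gs -> `|zbar mu X g n w| <= h) ->
      forall t, Theta t -> `|a n w t - f t| <= 4 * (e / 4)) ->
  (err gs n w < (h ^+ 6)%:E)%E ->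
  well_behaved Theta f W t0 D r1 K e (a n w) (B n w).
Proof.
move=> n0 e0 h0 he h1 che ch1 kgs Jgs unif small.
have [p1 p2 p3 p4] := err_pieces gs n w.
have h0' := ltW h0.
have n2 : 0 <= n%:R ^- 2 :> R by rewrite invr_ge0 exprn_ge0.
have hz g : g \in gs -> `|zbar mu X g n w| <= h.
  move=> ggs; have : zbar mu X g n w ^+ 4 <= h ^+ 4.
    rewrite (le_trans (zbar_le_zsum mu X n w ggs))//.
    have : zsum mu X gs n w < h ^+ 6 by rewrite -lte_fin (le_lt_trans p1).
    by move=> /ltW/le_trans; apply; rewrite ler_wiXn2l.
  by rewrite pow4_abs ler_pXn2r ?nnegrE.
have nA3 : ~ A3 n w.
  move=> Aw; have := le_lt_trans p4 small.
  rewrite indicE mem_set// lte_fin ltNge => /negP; apply.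
  by rewrite exprn_ile1.
have hB t : Theta t -> `|B n w t - W t| <= c1 * h.
  move=> Tt; apply: (scaled_error_small n0 c10 h0' _ (u1_ge0 n w) (B_err w n0 Tt)) => //.
  apply: le_lt_trans small; apply: le_trans p2.
  by rewrite leeDr// lee_fin.
have hG t : `|t - t0| < r1 ->
    `|jacobian (vec (B n w)) t - jacobian (vec W) t| <= c1 * h.
  move=> tr; apply: (scaled_error_small n0 c10 h0' _ (u2_ge0 n w) (G_err w n0 tr)) => //.
  exact: le_lt_trans small.
have hk : n%:R^-1 * \sum_(l < n) kappa (X l w) <= K.
  rewrite kappa_mean; have := hz _ kgs; rewrite ler_norml => /andP[_ hk].
  have := KW0; have := Ikappa0.
  have := normr_ge0 (W t0); have := normr_ge0 D; rewrite /K; lra.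
have JB t : `|t - t0| < r1 -> `|jacobian (vec (B n w)) t| <= K.
  move=> tr; rewrite -(subrK (jacobian (vec W) t) (jacobian _ t)) (le_trans (ler_normD _ _))//.
  have [h2 _] := W_le tr; have := hG _ tr.
  have := KW0; have := Ikappa0.
  have := normr_ge0 (W t0); have := normr_ge0 D; rewrite /K; lra.
have HB t : `|t - t0| < r1 -> `|jacobian (vec (jacobian (vec (B n w)))) t| <= K.
  move=> tr; rewrite -/(hessian (vec (B n w)) t) -(subrK (hessian (vec W) t) (hessian _ t)).
  rewrite (le_trans (ler_normD _ _))//.
  have [_ h2] := W_le tr; have := H_err n0 tr nA3.
  have := KW0; have := Ikappa0.
  have := normr_ge0 (W t0); have := normr_ge0 D; rewrite /K; lra.
have K0 : 0 <= K by rewrite /K !addr_ge0.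
split.
- move=> s sr; have [da Ja] := a_jac n w sr; split => //.
  + by have [] := B_diff w n0 sr.
  + rewrite Ja; apply: le_trans hk; apply: norm_mean_le => l; exact: JF_le.
  + exact: JB.
- move=> s t sr tr; split.
    have [_ ->] := a_jac n w sr; have [_ ->] := a_jac n w tr.
    rewrite -scalerBr -sumrB.
    apply: le_trans (norm_mean_le (fun l => JF_lip (X l w) sr tr)) _.
    rewrite -mulr_suml -mulr_sumr mulrA ler_wpM2r// mulrCA ler_wpM2l//.
  have dJB s' : `|s' - t0| < r1 -> differentiable (vec (jacobian (vec (B n w)))) s'.
    by move=> s'r; have [] := B_diff w n0 s'r.
  have := norm_sub_le_jacobian dJB K0 HB sr tr.
  rewrite /vec -linearB norm_mxvec => /le_trans; apply.
  by rewrite !ler_wpM2r// ler_nat.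
- move=> s Ts; apply: le_trans (unif n w h n0 he hz s Ts) _.
  by rewrite mulrC divfK.
- by move=> s Ts; apply: le_trans (hB s Ts) _.
- apply: norm_matrix_le => [|i j]; first exact: ltW.
  rewrite empirical_jacobian_t0 (le_trans (hz _ (Jgs i j)))// (le_trans he)//.
  by rewrite ler_pdivrMr// ler_peMr ?(ltW e0)// ler1n.
Qed.

Variable th : nat -> Omega -> 'rV[R]_d.
Hypothesis th_min : forall n w, (0 < n)%N ->
  is_minimizer Theta (quad (a n w) (B n w)) (th n w).

Variables (F' : nat -> Omega -> 'rV[R]_d -> T -> 'rV[R]_k).
Variables (B' : nat -> nat -> Omega -> 'rV[R]_d -> 'M[R]_k).
Variables (phi : nat -> R) (m0 : nat) (kappam : nat -> T -> R).
Variables (q1 q2 : nat -> nat -> Omega -> \bar R).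
Hypothesis phi0 : forall m, (m0 <= m)%N -> 0 < phi m.
Hypothesis F'_err : forall m w x t, (m0 <= m)%N -> Theta t ->
  phi m * `|F' m w t x - F t x| <= kappam m x.
Hypothesis dF' : forall m w x t, `|t - t0| < r1 -> differentiable ((F' m w)^~ x) t.
Hypothesis J'_err : forall m w x t, (m0 <= m)%N -> `|t - t0| < r1 ->
  phi m * `|jacobian ((F' m w)^~ x) t - jacobian (F^~ x) t| <= kappam m x.
Hypothesis q1_ge0 : forall n m w, (m0 <= m)%N -> (0 <= q1 n m w)%E.
Hypothesis q2_ge0 : forall n m w, (m0 <= m)%N -> (0 <= q2 n m w)%E.
Hypothesis B'_err : forall n m w t, (0 < n)%N -> (m0 <= m)%N -> Theta t ->
  ((phi m * `|B' n m w t - B n w t|)%:E <= c1%:E * q1 n m w)%E.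
Hypothesis dB' : forall n m w t, (0 < n)%N -> `|t - t0| < r1 ->
  differentiable (vec (B' n m w)) t.
Hypothesis G'_err : forall n m w t, (0 < n)%N -> (m0 <= m)%N -> `|t - t0| < r1 ->
  ((phi m * `|jacobian (vec (B' n m w)) t - jacobian (vec (B n w)) t|)%:E
     <= c1%:E * q2 n m w)%E.

Definition approximate_constraint n m w t : 'rV[R]_k :=
  empirical_mean (sample X n w) (F' m w t).
Let a' := approximate_constraint.

Variable thm : nat -> nat -> Omega -> 'rV[R]_d.
Hypothesis thm_min : forall n m w, (0 < n)%N ->
  is_minimizer Theta (quad (a' n m w) (B' n m w)) (thm n m w).

Let Lm := influence D (W t0).

Definition influence_term n w : 'rV[R]_d := - (a n w t0 *m Lm).

(** Up to a constant, phi_m^2 times the squared size of the perturbation. Squares of [q1] and [q2]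
    are replaced by cubes, the controlled moments, through y^2 <= 1 + y^3; this accounts for the
    2. *)
Definition approximation_gap n m w : \bar R :=
  (((n%:R^-1 * sample_sum X (kappam m) n w) ^+ 2 + 2)%:E
   + q1 n m w ^+ 3 + q2 n m w ^+ 3)%E.

Let mean_diff n m w (G : nat -> Omega -> T -> 'rV[R]_k) (H : T -> 'rV[R]_k) : (m0 <= m)%N ->
  (forall x, phi m * `|G m w x - H x| <= kappam m x) ->
  `|empirical_mean (sample X n w) (G m w) - empirical_mean (sample X n w) H| <=
  (phi m)^-1 * (n%:R^-1 * sample_sum X (kappam m) n w).
Proof.
move=> mm0 GH; rewrite /empirical_mean -scalerBr -sumrB.
have GH' x : `|G m w x - H x| <= (phi m)^-1 * kappam m x.
  by rewrite ler_pdivlMl ?phi0.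
apply: le_trans (norm_mean_le (fun l => GH' _)) _.
rewrite -mulr_sumr mulrCA ler_wpM2l ?invr_ge0 ?(ltW (phi0 mm0))//.
rewrite ler_wpM2l ?invr_ge0// /sample_sum le_eqVlt; apply/orP; left; apply/eqP.
by apply: eq_bigr => l _; rewrite tnth_mktuple.
Qed.

Let a'_jac n m w t : `|t - t0| < r1 -> differentiable (a' n m w) t /\
  jacobian (a' n m w) t = n%:R^-1 *: \sum_(l < n) jacobian ((F' m w)^~ (X l w)) t.
Proof.
move=> tr.
have [] := @empirical_mean_jacobian R d k n (fun l s => F' m w s (X l w)) t.
  by move=> l; exact: dF'.
have -> : (fun s => n%:R^-1 *: \sum_(l < n) F' m w s (X l w)) = a' n m w.
  apply/funext => s; congr (_ *: _); apply: eq_bigr => l _.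
  by rewrite tnth_mktuple.
by [].
Qed.

Let J'_diff n m w t : (m0 <= m)%N -> `|t - t0| < r1 ->
  `|jacobian (a' n m w) t - jacobian (a n w) t| <=
  (phi m)^-1 * (n%:R^-1 * sample_sum X (kappam m) n w).
Proof.
move=> mm0 tr; have [_ ->] := a'_jac n m w tr; have [_ ->] := a_jac n w tr.
rewrite -scalerBr -sumrB.
have JJ x : `|jacobian ((F' m w)^~ x) t - jacobian (F^~ x) t| <= (phi m)^-1 * kappam m x.
  by rewrite ler_pdivlMl ?phi0// J'_err.
apply: le_trans (norm_mean_le (fun l => JJ _)) _.
by rewrite -mulr_sumr mulrCA.
Qed.

Lemma pointwise_bounds : exists gs, {in gs, forall g, L4 mu g} /\
  exists2 C, 0 < C & forall n w, (0 < n)%N ->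
    ((sqn (th n w - t0 - influence_term n w))%:E <= C%:E * err gs n w)%E /\
    forall m, (m0 <= m)%N -> ((sqn (thm n m w - th n w))%:E <=
      C%:E * err gs n w + C%:E * ((phi m ^- 2)%:E * approximation_gap n m w))%E.
Proof.
have [c c_gt0 coer] := W_coercive.
have K1 : 1 <= K.
  by have := KW0; have := Ikappa0; have := normr_ge0 (W t0); have := normr_ge0 D; rewrite /K; lra.
have W0K : `|W t0| + 1 <= K.
  by have := KW0; have := Ikappa0; have := normr_ge0 D; rewrite /K; lra.
have DK : `|D| <= K.
  by have := KW0; have := Ikappa0; have := normr_ge0 (W t0); rewrite /K; lra.
have [e [C [e0 e1 C0 est]]] :=
  estimation cT f_cont f_uniq f0 r10 rT c_gt0 coer W_sym D_rank K1 W0K DK.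
have e4 : 0 < e / 4 by rewrite divr_gt0.
have [gs [gs4 kgs Fgs Jgs unif]] := bracketing_lists e4.
have c11 : 0 < c1 + 1 by rewrite ltr_wpDl.
have [|h h0 /= /andP[he /andP[hc1 /andP[hc2 /andP[h1 _]]]]] :=
  @exists_pos_le R [:: e / 4; e / (c1 + 1); 1 / (c1 + 1); 1].
  by rewrite /= !divr_gt0// ltr01.
have che : c1 * h <= e.
  move: hc1; rewrite ler_pdivlMr// => /(le_trans _); apply.
  by rewrite mulrC ler_wpM2l ?(ltW h0)// lerDl.
have ch1 : c1 * h <= 1.
  move: hc2; rewrite ler_pdivlMr// => /(le_trans _); apply.
  by rewrite mulrC ler_wpM2l ?(ltW h0)// lerDl.
pose eta := h ^+ 6; have eta0 : 0 < eta by rewrite exprn_gt0.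
have [KT KT0 hKT] := compact_norm_bounded cT.
have dist s t : Theta s -> Theta t -> `|s - t| <= 2 * KT.
  move=> Ts Tt; rewrite (le_trans (ler_normB _ _))//.
  by rewrite mulrDl mul1r lerD ?hKT.
pose V := k%:R * `|Lm|; have V0 : 0 <= V by rewrite mulr_ge0.
have vV n w : `|influence_term n w| <= V * `|a n w t0|.
  by rewrite normrN (le_trans (norm_mulmx _ _))// mulrAC.
have wb n w : (0 < n)%N -> (err gs n w < eta%:E)%E ->
    well_behaved Theta f W t0 D r1 K e (a n w) (B n w).
  by move=> n0; apply: well_behaved_of_err => //.
have d0 : 0 <= d%:R :> R by [].
(* [A] and [Bv] come from (2 KT + V |a t0|)^2 <= 8 KT^2 + 2 V^2 |a t0|^2 together with |a t0|^2 <= 1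
   + zsum, used when [err] is large. *)
pose A := d%:R * (8 * KT ^+ 2 + 2 * V ^+ 2); pose Bv := d%:R * (2 * V ^+ 2).
have A0 : 0 <= A by rewrite mulr_ge0// addr_ge0// mulr_ge0// sqr_ge0.
have Bv0 : 0 <= Bv by rewrite mulr_ge0// mulr_ge0// sqr_ge0.
(* [C1] and [C2] bound the Newton remainder when [err] is large and when it is small; [C3] and [C4]
   do the same for the distance between the two estimators. *)
pose C1 := A / eta + Bv.
pose C2 := d%:R * C ^+ 2 * 3 * (2 + c1 ^+ 4).
pose A' := d%:R * (4 * KT ^+ 2).
have A'0 : 0 <= A' by rewrite mulr_ge0// mulr_ge0// sqr_ge0.
pose C3 := A' / eta.
pose C4 := (A' / e ^+ 2 + d%:R * C ^+ 2) * (3 * (1 + c1 ^+ 2)).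
have C1_0 : 0 <= C1 by rewrite addr_ge0// divr_ge0// ltW.
have C2_0 : 0 <= C2.
  apply: mulr_ge0; last by rewrite addr_ge0// exprn_ge0.
  by rewrite mulr_ge0// mulr_ge0// sqr_ge0.
have C3_0 : 0 <= C3 by rewrite divr_ge0// ltW.
have C4_0 : 0 <= C4.
  apply: mulr_ge0; last by rewrite mulr_ge0// addr_ge0// sqr_ge0.
  by apply: addr_ge0; [apply: divr_ge0 => //|apply: mulr_ge0 => //]; exact: sqr_ge0.
have [C1S C2S C3S C4S Ct_gt0] := summands_le_sum C1_0 C2_0 C3_0 C4_0.
exists gs; split => //; exists (C1 + C2 + C3 + C4 + 1) => //.
move=> n w n0.
have Tth : Theta (th n w) by have [] := th_min w n0.
have E0 := err_ge0 gs n w.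
have [p1 p2 _ _] := err_pieces gs n w.
have mono Ci (E : \bar R) : 0 <= Ci -> Ci <= C1 + C2 + C3 + C4 + 1 -> (0 <= E)%E ->
    (Ci%:E * E <= (C1 + C2 + C3 + C4 + 1)%:E * E)%E.
  by move=> Ci0 CiC EE; rewrite lee_wpmul2r// lee_fin.
split.
  have [small|big] := ltP (err gs n w) eta%:E.
    have [h3 _] := est _ _ _ (wb n w n0 small) (th_min w n0).
    apply: le_trans (mono C2 _ C2_0 C2S E0).
    move: h3; set x := `|a n w t0|; set y := `|jacobian _ _ - D|.
    set z := `|B n w t0 - W t0| => h3.
    have z4 : ((z ^+ 4)%:E <= (c1 ^+ 4)%:E * err gs n w)%E.
      apply: le_trans (scaled_error_fourth n0 c10 (normr_ge0 _) (u1_ge0 n w) (B_err w n0 T0)) _.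
      by rewrite lee_wpmul2l// lee_fin exprn_ge0.
    have x4 := err_a0 n w Fgs; have y4 := err_J0 n w Jgs.
    have step : sqn (th n w - t0 - influence_term n w) <=
        d%:R * C ^+ 2 * 3 * (2 * zsum mu X gs n w + z ^+ 4).
      rewrite (le_trans (sqn_le_norm_sqr _))//.
      have -> : d%:R * C ^+ 2 * 3 * (2 * zsum mu X gs n w + z ^+ 4) =
        d%:R * (C ^+ 2 * (3 * (2 * zsum mu X gs n w + z ^+ 4))) by ring.
      rewrite ler_wpM2l//.
      have -> : `|th n w - t0 - influence_term n w| = `|t0 - a n w t0 *m Lm - th n w|.
        rewrite -normrN; congr `|_|; rewrite /influence_term opprK opprD opprB.
        by rewrite addrC addrA addrAC addrC addrA.
      rewrite (@le_trans _ _ ((C * (x ^+ 2 + y ^+ 2 + z ^+ 2)) ^+ 2))//.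
        by rewrite lerXn2r ?nnegrE ?mulr_ge0 ?addr_ge0 ?sqr_ge0 ?(ltW C0).
      rewrite exprMn; apply: ler_wpM2l; first exact: sqr_ge0.
      rewrite (@le_trans _ _ (3 * (x ^+ 4 + y ^+ 4 + z ^+ 4)))//.
        rewrite -subr_ge0.
        have -> : 3 * (x ^+ 4 + y ^+ 4 + z ^+ 4) - (x ^+ 2 + y ^+ 2 + z ^+ 2) ^+ 2 =
          (x ^+ 2 - y ^+ 2) ^+ 2 + (y ^+ 2 - z ^+ 2) ^+ 2 + (x ^+ 2 - z ^+ 2) ^+ 2 by ring.
        by rewrite !addr_ge0// sqr_ge0.
      by rewrite ler_wpM2l// lerD2r mulrDl mul1r lerD.
    apply: (@le_trans _ _ ((d%:R * C ^+ 2 * 3)%:E * ((2 * zsum mu X gs n w + z ^+ 4)%:E))%E).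
      by rewrite -EFinM lee_fin.
    have -> : (C2%:E = (d%:R * C ^+ 2 * 3)%:E * (2 + c1 ^+ 4)%:E)%E by rewrite -EFinM.
    rewrite -muleA; apply: lee_wpmul2l.
      by rewrite lee_fin mulr_ge0// mulr_ge0// sqr_ge0.
    have -> : ((2 + c1 ^+ 4)%:E = 2%:E + (c1 ^+ 4)%:E)%E by [].
    rewrite ge0_muleDl ?lee_fin ?exprn_ge0//.
    have -> : ((2 * zsum mu X gs n w + z ^+ 4)%:E =
      2%:E * (zsum mu X gs n w)%:E + (z ^+ 4)%:E)%E by [].
    by apply: leeD => //; apply: lee_wpmul2l.
  apply: le_trans (mono C1 _ C1_0 C1S E0).
  apply: le_trans (lee_dichotomy A0 Bv0 eta0 big p1); rewrite lee_fin.
  rewrite (le_trans (sqn_le_norm_sqr _))// /A /Bv -mulrA -mulrDr ler_wpM2l//.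
  have h2 : `|th n w - t0 - influence_term n w| <= 2 * KT + V * `|a n w t0|.
    by rewrite (le_trans (ler_normB _ _))// lerD// dist.
  have h3 : `|a n w t0| ^+ 2 <= 1 + zsum mu X gs n w.
    by rewrite (le_trans (sqr_le_fourth _))// lerD2l err_a0.
  apply: (@le_trans _ _ ((2 * KT + V * `|a n w t0|) ^+ 2)).
    by rewrite lerXn2r ?nnegrE// addr_ge0// mulr_ge0.
  apply: (@le_trans _ _ (8 * KT ^+ 2 + 2 * V ^+ 2 * `|a n w t0| ^+ 2)).
    rewrite -subr_ge0.
    have -> : 8 * KT ^+ 2 + 2 * V ^+ 2 * `|a n w t0| ^+ 2 - (2 * KT + V * `|a n w t0|) ^+ 2 =
      (2 * KT - V * `|a n w t0|) ^+ 2 by ring.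
    exact: sqr_ge0.
  by rewrite -addrA lerD2l -[X in _ <= X + _]mulr1 -mulrDr ler_wpM2l// mulr_ge0// sqr_ge0.
move=> m mm0.
have phim := phi0 mm0.
have Tthm : Theta (thm n m w) by have [] := thm_min m w n0.
have diam : sqn (thm n m w - th n w) <= A'.
  rewrite (le_trans (sqn_le_norm_sqr _))// ler_wpM2l//.
  have -> : 4 * KT ^+ 2 = (2 * KT) ^+ 2 by ring.
  by rewrite lerXn2r ?nnegrE ?mulr_ge0// dist.
have gap0 : (0 <= (phi m ^- 2)%:E * approximation_gap n m w)%E.
  rewrite mule_ge0 ?lee_fin ?invr_ge0 ?exprn_ge0 ?(ltW phim)//.
  rewrite /approximation_gap !adde_ge0 ?expe_ge0 ?q1_ge0 ?q2_ge0//.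
  by rewrite lee_fin addr_ge0// sqr_ge0.
have [small|big] := ltP (err gs n w) eta%:E; last first.
  apply: (@le_trans _ _ ((C1 + C2 + C3 + C4 + 1)%:E * err gs n w)%E); last first.
    by rewrite leeDl// mule_ge0// lee_fin ltW.
  apply: le_trans (mono C3 _ C3_0 C3S E0).
  have := lee_dichotomy A'0 (lexx 0) eta0 big p1; rewrite mul0r !addr0.
  by apply: le_trans; rewrite lee_fin.
apply: (@le_trans _ _ ((C1 + C2 + C3 + C4 + 1)%:E * ((phi m ^- 2)%:E * approximation_gap n m w))%E); last first.
  by rewrite leeDr// mule_ge0// lee_fin ltW.
set Ct := C1 + C2 + C3 + C4 + 1.
have Ct0 : 0 < Ct by [].
have ip2 : 0 < phi m ^- 2 by rewrite invr_gt0 exprn_gt0.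
(* An infinite [q1] or [q2] makes the right side infinite, so only real values need an argument. *)
have gap_oo : approximation_gap n m w = +oo%E ->
    ((sqn (thm n m w - th n w))%:E <=
     Ct%:E * ((phi m ^- 2)%:E * approximation_gap n m w))%E.
  by move=> ->; rewrite !gt0_muley ?leey ?lte_fin.
have finite_or (y : \bar R) : (0 <= y)%E -> y = +oo%E \/ exists2 x, 0 <= x & y = x%:E.
  by case: y => [x| |]// x0; [right; exists x|left].
have oo3 : ((+oo : \bar R) ^+ 3 = +oo)%E by rewrite !expeS expe0 mule1 !mulyy.
set kb := n%:R^-1 * sample_sum X (kappam m) n w.
have kb0 : 0 <= kb.
  rewrite mulr_ge0 ?invr_ge0// sumr_ge0// => l _.
  by apply: le_trans (F'_err w (X l w) mm0 T0); rewrite mulr_ge0// ltW.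
have [q1E|[y1 y10 q1E]] := finite_or _ (q1_ge0 n w mm0).
  apply: gap_oo; rewrite /approximation_gap q1E oo3 addey// addye//.
  by rewrite gt_eqF// (lt_le_trans _ (expe_ge0 3 (q2_ge0 n w mm0)))// ltNy0.
have [q2E|[y2 y20 q2E]] := finite_or _ (q2_ge0 n w mm0).
  by apply: gap_oo; rewrite /approximation_gap q1E q2E oo3 -EFin_expe addey.
have gapE : approximation_gap n m w = (kb ^+ 2 + 2 + y1 ^+ 3 + y2 ^+ 3)%:E.
  by rewrite /approximation_gap q1E q2E -!EFin_expe.
rewrite gapE; change ((sqn (thm n m w - th n w))%:E <=
  (Ct * (phi m ^- 2 * (kb ^+ 2 + 2 + y1 ^+ 3 + y2 ^+ 3)))%:E)%E; rewrite lee_fin.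
pose alpha := (phi m)^-1 * (kb + c1 * y1 + c1 * y2).
have ip : 0 <= (phi m)^-1 by rewrite invr_ge0 ltW.
have cy1 : 0 <= c1 * y1 by rewrite mulr_ge0.
have cy2 : 0 <= c1 * y2 by rewrite mulr_ge0.
have alpha0 : 0 <= alpha by rewrite mulr_ge0// !addr_ge0.
have aa t : Theta t -> `|a' n m w t - a n w t| <= alpha.
  move=> Tt; apply: le_trans (@mean_diff n m w (fun m w => F' m w t) (F t) mm0 _) _.
    by move=> x; exact: F'_err.
  by rewrite ler_wpM2l// -addrA lerDl addr_ge0.
have BB t : Theta t -> `|B' n m w t - B n w t| <= alpha.
  move=> Tt; have := B'_err w n0 mm0 Tt; rewrite q1E -EFinM lee_fin => hB.
  by rewrite /alpha ler_pdivlMl// (le_trans hB)// addrAC lerDr addr_ge0.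
have JG s : `|s - t0| < r1 -> [/\ differentiable (a' n m w) s,
    differentiable (vec (B' n m w)) s,
    `|jacobian (a' n m w) s - jacobian (a n w) s| <= alpha &
    `|jacobian (vec (B' n m w)) s - jacobian (vec (B n w)) s| <= alpha].
  move=> sr; split.
  - by have [] := a'_jac n m w sr.
  - exact: dB'.
  - apply: le_trans (J'_diff n w mm0 sr) _.
    by rewrite ler_wpM2l// -addrA lerDl addr_ge0.
  - have := G'_err w n0 mm0 sr; rewrite q2E -EFinM lee_fin => hG.
    by rewrite /alpha ler_pdivlMl// (le_trans hG)// lerDr addr_ge0.
have [_ hest] := est _ _ _ (wb n w n0 small) (th_min w n0).
(* The perturbation estimate requires [alpha <= e]; beyond that, the squared diameter bound [A'] is
   at most A' alpha^2 / e^2, which is still of order alpha^2. *)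
have key : sqn (thm n m w - th n w) <= (A' / e ^+ 2 + d%:R * C ^+ 2) * alpha ^+ 2.
  rewrite mulrDl; have [ale|ale] := leP alpha e.
    have al0e : 0 <= alpha <= e by rewrite alpha0.
    have h2 := hest _ _ _ _ al0e (thm_min m w n0) aa BB JG.
    rewrite (le_trans (sqn_le_norm_sqr _))// ler_wpDl//.
      by rewrite mulr_ge0 ?sqr_ge0// divr_ge0// sqr_ge0.
    have -> : d%:R * C ^+ 2 * alpha ^+ 2 = d%:R * (C * alpha) ^+ 2 by ring.
    apply: ler_wpM2l; first exact: d0.
    by apply: lerXn2r; [rewrite nnegrE|rewrite nnegrE mulr_ge0// ltW|exact: h2].
  have t2 : 0 <= d%:R * C ^+ 2 * alpha ^+ 2.
    by apply: mulr_ge0; [apply: mulr_ge0; [exact: d0|exact: sqr_ge0]|exact: sqr_ge0].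
  have t3 : A' <= A' / e ^+ 2 * alpha ^+ 2.
    have ea : e ^+ 2 <= alpha ^+ 2.
      by apply: lerXn2r; rewrite ?nnegrE; [exact: ltW|exact: alpha0|exact: ltW].
    have e2 : 0 < e ^+ 2 by rewrite exprn_gt0.
    rewrite -mulrA ler_peMr//.
    by rewrite ler_pdivlMl// mulr1.
  by rewrite (le_trans diam)// (le_trans t3)// lerDl.
have al2 : alpha ^+ 2 <= phi m ^- 2 * (3 * (1 + c1 ^+ 2) * (kb ^+ 2 + 2 + y1 ^+ 3 + y2 ^+ 3)).
  rewrite /alpha exprMn exprVn ler_wpM2l ?(ltW ip2)//.
  exact: sqr_gap_le.
rewrite (le_trans key)// (@le_trans _ _ (C4 * (phi m ^- 2 * (kb ^+ 2 + 2 + y1 ^+ 3 + y2 ^+ 3))))//.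
  rewrite /C4 -mulrA ler_wpM2l//.
    by apply: addr_ge0; [apply: divr_ge0 => //|apply: mulr_ge0 => //]; exact: sqr_ge0.
  by rewrite mulrCA.
rewrite ler_wpM2r//.
  by rewrite mulr_ge0 ?(ltW ip2)// !addr_ge0 ?sqr_ge0 ?exprn_ge0.
Qed.

Hypothesis mu1 : forall n, (0 < n)%N -> measurable_fun setT (u1 n).
Hypothesis mu2 : forall n, (0 < n)%N -> measurable_fun setT (u2 n).
Hypothesis iu1 : forall n, (0 < n)%N -> (\int[P]_w (u1 n w ^+ 6) <= M%:E)%E.
Hypothesis iu2 : forall n, (0 < n)%N -> (\int[P]_w (u2 n w ^+ 6) <= M%:E)%E.
Hypothesis mq1 : forall n m, (0 < n)%N -> measurable_fun setT (q1 n m).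
Hypothesis mq2 : forall n m, (0 < n)%N -> measurable_fun setT (q2 n m).
Hypothesis iq1 : forall n m, (0 < n)%N -> (m0 <= m)%N ->
  (\int[P]_w (q1 n m w ^+ 3) <= M%:E)%E.
Hypothesis iq2 : forall n m, (0 < n)%N -> (m0 <= m)%N ->
  (\int[P]_w (q2 n m w ^+ 3) <= M%:E)%E.
Hypothesis mA3 : forall n, (0 < n)%N -> measurable (A3 n).
Hypothesis A3_prob : n%:R * fine (P (A3 n)) @[n --> \oo] --> (0 : R).
Hypothesis mkm : forall m, measurable_fun setT (kappam m).
Hypothesis ikm : forall m, mu.-integrable setT (EFin \o (fun x => kappam m x ^+ 2)).
Hypothesis kmM : forall m, \int[mu]_x (kappam m x ^+ 2) <= M.

Let measurable_expe (u : Omega -> \bar R) l :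
  measurable_fun setT u -> measurable_fun setT (fun w => u w ^+ l)%E.
Proof.
move=> mu_; elim: l => [|l IH].
  by under eq_fun do rewrite expe0; exact: measurable_cst.
by under eq_fun do rewrite expeS; exact: emeasurable_funM.
Qed.

Let Efin (g : Omega -> R) : P.-integrable setT (EFin \o g) ->
  (\int[P]_w (g w)%:E = (\int[P]_w g w)%:E)%E.
Proof. by move=> fi; rewrite /Rintegral fineK// integrable_fin_num. Qed.

Lemma integral_err gs : {in gs, forall g, L4 mu g} ->
  exists2 C, 0 <= C & forall n, (0 < n)%N -> measurable_fun setT (err gs n) /\
    (\int[P]_w err gs n w <= (C * n%:R ^- 2 + fine (P (A3 n)))%:E)%E.
Proof.
move=> gs4; have [C C0 hC] := Rintegral_zsum X_iid gs4.
exists (C + (1 + M + M)); first by rewrite !addr_ge0.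
move=> n n0; have [iz hz] := hC n n0.
have n2 : 0 <= n%:R ^- 2 :> R by rewrite invr_ge0 exprn_ge0.
have mz : measurable_fun setT (fun w => (zsum mu X gs n w)%:E) := measurable_int _ iz.
have m1 : measurable_fun setT (fun w => (n%:R ^- 2)%:E * u1 n w ^+ 6)%E.
  by apply: emeasurable_funM; [exact: measurable_cst|apply: measurable_expe; exact: mu1].
have m1' : measurable_fun setT (fun w => (n%:R ^- 2)%:E + (n%:R ^- 2)%:E * u1 n w ^+ 6)%E.
  by apply: emeasurable_funD => //; exact: measurable_cst.
have m2 : measurable_fun setT (fun w => (n%:R ^- 2)%:E * u2 n w ^+ 6)%E.
  by apply: emeasurable_funM; [exact: measurable_cst|apply: measurable_expe; exact: mu2].
have m3 : measurable_fun setT (fun w => (\1_(A3 n) w : R)%:E).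
  by apply/measurable_EFinP; apply: measurable_indic; exact: mA3.
have z0 w : (0 <= (zsum mu X gs n w)%:E)%E by rewrite lee_fin zsum_ge0.
have p1 w : (0 <= (n%:R ^- 2)%:E * u1 n w ^+ 6)%E by rewrite mule_ge0 ?lee_fin// expe_ge0.
have p1' w : (0 <= (n%:R ^- 2)%:E + (n%:R ^- 2)%:E * u1 n w ^+ 6)%E by rewrite adde_ge0 ?lee_fin.
have p2 w : (0 <= (n%:R ^- 2)%:E * u2 n w ^+ 6)%E by rewrite mule_ge0 ?lee_fin// expe_ge0.
have p3 w : (0 <= (\1_(A3 n) w : R)%:E)%E by rewrite lee_fin indicE.
have s1 : measurable_fun setT (fun w => (zsum mu X gs n w)%:E +
    ((n%:R ^- 2)%:E + (n%:R ^- 2)%:E * u1 n w ^+ 6))%E by exact: emeasurable_funD.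
have s2 : measurable_fun setT (fun w => (zsum mu X gs n w)%:E +
    ((n%:R ^- 2)%:E + (n%:R ^- 2)%:E * u1 n w ^+ 6) + (n%:R ^- 2)%:E * u2 n w ^+ 6)%E.
  exact: emeasurable_funD.
split; first exact: emeasurable_funD.
rewrite /err ge0_integralD//; last by move=> w _; rewrite !adde_ge0.
rewrite ge0_integralD//; last by move=> w _; rewrite adde_ge0.
rewrite ge0_integralD//.
rewrite ge0_integralD//.
rewrite !ge0_integralZl_EFin//; [|by move=> w _; rewrite expe_ge0|by apply: measurable_expe; exact: mu2|by move=> w _; rewrite expe_ge0|by apply: measurable_expe; exact: mu1].
have -> : (\int[P]_w (n%:R ^- 2)%:E = (n%:R ^- 2)%:E :> \bar R)%E.
  rewrite integral_cst// [X in (_ * X)%E](_ : _ = 1%E) ?mule1//.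
  exact: probability_setT.
have -> : (\int[P]_w (\1_(A3 n) w : R)%:E = (fine (P (A3 n)))%:E)%E.
  rewrite integral_indic//; last exact: mA3.
  by rewrite setIT fineK// fin_num_measure//; exact: mA3.
rewrite Efin//.
have -> : ((C + (1 + M + M)) * n%:R ^- 2 + fine (P (A3 n)))%:E =
  ((C * n%:R ^- 2)%:E + ((n%:R ^- 2)%:E + (n%:R ^- 2)%:E * M%:E) + (n%:R ^- 2)%:E * M%:E
   + (fine (P (A3 n)))%:E)%E.
  rewrite -!EFinM -!EFinD; congr (_%:E); ring.
apply: leeD => //; apply: leeD; last by apply: lee_wpmul2l; rewrite ?lee_fin// iu2.
apply: leeD; first by rewrite lee_fin.
by apply: leeD => //; apply: lee_wpmul2l; rewrite ?lee_fin// iu1.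
Qed.

Lemma integral_gap n m : (0 < n)%N -> (m0 <= m)%N ->
  measurable_fun setT (approximation_gap n m) /\
  (\int[P]_w approximation_gap n m w <= (2 + 3 * M)%:E)%E.
Proof.
move=> n0 mm0.
have mk : measurable_fun setT (fun w => ((n%:R^-1 * sample_sum X (kappam m) n w) ^+ 2 + 2)%:E).
  apply/measurable_EFinP; apply: measurable_funD => //; apply: measurable_funX.
  by apply: measurable_funM => //; exact: measurable_sample_sum.
have m1 : measurable_fun setT (fun w => q1 n m w ^+ 3)%E by apply: measurable_expe; exact: mq1.
have m2 : measurable_fun setT (fun w => q2 n m w ^+ 3)%E by apply: measurable_expe; exact: mq2.
have k0 w : (0 <= ((n%:R^-1 * sample_sum X (kappam m) n w) ^+ 2 + 2)%:E)%E.
  by rewrite lee_fin addr_ge0// sqr_ge0.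
have z1 w : (0 <= q1 n m w ^+ 3)%E by rewrite expe_ge0// q1_ge0.
have z2 w : (0 <= q2 n m w ^+ 3)%E by rewrite expe_ge0// q2_ge0.
have m12 : measurable_fun setT (fun w => ((n%:R^-1 * sample_sum X (kappam m) n w) ^+ 2 + 2)%:E
    + q1 n m w ^+ 3)%E by exact: emeasurable_funD.
split; first exact: emeasurable_funD.
rewrite /approximation_gap ge0_integralD//; last by move=> w _; rewrite adde_ge0.
rewrite ge0_integralD//.
have is_ : P.-integrable setT (EFin \o sample_sum X (fun x => kappam m x ^+ 2) n) /\
    \int[P]_w sample_sum X (fun x => kappam m x ^+ 2) n w = n%:R * \int[mu]_x (kappam m x ^+ 2).
  have [] := @Rintegral_lin_sum _ _ _ P 'I_n (index_enum _) (fun=> 1)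
    (fun i w => kappam m (X i w) ^+ 2).
    by move=> i; have [] := integral_sample X_iid i (ikm m).
  rewrite (_ : (fun w => _) = sample_sum X (fun x => kappam m x ^+ 2) n); last first.
    by apply/funext => w; apply: eq_bigr => i _; rewrite mul1r.
  move=> i1 i2; split => //; rewrite i2.
  under eq_bigr => i _ do rewrite mul1r (integral_sample X_iid i (ikm m)).2.
  by rewrite sumr_const card_ord mulr_natl.
have [is1 is2] := is_.
have iZ := integrable_EFinZl measurableT n%:R^-1 is1.
have i2 : P.-integrable setT (EFin \o (fun=> 2 : R)) by exact: finite_measure_integrable_cst.
have iD := integrable_EFinD measurableT iZ i2.
have nn0 : n%:R != 0 :> R by rewrite pnatr_eq0 -lt0n.
have h : (\int[P]_w ((n%:R^-1 * sample_sum X (kappam m) n w) ^+ 2 + 2)%:E <= (M + 2)%:E)%E.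
  apply: (@le_trans _ _ (\int[P]_w (n%:R^-1 * sample_sum X (fun x => kappam m x ^+ 2) n w + 2)%:E)%E).
    apply: ge0_le_integral_sup => w //.
    by rewrite lee_fin lerD2r mean_sqr_le.
  rewrite Efin// lee_fin RintegralD// RintegralZl// is2 mulKf//.
  have P1 : fine (P [set: Omega]) = 1 by rewrite probability_setT.
  by rewrite Rintegral_cst// P1 mulr1 lerD2r kmM.
have -> : ((2 + 3 * M)%:E = (M + 2)%:E + M%:E + M%:E)%E.
  by rewrite -!EFinD; congr (_%:E); ring.
by apply: leeD; [apply: leeD => //; exact: iq1|exact: iq2].
Qed.

Let fine_le (x : \bar R) r : (0 <= x)%E -> (x <= r%:E)%E -> fine x <= r.
Proof. by case: x => [x||]//; rewrite !lee_fin. Qed.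

(** [delta n] is a multiple of n^-2 plus a multiple of P (A3 n), so n delta_n tends to 0 by the rate
    assumed for the second derivatives of the weight. *)
Lemma mean_square_errors : exists delta : nat -> R, exists C,
  [/\ n%:R * delta n @[n --> \oo] --> (0 : R), forall n, 0 <= delta n, 0 <= C,
   forall n, (0 < n)%N -> \int[P]_w sqn (th n w - t0 - influence_term n w) <= delta n &
   forall n m, (0 < n)%N -> (m0 <= m)%N ->
     \int[P]_w sqn (thm n m w - th n w) <= delta n + C * phi m ^- 2].
Proof.
have [gs [gs4 [C C0 hC]]] := pointwise_bounds.
have [C' C'0 hC'] := integral_err gs4.
have CE n : (0 < n)%N -> (\int[P]_w (C%:E * err gs n w) <= (C * (C' * n%:R ^- 2 + fine (P (A3 n))))%:E)%E.
  move=> n0; have [mE iE] := hC' n n0.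
  rewrite ge0_integralZl_EFin ?(ltW C0)//; last by move=> w _; exact: err_ge0.
  by rewrite EFinM; apply: lee_wpmul2l => //; rewrite lee_fin ltW.
exists (fun n => C * (C' * n%:R ^- 2 + fine (P (A3 n)))), (C * (2 + 3 * M)); split.
- have inv : (fun n => n%:R^-1 : R) @ \oo --> (0 : R).
    by rewrite -cvg_shiftS; exact: cvg_harmonic.
  rewrite [X in X @ _ --> _](_ : _ = fun n => (C * C') * n%:R^-1 + C * (n%:R * fine (P (A3 n)))).
    rewrite -[X in _ --> X](_ : C * C' * 0 + C * 0 = 0 :> R); last by ring.
    by apply: cvgD; apply: cvgMr.
  (* The identity of sequences includes n = 0, where the inverse of 0 is 0. *)
  apply/funext => n; have [->|n0] := posnP n; first by rewrite invr0 !mul0r !mulr0 addr0.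
  have nn0 : n%:R != 0 :> R by rewrite pnatr_eq0 -lt0n.
  by field.
- move=> n; apply: mulr_ge0; first exact: ltW.
  by rewrite addr_ge0 ?fine_ge0// mulr_ge0// invr_ge0 exprn_ge0.
- by rewrite mulr_ge0 ?(ltW C0)// addr_ge0// mulr_ge0.
- move=> n n0; apply: fine_le.
    by apply: integral_ge0 => w _; rewrite lee_fin sqn_ge0.
  apply: le_trans (CE n n0); apply: ge0_le_integral_sup => w.
    by rewrite lee_fin sqn_ge0.
  by have [] := hC n w n0.
- move=> n m n0 mm0; apply: fine_le.
    by apply: integral_ge0 => w _; rewrite lee_fin sqn_ge0.
  have [mE _] := hC' n n0; have [mG iG] := integral_gap n0 mm0.
  have p2 : 0 <= phi m ^- 2 by rewrite invr_ge0 exprn_ge0// ltW// phi0.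
  have G0 w : (0 <= approximation_gap n m w)%E.
    rewrite /approximation_gap !adde_ge0 ?expe_ge0 ?q1_ge0 ?q2_ge0//.
    by rewrite lee_fin addr_ge0// sqr_ge0.
  have mpG : measurable_fun setT (fun w => (phi m ^- 2)%:E * approximation_gap n m w)%E.
    by apply: emeasurable_funM => //; exact: measurable_cst.
  have pG0 w : (0 <= (phi m ^- 2)%:E * approximation_gap n m w)%E by rewrite mule_ge0 ?lee_fin.
  apply: (@le_trans _ _ (\int[P]_w (C%:E * err gs n w + C%:E * ((phi m ^- 2)%:E * approximation_gap n m w)))%E).
    apply: ge0_le_integral_sup => w; first by rewrite lee_fin sqn_ge0.
    by have [_ h] := hC n w n0; exact: h.
  have C0' := ltW C0.
  rewrite ge0_integralD//; last 4 first.
  + by move=> w _; rewrite mule_ge0 ?lee_fin ?err_ge0.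
  + by apply: emeasurable_funM => //; exact: measurable_cst.
  + by move=> w _; rewrite mule_ge0 ?lee_fin.
  + by apply: emeasurable_funM => //; exact: measurable_cst.
  rewrite EFinD; apply: leeD; first exact: CE.
  rewrite ge0_integralZl_EFin// ge0_integralZl_EFin//.
  have -> : (C * (2 + 3 * M) * phi m ^- 2)%:E = (C%:E * ((phi m ^- 2)%:E * (2 + 3 * M)%:E))%E.
    by rewrite -!EFinM; congr (_%:E); ring.
  by apply: lee_wpmul2l; rewrite ?lee_fin//; apply: lee_wpmul2l; rewrite ?lee_fin.
Qed.

Lemma influence_term_entry n w i : influence_term n w 0 i =
  \sum_j (- Lm j i) * zbar mu X (fun x => F t0 x 0 j) n w.
Proof.
rewrite /influence_term !mxE -sumrN; apply: eq_bigr => j _.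
by rewrite empirical_constraint_t0 mulNr mulrC.
Qed.

Let F04 j : L4 mu (fun x => F t0 x 0 j). Proof. exact: L4_F. Qed.

Lemma L4_influence_term n i : L4 P (fun w => influence_term n w 0 i).
Proof.
rewrite (_ : (fun w => _) = (fun w => \sum_j (- Lm j i) * zbar mu X (fun x => F t0 x 0 j) n w)).
  by apply: L4_sum => j; apply: L4Z; exact: (L4_zbar X_iid).
by apply/funext => w; exact: influence_term_entry.
Qed.

Lemma influence_term_mean n i : (0 < n)%N -> \int[P]_w influence_term n w 0 i = 0.
Proof.
move=> n0; rewrite (_ : (fun w => _) = (fun w => \sum_j (- Lm j i) * zbar mu X (fun x => F t0 x 0 j) n w)).
  have [|_ ->] := @Rintegral_lin_sum _ _ _ P 'I_k (index_enum _) (fun j => - Lm j i)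
    (fun j w => zbar mu X (fun x => F t0 x 0 j) n w).
    by move=> j; apply: L4_integrable; exact: (L4_zbar X_iid).
  by apply: big1 => j _; rewrite (Rintegral_zbar X_iid)// mulr0.
by apply/funext => w; exact: influence_term_entry.
Qed.

(** For [S] the covariance of the constraint at [t0], the quantity is [Lm^T *m S *m Lm]. As [W t0]
    inverts [S], the sandwich collapses to the efficiency bound, exactly for every positive n. *)
Lemma influence_term_covariance n i j : (0 < n)%N ->
  n%:R * \int[P]_w (influence_term n w 0 i * influence_term n w 0 j) =
  invmx (D *m W t0 *m D^T) i j.
Proof.
move=> n0; pose z l w := zbar mu X (fun x => F t0 x 0 l) n w.
have z4 l : L4 P (z l) by exact: (L4_zbar X_iid).
rewrite (_ : (fun w => _) = (fun w => \sum_(p <- index_enum ('I_k * 'I_k)%type)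
  (Lm p.1 i * Lm p.2 j) * (z p.1 w * z p.2 w))); last first.
  apply/funext => w; rewrite !influence_term_entry mulr_suml.
  rewrite -(pair_bigA _ (fun l l' => Lm l i * Lm l' j * (z l w * z l' w)))/=.
  by apply: eq_bigr => l _; rewrite mulr_sumr; apply: eq_bigr => l' _; rewrite /z; ring.
have [|_ ->] := @Rintegral_lin_sum _ _ _ P _ (index_enum ('I_k * 'I_k)%type)
    (fun p => Lm p.1 i * Lm p.2 j) (fun p w => z p.1 w * z p.2 w).
  by move=> p; exact: L4M_integrable.
have F0 l : \int[mu]_x F t0 x 0 l = 0.
  by have := congr1 (fun y : 'rV_k => y 0 l) f0; rewrite !mxE.
pose S := cov_mx mu (fun j x => F t0 x 0 j).
have SE l l' : n%:R * \int[P]_w (z l w * z l' w) = S l l'.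
  rewrite (Rintegral_zbar_mul X_iid)// mxE !F0 mulr0 subr0.
  by apply: eq_Rintegral => x _; rewrite !subr0.
have [c c_gt0 coer] := W_coercive.
have [c' c'0 coer'] := row_full_rank_coercive D_rank c_gt0 (coer _ T0).
have Mu : D *m W t0 *m D^T \in unitmx.
  apply: (@coercive_unitmx _ _ _ c') => // u.
  by rewrite (le_trans (coer' u))// /bil trmx_mul !mulmxA.
have MM : (D *m W t0 *m D^T)^T = D *m W t0 *m D^T.
  by rewrite !trmx_mul trmxK W_sym mulmxA.
have <- : Lm^T *m S *m Lm = invmx (D *m W t0 *m D^T).
  have LT : Lm^T = invmx (D *m W t0 *m D^T) *m D *m W t0.
    by rewrite /Lm /influence !trmx_mul trmx_inv MM trmxK W_sym mulmxA.
  have WS : W t0 *m S = 1%:M by rewrite WE// mulVmx// cov_unit.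
  rewrite LT -!mulmxA (mulmxA (W t0) S) WS mul1mx /Lm /influence.
  by rewrite !mulmxA -(mulmxA (invmx _)) -(mulmxA (invmx _)) mulVmx// mul1mx.
rewrite mulr_sumr -(pair_bigA _ (fun l l' => n%:R * (Lm l i * Lm l' j * \int[P]_w (z l w * z l' w))))/=.
rewrite exchange_big/= [RHS]mxE; apply: eq_bigr => l' _.
rewrite [X in _ = X * _]mxE mulr_suml; apply: eq_bigr => l _.
by rewrite -SE [Lm^T i l]mxE; ring.
Qed.

End cue_estimator.

(** * Extension to the whole space *)

Section measurability_of_entries.
Context {R : realType}.

Lemma measurable_coord m n (i : 'I_m) (j : 'I_n) :
  measurable_fun [set: 'M[R]_(m, n)] (fun A => A i j).
Proof.
apply: (measurability _ (RGenOInfty.measurableE R)) => _ [_ [x ->] <-].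
rewrite setTI; apply: sub_sigma_algebra.
by apply: open_comp; [move=> A _; exact: coord_continuous|exact: interval_open].
Qed.

Lemma measurable_entry {d} {T : measurableType d} m n (D : set T)
    (f : T -> 'M[R]_(m, n)) i j :
  measurable_fun D f -> measurable_fun D (fun x => f x i j).
Proof. by move=> mf; exact: (measurableT_comp (@measurable_coord m n i j) mf). Qed.

Lemma measurable_open m n (A : set 'M[R]_(m, n)) : open A -> measurable A.
Proof. by move=> oA; exact: sub_sigma_algebra. Qed.

End measurability_of_entries.

Section twelfth_moment.
Context {d} {T : measurableType d} {R : realType}.
Variables (mu : probability T R) (f : T -> R).
Hypothesis mf : measurable_fun setT f.

Let expr_le (j : nat) x : (j <= 6)%N -> f x ^+ (2 * j) <= 1 + f x ^+ 12.
Proof.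
move=> j6; rewrite exprM -[12%N]/(2 * 6)%N [X in _ <= 1 + X]exprM.
have [le1|gt1] := leP (f x ^+ 2) 1.
  apply: (@le_trans _ _ 1); first by rewrite exprn_ile1// sqr_ge0.
  by rewrite lerDl exprn_ge0// sqr_ge0.
by rewrite (le_trans (ler_weXn2l (ltW gt1) j6))// lerDr.
Qed.

Let integral_le j : (j <= 6)%N ->
  (\int[mu]_x (f x ^+ (2 * j))%:E <= 1 + \int[mu]_x (f x ^+ 12)%:E)%E.
Proof.
move=> j6; have p12 x : 0 <= f x ^+ 12 by rewrite -[12%N]/(2 * 6)%N exprM exprn_ge0// sqr_ge0.
have -> : (1 + \int[mu]_x (f x ^+ 12)%:E = \int[mu]_x (1%:E + (f x ^+ 12)%:E))%E.
  rewrite ge0_integralD//; last 2 first.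
  - by move=> x _; rewrite lee_fin.
  - by apply/measurable_EFinP; exact: measurable_funX.
  rewrite integral_cst// [X in (_ * X)%E](_ : _ = 1%E) ?mule1//.
  exact: probability_setT.
apply: ge0_le_integral_sup => x; first by rewrite lee_fin exprM exprn_ge0// sqr_ge0.
by rewrite -EFinD lee_fin expr_le.
Qed.

Let integrable_expr j : (j <= 6)%N -> (\int[mu]_x (f x ^+ 12)%:E < +oo)%E ->
  mu.-integrable setT (EFin \o (fun x => f x ^+ (2 * j))).
Proof.
move=> j6 foo; apply/integrableP; split.
  by apply/measurable_EFinP; exact: measurable_funX.
have p x : 0 <= f x ^+ (2 * j) by rewrite exprM exprn_ge0// sqr_ge0.
under eq_integral => x _ do rewrite /= ger0_norm//.
by rewrite (le_lt_trans (integral_le j6))// lte_add_pinfty// ltry.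
Qed.

Lemma L4_of_twelfth_moment : (\int[mu]_x (f x ^+ 12)%:E < +oo)%E -> L4 mu f.
Proof. by move=> foo; split => //; exact: (@integrable_expr 2). Qed.

Lemma sqr_of_twelfth_moment C : (\int[mu]_x (f x ^+ 12)%:E <= C%:E)%E ->
  mu.-integrable setT (EFin \o (fun x => f x ^+ 2)) /\
  \int[mu]_x (f x ^+ 2) <= 1 + C.
Proof.
move=> fC; have foo := le_lt_trans fC (ltry C).
have i2 : mu.-integrable setT (EFin \o (fun x => f x ^+ 2)) by exact: (@integrable_expr 1).
split => //; rewrite -lee_fin /Rintegral fineK ?integrable_fin_num//.
by rewrite (le_trans (@integral_le 1 isT))// EFinD leeD.
Qed.

End twelfth_moment.

Section norm_comparison.
Context {R : realType}.
Variable nrm : forall m n : nat, 'M[R]_(m, n) -> R.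
Hypothesis nrm_norm : forall m n : nat, is_norm (@nrm m n).

(** [nrm] is an unrelated norm for each shape, so a common constant exists only for finitely many
    shapes. *)
Lemma common_norm_bound (s : seq (nat * nat)) : exists2 c, 0 < c &
  forall m n, (m, n) \in s -> forall A : 'M[R]_(m, n), `|A| <= c * nrm A.
Proof.
elim: s => [|[m n] s [c c0 hc]]; first by exists 1.
have [c' c'0 hc'] := mx_norm_le_is_norm (@nrm_norm m n).
exists (c + c') => [|m1 n1]; first exact: addr_gt0.
have n0 (A : 'M[R]_(m1, n1)) : 0 <= nrm A by exact: is_norm_ge0.
rewrite inE => /orP[/eqP[-> ->] A|mn A].
  by rewrite (le_trans (hc' A))// ler_wpM2r ?lerDr ?(ltW c0)//; exact: is_norm_ge0.
by rewrite (le_trans (hc _ _ mn A))// ler_wpM2r ?lerDl ?(ltW c'0).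
Qed.

Lemma supdist_ge0 (U : Type) m n (S : set U) (f g : U -> 'M[R]_(m, n)) t :
  S t -> (0 <= supdist nrm S f g)%E.
Proof.
move=> St; apply: le_trans (supnorm_ge nrm _ St).
by rewrite lee_fin is_norm_ge0.
Qed.

Lemma scaled_norm_le_supdist (U : Type) m n (S : set U) (f g : U -> 'M[R]_(m, n)) t s c :
  0 <= s -> 0 <= c -> (forall A : 'M[R]_(m, n), `|A| <= c * nrm A) -> S t ->
  ((s * `|f t - g t|)%:E <= c%:E * (s%:E * supdist nrm S f g))%E.
Proof.
move=> s0 c0 hc St; apply: (@le_trans _ _ (c%:E * (s%:E * (nrm (f t - g t))%:E))%E).
  by rewrite -!EFinM lee_fin mulrCA ler_wpM2l.
do 2 (apply: lee_wpmul2l; rewrite ?lee_fin//).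
exact: (supnorm_ge nrm (fun t => f t - g t) St).
Qed.

Lemma scaled_norm_le_of_supdist (U : Type) m n (S : set U) (f g : U -> 'M[R]_(m, n)) t s c K :
  0 < s -> 0 <= c -> (forall A : 'M[R]_(m, n), `|A| <= c * nrm A) -> S t ->
  (s%:E * supdist nrm S f g <= K%:E)%E -> s * `|f t - g t| <= c * K.
Proof.
move=> s0 c0 hc St hK; rewrite -lee_fin.
apply: le_trans (scaled_norm_le_supdist f g (ltW s0) c0 hc St) _.
by rewrite EFinM; apply: lee_wpmul2l; rewrite ?lee_fin.
Qed.

End norm_comparison.

Section extension_by_zero.
Context {R : realType} {T U : Type}.

(* What happens off the sample space is irrelevant, and extending by zero makes
   the pointwise hypotheses hold everywhere. *)
Definition zero_off m n (D : set T) (f : T -> 'M[R]_(m, n)) : T -> 'M[R]_(m, n) :=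
  fun x => if x \in D then f x else 0.

Lemma zero_off_section m n (D : set T) (f : U -> T -> 'M[R]_(m, n)) x :
  (fun u => zero_off D (f u) x) = if x \in D then f^~ x else cst 0.
Proof. by apply/funext => u; rewrite /zero_off; case: (x \in D). Qed.

Lemma zero_off_entry m n (D : set T) (f : T -> 'M[R]_(m, n)) i j :
  (fun x => zero_off D f x i j) = (fun x => f x i j) \_ D.
Proof. by apply/funext => x; rewrite /zero_off patchE; case: ifP => _; rewrite ?mxE. Qed.

Lemma zero_offE m n (D : set T) (f : T -> 'M[R]_(m, n)) x : D x -> zero_off D f x = f x.
Proof. by move=> Dx; rewrite /zero_off mem_set. Qed.

End extension_by_zero.

Section integral_of_extension.
Context {d} {T : measurableType d} {R : realType}.
Variables (mu : {measure set T -> \bar R}) (D : set T).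

Lemma mx_integral_zero_off m n (f : T -> 'M[R]_(m, n)) i j :
  mx_integral mu D f i j = \int[mu]_x zero_off D f x i j.
Proof. by rewrite mxE Rintegral_mkcond zero_off_entry. Qed.

Lemma measurable_zero_off m n (f : T -> 'M[R]_(m, n)) i j :
  measurable D -> measurable_fun D f ->
  measurable_fun setT (fun x => zero_off D f x i j).
Proof.
move=> mD mf; rewrite zero_off_entry.
apply: (measurable_restrictT (fun x => f x i j) mD).1.
exact: measurable_entry.
Qed.

End integral_of_extension.

Lemma covariance_mx_zero_off {d} {T : measurableType d} {R : realType}
    (mu : probability T R) (D : set T) k (f : T -> 'rV[R]_k) :
  covariance_mx mu D f = cov_mx mu (fun j x => zero_off D f x 0 j).
Proof.
apply/matrixP => i j; rewrite mxE [X in X + _]mxE [X in _ + X]mxE [X in - X]mxE big_ord1.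
rewrite [_^T i 0]mxE !mx_integral_zero_off [RHS]mxE; congr (_ - _).
rewrite Rintegral_mkcond; apply: eq_Rintegral => x _.
rewrite /zero_off patchE; case: ifP => _; last by rewrite !mxE mulr0.
by rewrite mxE big_ord1 mxE.
Qed.

Lemma jacobian_cst {R : realType} {d p : nat} (c : 'rV[R]_p) (t : 'rV[R]_d) :
  jacobian (cst c) t = 0.
Proof.
apply/matrixP => i j; rewrite jacobian_entry; last exact: differentiable_cst.
by rewrite mxE derive_cst.
Qed.

Lemma locally_bounded {R : realType} {d m n : nat} (f : 'rV[R]_d -> 'M[R]_(m, n)) t0 :
  {for t0, continuous f} ->
  exists2 r, 0 < r & forall t, `|t - t0| < r -> `|f t| <= `|f t0| + 1.
Proof.
move=> /cvgrPdist_lt/(_ _ ltr01)/nbhs_ballP[r /= r0 hr]; exists r => // t tr.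
have : `|f t0 - f t| < 1 by apply: hr; rewrite -ball_normE/= distrC.
by move=> h; rewrite -lerBlDl (le_trans (lerB_dist _ _))// distrC ltW.
Qed.

(** * Reduction of the hypotheses to the max norm and to functions on the whole space *)

Theorem corollary4p2
  (R : realType) (q d k : nat) (k_ge_d : (d <= k)%N)
  (nrm : forall m n : nat, 'M[R]_(m, n) -> R)
  (nrm_norm : forall m n : nat, is_norm (nrm m n))
  (* the sample space, the law mu and the observations *)
  (XX : set 'rV[R]_q) (XX_open : open XX)
  (mu : probability 'rV[R]_q R) (mu_XX : mu XX = 1%E)
  (dO : measure_display) (Omega : measurableType dO)
  (P : probability Omega R)
  (X : nat -> {RV P >-> 'rV[R]_q})
  (X_XX : forall i w, XX (X i w))
  (X_iid : iid X mu)
  (* the constraint function Phi *)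
  (Theta : set 'rV[R]_d)
  (Phi : 'rV[R]_d -> 'rV[R]_q -> 'rV[R]_k)
  (Phi_meas : forall t, Theta t -> measurable_fun XX (Phi t))
  (* the observed approximations Phim m (Y w) of Phi, where Y is a random
     element independent of the observations *)
  (dS : measure_display) (S : measurableType dS) (Y : {RV P >-> S})
  (Y_indep : independent_of_sequence Y X)
  (Phim : nat -> S -> 'rV[R]_d -> 'rV[R]_q -> 'rV[R]_k)
  (Phim_meas : forall m t, Theta t ->
     measurable_fun ([set: S] `*` XX)
       (fun z : S * 'rV[R]_q => Phim m z.1 t z.2))
  (* W is the inverse of the covariance of Phi(theta, .), What its estimator *)
  (W : 'rV[R]_d -> 'M[R]_k)
  (covariance_unit : forall t, Theta t ->
     covariance_mx mu XX (Phi t) \in unitmx)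
  (W_def : W = fun t => invmx (covariance_mx mu XX (Phi t)))
  (estW : weight_estimator 'rV[R]_q k)
  (What : nat -> Omega -> 'rV[R]_d -> 'M[R]_k)
  (What_def : What = fun n w t => estW n (sample X n w) (Phi t))
  (Whatm : nat -> nat -> Omega -> 'rV[R]_d -> 'M[R]_k)
  (Whatm_def : Whatm =
     fun n m w t => estW n (sample X n w) (Phim m (Y w) t))
  (What_meas : forall n t, (0 < n)%N -> Theta t ->
     measurable_fun [set: Omega] (fun w => What n w t))
  (Whatm_meas : forall n m t, (0 < n)%N -> Theta t ->
     measurable_fun [set: Omega] (fun w => Whatm n m w t))
  (What_consistent : forall t, Theta t -> forall eps : R, 0 < eps ->
     P [set w | eps < nrm k k (What n w t - W t)] @[n --> \oo] --> 0%E)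
  (* (1) *)
  (Theta_compact : compact Theta)
  (* (2) *)
  (mean_cont : {within Theta, continuous (fun t => mx_integral mu XX (Phi t))})
  (theta0 : 'rV[R]_d)
  (theta0_int : interior Theta theta0)
  (theta0_zero : mx_integral mu XX (Phi theta0) = 0)
  (theta0_uniq : forall t, Theta t -> mx_integral mu XX (Phi t) = 0 ->
     t = theta0)
  (* (3) *)
  (Phi_cont : forall x, XX x -> {within Theta, continuous (Phi^~ x)})
  (Phi_bound : exists2 g : 'rV[R]_q -> R, mu.-integrable XX (EFin \o g) &
     forall x, XX x -> (supnorm nrm Theta (Phi^~ x) <= (g x)%:E)%E)
  (* (4) *)
  (N : set 'rV[R]_d) (N_open : open N) (N_theta0 : N theta0)
  (N_Theta : N `<=` Theta)
  (Phi_C2 : forall x, XX x ->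
     twice_continuously_differentiable_on N (Phi^~ x))
  (dPhi_bound : exists2 g : 'rV[R]_q -> R, mu.-integrable XX (EFin \o g) &
     forall x, XX x ->
       (supnorm nrm N (jacobian (Phi^~ x)) <= (g x)%:E)%E /\
       (supnorm nrm N (hessian (Phi^~ x)) <= (g x)%:E)%E)
  (* (5) *)
  (D : 'M[R]_(d, k))
  (D_def : D = mx_integral mu XX (fun x => jacobian (Phi^~ x) theta0))
  (D_rank : \rank D = d)
  (V : 'M[R]_k)
  (V_def : V =
     mx_integral mu XX (fun x => (Phi theta0 x)^T *m Phi theta0 x))
  (V_rank : \rank V = k)
  (* (6) *)
  (kappa : 'rV[R]_q -> R) (kappa_meas : measurable_fun XX kappa)
  (kappa_12 : (\int[mu]_(x in XX) (kappa x ^+ 12)%:E < +oo)%E)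
  (Phi_kappa : forall x, XX x ->
     [/\ (supnorm nrm Theta (Phi^~ x) <= (kappa x)%:E)%E,
         (supnorm nrm N (jacobian (Phi^~ x)) <= (kappa x)%:E)%E &
         (supnorm nrm N (hessian (Phi^~ x)) <= (kappa x)%:E)%E])
  (* (7) *)
  (phi : nat -> R) (phi_oo : phi m @[m --> \oo] --> +oo)
  (kappam : nat -> 'rV[R]_q -> R)
  (kappam_meas : forall m, measurable_fun XX (kappam m))
  (kappam_12 : exists C : R, forall m,
     (\int[mu]_(x in XX) (kappam m x ^+ 12)%:E <= C%:E)%E)
  (Phim_diff : forall m w x, XX x ->
     differentiable_on N ((Phim m (Y w))^~ x))
  (Phim_kappam : forall m w x, XX x ->
     ((phi m)%:E * supdist nrm Theta ((Phim m (Y w))^~ x) (Phi^~ x)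
        <= (kappam m x)%:E)%E /\
     ((phi m)%:E * supdist nrm N (jacobian ((Phim m (Y w))^~ x))
                                  (jacobian (Phi^~ x))
        <= (kappam m x)%:E)%E)
  (* (8) *)
  (What_diff : forall n w, (0 < n)%N -> differentiable_on N (vec (What n w)))
  (What_moment : bounded_moments P [set n | (0 < n)%N] 6 (fun n w =>
     ((Num.sqrt n%:R)%:E * supdist nrm Theta (What n w) W)%E))
  (dWhat_moment : bounded_moments P [set n | (0 < n)%N] 6 (fun n w =>
     ((Num.sqrt n%:R)%:E *
        supdist nrm N (jacobian (vec (What n w))) (jacobian (vec W)))%E))
  (Whatm_moment : bounded_moments P [set nm | (0 < nm.1)%N] 3
     (fun (nm : nat * nat) w => ((phi nm.2)%:E *
        supdist nrm Theta (Whatm nm.1 nm.2 w) (What nm.1 w))%E))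
  (* (9) *)
  (What_C2 : forall n w, (0 < n)%N ->
     twice_continuously_differentiable_on N (vec (What n w)))
  (W_C2 : twice_continuously_differentiable_on N (vec W))
  (d2What_meas : forall n, (0 < n)%N ->
     measurable_fun [set: Omega] (fun w =>
       supdist nrm N (hessian (vec (What n w))) (hessian (vec W))))
  (d2What_prob : forall eta : R, 0 < eta ->
     (fun n : nat => fine (P [set w | (eta%:E <
        supdist nrm N (hessian (vec (What n w))) (hessian (vec W)))%E]))
     =o_\oo (fun n : nat => n%:R^-1 : R))
  (Whatm_diff : forall n m w, (0 < n)%N ->
     differentiable_on N (vec (Whatm n m w)))
  (dWhatm_moment : bounded_moments P [set nm | (0 < nm.1)%N] 3
     (fun (nm : nat * nat) w => ((phi nm.2)%:E *
        supdist nrm N (jacobian (vec (Whatm nm.1 nm.2 w)))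
                        (jacobian (vec (What nm.1 w))))%E))
  (* the continuous updating estimators *)
  (thetahat : nat -> {RV P >-> 'rV[R]_d})
  (thetahat_min : forall n w, (0 < n)%N ->
     is_minimizer Theta (cue_objective estW (sample X n w) Phi)
       (thetahat n w))
  (thetahatm : nat -> nat -> {RV P >-> 'rV[R]_d})
  (thetahatm_min : forall n m w, (0 < n)%N ->
     is_minimizer Theta (cue_objective estW (sample X n w) (Phim m (Y w)))
       (thetahatm n m w)) :
  (exists a b : nat * nat -> R,
     [/\ \forall nm \near filter_prod \oo \oo,
           (nm.1%:R%:E * 'E_P[(fun w : Omega =>
              nrm 1%N d (thetahatm nm.1 nm.2 w - thetahat nm.1 w) ^+ 2)%R])%E
           = (a nm + b nm)%:E,
         forall nm : nat * nat, a nm =O_(nm \near filter_prod \oo \oo)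
           (nm.1%:R * phi nm.2 ^- 2 : R) &
         b @ filter_prod \oo \oo --> (0 : R)]) /\
  (* any way of letting n and m tend to infinity with n / phi_m ^ 2 --> 0,
     for instance along m = m(n) *)
  (forall F : set_system (nat * nat), ProperFilter F ->
     F --> filter_prod \oo \oo ->
     nm.1%:R / phi nm.2 ^+ 2 @[nm --> F] --> (0 : R) ->
     root_n_consistent P (nrm 1%N d) F thetahatm theta0 /\
     asymptotic_variance P F thetahatm (invmx (D *m invmx V *m D^T))).
Proof.
have mXX : measurable XX := measurable_open XX_open.
have T0 : Theta theta0 := N_Theta _ N_theta0.
(* The shapes of the values, Jacobians and Hessians of the constraint and of the weight. *)
have [c c0 hc] := common_norm_bound nrm_norm
  [:: (1, k); (d, k); (d, d * k); (k, k); (d, k * k); (d, d * (k * k))]%N.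
have c_Phi (A : 'M[R]_(1, k)) : `|A| <= c * nrm _ _ A by apply: hc; rewrite !inE eqxx ?orbT.
have c_J (A : 'M[R]_(d, k)) : `|A| <= c * nrm _ _ A by apply: hc; rewrite !inE eqxx ?orbT.
have c_H (A : 'M[R]_(d, d * k)) : `|A| <= c * nrm _ _ A by apply: hc; rewrite !inE eqxx ?orbT.
have c_W (A : 'M[R]_(k, k)) : `|A| <= c * nrm _ _ A by apply: hc; rewrite !inE eqxx ?orbT.
have c_JW (A : 'M[R]_(d, k * k)) : `|A| <= c * nrm _ _ A by apply: hc; rewrite !inE eqxx ?orbT.
have c_HW (A : 'M[R]_(d, d * (k * k))) : `|A| <= c * nrm _ _ A by apply: hc; rewrite !inE eqxx ?orbT.
have c0' := ltW c0.
pose F t := zero_off XX (Phi t).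
pose K x := c * (kappa \_ XX) x.
have FE x : F^~ x = if x \in XX then Phi^~ x else cst 0 by exact: zero_off_section.
have KE x : XX x -> K x = c * kappa x by move=> Xx; rewrite /K patchE mem_set.
have K0 x : ~ XX x -> K x = 0 by move=> Xx; rewrite /K patchE memNset// mulr0.
have mkap : measurable_fun setT (kappa \_ XX) by apply: (measurable_restrictT kappa mXX).1.
have K4 : L4 mu K.
  apply: L4Z; apply: L4_of_twelfth_moment => //.
  rewrite integral_mkcond in kappa_12; apply: le_lt_trans kappa_12.
  rewrite le_eqVlt; apply/orP; left; apply/eqP; apply: eq_integral => x _.
  by rewrite /= !patchE; case: ifP => // _; rewrite expr0n.
(* The ball lies in [N], and continuity at theta0 bounds the first two derivatives of [W] on it. *)
have [r1 r1_gt0 [r1N [KW W_le]]] : exists2 r1, 0 < r1 &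
    (forall s, `|s - theta0| < r1 -> N s) /\ exists KW, forall t, `|t - theta0| < r1 ->
      `|jacobian (vec W) t| <= KW /\ `|hessian (vec W) t| <= KW.
  have /nbhs_ballP[r /= r0 hr] : nbhs theta0 N by exact: open_nbhs_nbhs.
  have [_ dJW cHW] := W_C2.
  have [r' r'0 hr'] := locally_bounded (differentiable_continuous (dJW _ N_theta0)).
  have [r'' r''0 hr''] := locally_bounded (cHW _ N_theta0).
  exists (Num.min r (Num.min r' r'')); first by rewrite !lt_min r0 r'0.
  split=> [s|].
    rewrite lt_min => /andP[sr _]; apply: hr.
    by rewrite -ball_normE/= distrC.
  pose K1 := `|vec (jacobian (vec W)) theta0| + 1; pose K2 := `|hessian (vec W) theta0| + 1.
  exists (K1 + K2) => t; rewrite !lt_min => /and3P[_ tr' tr'']; split.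
    rewrite -norm_mxvec; apply: le_trans (hr' _ tr') _.
    by rewrite lerDl addr_ge0.
  by apply: le_trans (hr'' _ tr'') _; rewrite lerDr addr_ge0.
have r1T s : `|s - theta0| < r1 -> Theta s by move=> /r1N; exact: N_Theta.
have mF t j : Theta t -> measurable_fun setT (fun x => F t x 0 j).
  by move=> Tt; apply: measurable_zero_off => //; exact: Phi_meas.
have cF x : {within Theta, continuous (F^~ x)}.
  rewrite FE; case: ifPn => [/set_mem|_]; first exact: Phi_cont.
  by apply: continuous_subspaceT; exact: cst_continuous.
have dominated m n (U : set 'rV[R]_d) (g : 'rV[R]_d -> 'M[R]_(m, n)) x t :
    (forall A : 'M[R]_(m, n), `|A| <= c * nrm _ _ A) -> XX x -> U t ->
    (supnorm nrm U g <= (kappa x)%:E)%E -> `|g t| <= K x.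
  move=> cA Xx Ut gx; rewrite KE// (le_trans (cA _))// ler_wpM2l//.
  exact: supnorm_le gx Ut.
have F_le t x : Theta t -> `|F t x| <= K x.
  move=> Tt; have [Xx|Xx] := pselect (XX x); last first.
    by rewrite K0// /F /zero_off memNset// normr0.
  rewrite /F zero_offE//; have [h _ _] := Phi_kappa x Xx.
  exact: (dominated _ _ Theta (Phi^~ x)).
have dF x t : `|t - theta0| < r1 -> differentiable (F^~ x) t.
  move=> /r1N Nt; rewrite FE; case: ifPn => [/set_mem Xx|_]; last exact: differentiable_cst.
  by have [h _ _] := Phi_C2 x Xx; exact: h.
have JF_le x t : `|t - theta0| < r1 -> `|jacobian (F^~ x) t| <= K x.
  move=> /r1N Nt; rewrite FE; case: ifPn => [/set_mem Xx|/negP Xx].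
    by have [_ h _] := Phi_kappa x Xx; exact: (dominated _ _ N (jacobian (Phi^~ x))).
  by rewrite jacobian_cst normr0 K0// => ?; apply: Xx; exact: mem_set.
have JF_lip x s t : `|s - theta0| < r1 -> `|t - theta0| < r1 ->
    `|jacobian (F^~ x) s - jacobian (F^~ x) t| <= d.+1%:R * K x * `|s - t|.
  move=> sr tr; have KK : 0 <= K x := le_trans (normr_ge0 _) (JF_le x s sr).
  have dK : d%:R * K x * `|s - t| <= d.+1%:R * K x * `|s - t|.
    by rewrite !ler_wpM2r// ler_nat.
  apply: le_trans dK.
  rewrite FE; case: ifPn => [/set_mem Xx|_]; last first.
    rewrite !jacobian_cst subrr normr0. apply: mulr_ge0 => //. apply: mulr_ge0 => //.
  rewrite -[leLHS]norm_mxvec linearB/=.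
  have [_ h _] := Phi_C2 x Xx; have [_ _ h'] := Phi_kappa x Xx.
  apply: (@norm_sub_le_jacobian _ _ _ theta0 r1 (K x) (vec (jacobian (Phi^~ x)))) => //.
    by move=> u /r1N; exact: h.
  by move=> u /r1N Nu; exact: (dominated _ _ N (hessian (Phi^~ x))).
have meanE t : mean_constraint mu F t = mx_integral mu XX (Phi t).
  by apply/matrixP => i j; rewrite mx_integral_zero_off (ord1 i) mxE.
have f_cont : {within Theta, continuous (mean_constraint mu F)}.
  by rewrite (_ : mean_constraint mu F = fun t => mx_integral mu XX (Phi t))//; apply/funext.
have f_uniq t : Theta t -> mean_constraint mu F t = 0 -> t = theta0.
  by move=> Tt; rewrite meanE; exact: theta0_uniq.
have f0 : mean_constraint mu F theta0 = 0 by rewrite meanE.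
have covE t : covariance_mx mu XX (Phi t) = cov_mx mu (fun j x => F t x 0 j).
  exact: covariance_mx_zero_off.
have cov_unit t : Theta t -> cov_mx mu (fun j x => F t x 0 j) \in unitmx.
  by move=> Tt; rewrite -covE; exact: covariance_unit.
have WE t : Theta t -> W t = invmx (cov_mx mu (fun j x => F t x 0 j)).
  by move=> _; rewrite W_def covE.
have DE : mean_jacobian mu theta0 F = D.
  rewrite D_def; apply/matrixP => i j; rewrite [LHS]mxE [RHS]mxE [RHS]Rintegral_mkcond.
  apply: eq_Rintegral => x _; rewrite patchE FE; case: ifP => // _.
  by rewrite jacobian_cst mxE.
have D_rank' : \rank (mean_jacobian mu theta0 F) = d by rewrite DE.
(* The mean constraint vanishes at theta0, so the covariance there is the second moment matrix
   [V]. *)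
have WV : W theta0 = invmx V.
  by rewrite W_def /covariance_mx theta0_zero trmx0 mul0mx subr0 -V_def.
have B_diff n w t : (0 < n)%N -> `|t - theta0| < r1 ->
    differentiable (vec (What n w)) t /\
    differentiable (vec (jacobian (vec (What n w)))) t.
  by move=> n0 /r1N Nt; have [h1 h2 _] := What_C2 n w n0; split; [exact: h1|exact: h2].
pose u1 n w := ((Num.sqrt n%:R)%:E * supdist nrm Theta (What n w) W)%E.
pose u2 n w := ((Num.sqrt n%:R)%:E *
  supdist nrm N (jacobian (vec (What n w))) (jacobian (vec W)))%E.
(* The threshold is the inverse of the norm constant, so that outside this event the Hessians differ
   by at most 1 in the max norm. *)
pose A3 n := [set w | ((c^-1)%:E <
  supdist nrm N (hessian (vec (What n w))) (hessian (vec W)))%E].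
have u1_ge0 n w : (0 <= u1 n w)%E.
  by rewrite mule_ge0 ?lee_fin ?sqrtr_ge0//; exact: supdist_ge0 T0.
have u2_ge0 n w : (0 <= u2 n w)%E.
  by rewrite mule_ge0 ?lee_fin ?sqrtr_ge0//; exact: supdist_ge0 N_theta0.
have B_err n w t : (0 < n)%N -> Theta t ->
    ((Num.sqrt n%:R * `|What n w t - W t|)%:E <= c%:E * u1 n w)%E.
  by move=> _ Tt; apply: scaled_norm_le_supdist => //; exact: sqrtr_ge0.
have G_err n w t : (0 < n)%N -> `|t - theta0| < r1 ->
    ((Num.sqrt n%:R * `|jacobian (vec (What n w)) t - jacobian (vec W) t|)%:E
       <= c%:E * u2 n w)%E.
  move=> _ /r1N Nt; apply: scaled_norm_le_supdist => //; exact: sqrtr_ge0.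
have H_err n w t : (0 < n)%N -> `|t - theta0| < r1 -> ~ A3 n w ->
    `|hessian (vec (What n w)) t - hessian (vec W) t| <= 1.
  move=> _ /r1N Nt /negP; rewrite -leNgt => h.
  have := @scaled_norm_le_of_supdist _ nrm _ _ _ N (hessian (vec (What n w)))
    (hessian (vec W)) t 1 c c^-1 ltr01 c0' c_HW Nt.
  by rewrite mul1e mul1r mulfV ?gt_eqF//; exact.
have sampleE (g g' : 'rV[R]_q -> 'rV[R]_k) n w : (forall x, XX x -> g x = g' x) ->
    empirical_mean (sample X n w) g = empirical_mean (sample X n w) g'.
  move=> gg; congr (_ *: _); apply: eq_bigr => i _.
  by rewrite tnth_mktuple; apply: gg; exact: X_XX.
(* Only the empirical mean is rewritten with the extension, the observations lying in [XX]; the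
   weight keeps the original constraint, since an arbitrary expression may depend on its values
   elsewhere. *)
have objective (G : 'rV[R]_d -> 'rV[R]_q -> 'rV[R]_k) n w (s : 'rV[R]_d) :
    quad (fun t => empirical_mean (sample X n w) (zero_off XX (G t)))
      (fun t => estW n (sample X n w) (G t)) s =
    cue_objective estW (sample X n w) G s.
  by rewrite /quad /bil (@sampleE _ (G s))// => x Xx; rewrite zero_offE.
have minimizer_quad (G : 'rV[R]_d -> 'rV[R]_q -> 'rV[R]_k) n w s :
    is_minimizer Theta (cue_objective estW (sample X n w) G) s ->
    is_minimizer Theta (quad (fun t => empirical_mean (sample X n w) (zero_off XX (G t)))
      (fun t => estW n (sample X n w) (G t))) s.
  by move=> [Ts hs]; split=> // s' Ts'; rewrite !objective; exact: hs.
have th_min n w : (0 < n)%N ->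
    is_minimizer Theta (quad (empirical_constraint X F n w) (What n w)) (thetahat n w).
  by move=> n0; rewrite What_def; apply: minimizer_quad; exact: thetahat_min.
pose F' m w t := zero_off XX (Phim m (Y w) t).
have F'E m w x : (F' m w)^~ x = if x \in XX then (Phim m (Y w))^~ x else cst 0.
  exact: zero_off_section.
pose Km m x := c * (kappam m \_ XX) x.
have KmE m x : XX x -> Km m x = c * kappam m x by move=> Xx; rewrite /Km patchE mem_set.
have Km0 m x : ~ XX x -> Km m x = 0 by move=> Xx; rewrite /Km patchE memNset// mulr0.
(* The scale phi is positive only from some index on, which is enough as m tends to infinity. *)
have [m0 _ phi0] := (cvgryPgt phi).1 phi_oo 0.
have phi_gt0 m : (m0 <= m)%N -> 0 < phi m by move=> mm0; exact: phi0.
have F'_err m w x t : (m0 <= m)%N -> Theta t -> phi m * `|F' m w t x - F t x| <= Km m x.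
  move=> mm0 Tt; have [Xx|Xx] := pselect (XX x); last first.
    by rewrite Km0// /F' /F /zero_off memNset// subr0 normr0 mulr0.
  rewrite KmE// /F' /F !zero_offE//; have [h _] := Phim_kappam m w x Xx.
  exact: (scaled_norm_le_of_supdist (phi_gt0 _ mm0) c0' c_Phi Tt h).
have dF' m w x t : `|t - theta0| < r1 -> differentiable ((F' m w)^~ x) t.
  move=> /r1N Nt; rewrite F'E; case: ifPn => [/set_mem Xx|_]; last exact: differentiable_cst.
  exact: Phim_diff.
have J'_err m w x t : (m0 <= m)%N -> `|t - theta0| < r1 ->
    phi m * `|jacobian ((F' m w)^~ x) t - jacobian (F^~ x) t| <= Km m x.
  move=> mm0 /r1N Nt; rewrite F'E FE; case: ifPn => [/set_mem Xx|/negP Xx]; last first.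
    by rewrite subrr normr0 mulr0 Km0// => ?; apply: Xx; exact: mem_set.
  rewrite KmE//; have [_ h] := Phim_kappam m w x Xx.
  exact: (scaled_norm_le_of_supdist (phi_gt0 _ mm0) c0' c_J Nt h).
pose q1 n m w := ((phi m)%:E * supdist nrm Theta (Whatm n m w) (What n w))%E.
pose q2 n m w := ((phi m)%:E *
  supdist nrm N (jacobian (vec (Whatm n m w))) (jacobian (vec (What n w))))%E.
have q1_ge0 n m w : (m0 <= m)%N -> (0 <= q1 n m w)%E.
  move=> mm0; rewrite mule_ge0 ?lee_fin ?(ltW (phi_gt0 _ mm0))//.
  exact: supdist_ge0 T0.
have q2_ge0 n m w : (m0 <= m)%N -> (0 <= q2 n m w)%E.
  move=> mm0; rewrite mule_ge0 ?lee_fin ?(ltW (phi_gt0 _ mm0))//.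
  exact: supdist_ge0 N_theta0.
have B'_err n m w t : (0 < n)%N -> (m0 <= m)%N -> Theta t ->
    ((phi m * `|Whatm n m w t - What n w t|)%:E <= c%:E * q1 n m w)%E.
  by move=> _ mm0 Tt; apply: scaled_norm_le_supdist => //; exact/ltW/phi_gt0.
have dB' n m w t : (0 < n)%N -> `|t - theta0| < r1 -> differentiable (vec (Whatm n m w)) t.
  by move=> n0 /r1N; exact: Whatm_diff.
have G'_err n m w t : (0 < n)%N -> (m0 <= m)%N -> `|t - theta0| < r1 ->
    ((phi m * `|jacobian (vec (Whatm n m w)) t - jacobian (vec (What n w)) t|)%:E
       <= c%:E * q2 n m w)%E.
  by move=> _ mm0 /r1N Nt; apply: scaled_norm_le_supdist => //; exact/ltW/phi_gt0.
have thm_min n m w : (0 < n)%N -> is_minimizer Theta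
    (quad (approximate_constraint X F' n m w) (Whatm n m w)) (thetahatm n m w).
  by move=> n0; rewrite Whatm_def; apply: minimizer_quad; exact: thetahatm_min.
have [mu1 [M1 iu1]] := What_moment; have [mu2 [M2 iu2]] := dWhat_moment.
have [mq1 [M3 iq1]] := Whatm_moment; have [mq2 [M4 iq2]] := dWhatm_moment.
have [M5 hM5] := kappam_12.
pose M6 := c ^+ 2 * (1 + M5).
pose M := `|M1| + (`|M2| + (`|M3| + (`|M4| + `|M6|))).
have M0 : 0 <= M by rewrite !addr_ge0.
have M1M : M1 <= M by rewrite (le_trans (ler_norm _))// lerDl !addr_ge0.
have M2M : M2 <= M.
  by rewrite (le_trans (ler_norm _))// /M addrCA lerDl !addr_ge0.
have M3M : M3 <= M.
  by rewrite (le_trans (ler_norm _))// /M addrA addrCA lerDl !addr_ge0.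
have M4M : M4 <= M.
  by rewrite (le_trans (ler_norm _))// /M addrA addrA addrCA lerDl !addr_ge0.
have M6M : M6 <= M.
  by rewrite (le_trans (ler_norm _))// /M addrA addrA addrA lerDr !addr_ge0.
have bnd (Z : Omega -> \bar R) j (a : R) : a <= M -> (\int[P]_w (Z w ^+ j) <= a%:E)%E ->
    (\int[P]_w (Z w ^+ j) <= M%:E)%E.
  by move=> aM /le_trans; apply; rewrite lee_fin.
have iu1' n : (0 < n)%N -> (\int[P]_w (u1 n w ^+ 6) <= M%:E)%E.
  by move=> n0; apply: (bnd _ _ _ M1M); exact: (iu1 n n0).
have iu2' n : (0 < n)%N -> (\int[P]_w (u2 n w ^+ 6) <= M%:E)%E.
  by move=> n0; apply: (bnd _ _ _ M2M); exact: (iu2 n n0).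
have iq1' n m : (0 < n)%N -> (m0 <= m)%N -> (\int[P]_w (q1 n m w ^+ 3) <= M%:E)%E.
  by move=> n0 _; apply: (bnd _ _ _ M3M); exact: (iq1 (n, m) n0).
have iq2' n m : (0 < n)%N -> (m0 <= m)%N -> (\int[P]_w (q2 n m w ^+ 3) <= M%:E)%E.
  by move=> n0 _; apply: (bnd _ _ _ M4M); exact: (iq2 (n, m) n0).
have mq1' n m : (0 < n)%N -> measurable_fun setT (q1 n m).
  by move=> n0; exact: (mq1 (n, m) n0).
have mq2' n m : (0 < n)%N -> measurable_fun setT (q2 n m).
  by move=> n0; exact: (mq2 (n, m) n0).
have mA3 n : (0 < n)%N -> measurable (A3 n).
  move=> n0; rewrite -[A3 n]setTI; apply: emeasurable_fun_o_infty => //.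
  exact: d2What_meas.
have A3_prob : n%:R * fine (P (A3 n)) @[n --> \oo] --> (0 : R).
  have ci0 : 0 < c^-1 by rewrite invr_gt0.
  have /eqoP ho := d2What_prob _ ci0.
  apply/cvgrPdist_le => e e0; near=> n.
  have n0 : (0 < n)%N by near: n; exists 1%N.
  have : `|fine (P (A3 n))| <= e * `|n%:R^-1| by near: n; exact: ho.
  rewrite sub0r normrN normrM normfV ger0_norm// => h.
  by rewrite mulrC -ler_pdivlMr ?ltr0n.
have mkm m : measurable_fun setT (kappam m \_ XX) by apply: (measurable_restrictT (kappam m) mXX).1.
have mKm m : measurable_fun setT (Km m) by apply: measurable_funM => //; exact: measurable_cst.
have Km2 m : mu.-integrable setT (EFin \o (fun x => Km m x ^+ 2)) /\
    \int[mu]_x (Km m x ^+ 2) <= M.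
  have h : (\int[mu]_x ((kappam m \_ XX) x ^+ 12)%:E <= M5%:E)%E.
    apply: le_trans (hM5 m); rewrite [leRHS]integral_mkcond.
    rewrite le_eqVlt; apply/orP; left; apply/eqP; apply: eq_integral => x _.
    by rewrite /= !patchE; case: ifP => // _; rewrite expr0n.
  have [i2 le2] := sqr_of_twelfth_moment (mkm m) h.
  have KmX : (fun x => Km m x ^+ 2) = (fun x => c ^+ 2 * (kappam m \_ XX) x ^+ 2).
    by apply/funext => x; rewrite /Km exprMn.
  rewrite KmX; split; first exact: integrable_EFinZl.
  rewrite RintegralZl//; apply: le_trans M6M.
  by rewrite ler_wpM2l// sqr_ge0.
have [delta [C [n_delta delta0 C0 th_v thm_th]]] := mean_square_errors X_iid Theta_compact
  r1_gt0 r1T K4 mF cF F_le dF JF_le JF_lip f_cont f_uniq f0 cov_unit WE D_rank' W_le B_diff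
  c0' M0 u1_ge0 u2_ge0 B_err G_err H_err th_min phi_gt0 F'_err dF' J'_err q1_ge0 q2_ge0
  B'_err dB' G'_err thm_min mu1 mu2 iu1' iu2' mq1' mq2' iq1' iq2' mA3 A3_prob mKm
  (fun m => (Km2 m).1) (fun m => (Km2 m).2).
have [KT KT0 TKT] := compact_norm_bounded Theta_compact.
(* The estimators take values in the compact [Theta], so their moments exist automatically. *)
have L4_bounded (Z : Omega -> 'rV[R]_d) i : measurable_fun setT Z ->
    (forall w, Theta (Z w)) -> L4 P (fun w => Z w 0 i).
  move=> mZ TZ; apply: (L4_le (L4_cst P KT)); first exact: measurable_entry.
  by move=> w; rewrite (le_trans (ler_norm_entry _ _ _))// TKT.
have th4 n i : (0 < n)%N -> L4 P (fun w => thetahat n w 0 i).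
  by move=> n0; apply: L4_bounded => // w; have [] := th_min n w n0.
have thm4 n m i : (0 < n)%N -> L4 P (fun w => thetahatm n m w 0 i).
  by move=> n0; apply: L4_bounded => // w; have [] := thm_min n m w n0.
pose v := influence_term mu X theta0 F W.
have v4 n i : (0 < n)%N -> L4 P (fun w => v n w 0 i).
  by move=> _; exact: (L4_influence_term X_iid r1_gt0 r1T K4 mF F_le f0).
have v_mean n i : (0 < n)%N -> \int[P]_w v n w 0 i = 0.
  by move=> n0; exact: (influence_term_mean X_iid r1_gt0 r1T K4 mF F_le f0).
have v_cov n i j : (0 < n)%N -> n%:R * \int[P]_w (v n w 0 i * v n w 0 j) =
    invmx (D *m invmx V *m D^T) i j.
  move=> n0; rewrite -DE -WV.
  exact: (influence_term_covariance X_iid r1_gt0 r1T K4 mF F_le f0 cov_unit WE D_rank').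
split.
  exact: (approximation_error (nrm_norm 1 d) C0 phi_gt0 n_delta delta0 th4 thm4 thm_th).
move=> G PG G_oo G_phi; split.
  apply: (root_n_consistency (nrm_norm 1 d) n_delta th4 thm4 v4 th_v thm_th v_cov PG G_oo G_phi).
  by move=> n m; exact: measurable_funP.
exact: (asymptotically_efficient n_delta th4 thm4 v4 th_v thm_th v_mean v_cov PG G_oo G_phi).
Unshelve. all: by end_near.
Qed.
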